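(* For each prime $p$ and every positive integer $d$, there exists a continuum of abstract isomorphism classes (i.e., $2^{\aleph_0}$ classes up to isomorphism of abstract groups) of second countable, topologically simple $p$-adic Lie groups of dimension $d$ whose Lie algebras are abelian.
   Context: A topological group is topologically simple if it is non-trivial and has no non-trivial proper closed normal subgroups. A $p$-adic Lie group is a Lie group (analytic group) over the field $\mathbf{Q}_p$ of $p$-adic numbers; its Lie algebra $L(G)$ is a finite-dimensional Lie algebra over $\mathbf{Q}_p$, and the dimension of $G$ is $\dim_{\mathbf{Q}_p} L(G)$. Two topological groups are in the same abstract isomorphism class if they are isomorphic as groups, ignoring the topologies. *)

(* Defs.v *)
From HB Require Import structures.
From mathcomp Require Import all_boot all_order all_algebra.
From mathcomp Require Import generic_quotient ring_quotient.
From mathcomp Require Import ring lra.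
From mathcomp Require Import all_classical topology.

Set Implicit Arguments.
Unset Strict Implicit.
Unset Printing Implicit Defensive.

Import Order.TTheory GRing.Theory Num.Theory.

Local Open Scope classical_set_scope.
Local Open Scope ring_scope.
Local Open Scope quotient_scope.

Definition padic_abs (p : nat) (x : rat) : rat :=
  if x == 0 then 0
  else p%:R ^ ((logn p `|denq x|)%:Z - (logn p `|numq x|)%:Z).

Section PadicAbs.
Variables (p : nat) (p_pr : prime p).
Local Notation abs := (padic_abs p).
Let p_gt0 : (0 < p%:R :> rat). Proof. by rewrite ltr0n prime_gt0. Qed.
Let p_ge1 : (1 <= p%:R :> rat). Proof. by rewrite ler1n prime_gt0. Qed.
Let p_neq0 : (p%:R != 0 :> rat). Proof. by rewrite gt_eqF. Qed.

Lemma padic_abs0 : abs 0 = 0. Proof. by rewrite /padic_abs eqxx. Qed.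

Lemma padic_abs_gt0 x : x != 0 -> 0 < abs x.
Proof. by rewrite /padic_abs => /negPf->; rewrite exprz_gt0. Qed.

Lemma padic_abs_ge0 x : 0 <= abs x.
Proof.
by have [->|/padic_abs_gt0/ltW//] := eqVneq x 0; rewrite padic_abs0.
Qed.

Lemma padic_abs_eq0 x : (abs x == 0) = (x == 0).
Proof.
have [->|x0] := eqVneq x 0; first by rewrite padic_abs0 eqxx.
by rewrite gt_eqF // padic_abs_gt0.
Qed.

Lemma padic_absE (a b : int) : a != 0 -> b != 0 ->
  abs (a%:~R / b%:~R) = p%:R ^ ((logn p `|b|)%:Z - (logn p `|a|)%:Z).
Proof.
move=> a0 b0; set x : rat := _ / _.
have x0 : x != 0 by rewrite mulf_neq0 ?invr_eq0 ?intr_eq0.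
rewrite /padic_abs (negPf x0); congr (_ ^ _).
have e : numq x * b = a * denq x.
  apply: (@intr_inj rat); rewrite !rmorphM /=.
  have dx0 : (denq x)%:~R != 0 :> rat by rewrite intr_eq0 denq_neq0.
  have b0' : b%:~R != 0 :> rat by rewrite intr_eq0.
  have := divq_num_den x; rewrite -[in RHS]/x => /(canRL (divfK dx0)) ->.
  by rewrite mulrAC /x divfK.
have := congr1 (fun z => logn p `|z|%N) e.
rewrite !abszM !lognM ?absz_gt0 ?numq_eq0 ?denq_neq0 // => {}e.
apply/eqP; rewrite subr_eq addrAC -subr_eq opprK eq_sym -!PoszD addnC.
by rewrite e addnC.
Qed.

Lemma padic_abs1 : abs 1 = 1.
Proof. by have := @padic_absE 1 1 isT isT; rewrite divff // subrr expr0z. Qed.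

Lemma ratP_int (x : rat) : x != 0 ->
  exists a b : int, [/\ a != 0, b != 0 & x = a%:~R / b%:~R].
Proof.
move=> x0; exists (numq x), (denq x).
by rewrite numq_eq0 denq_neq0 divq_num_den.
Qed.

Lemma padic_absM x y : abs (x * y) = abs x * abs y.
Proof.
have [->|x0] := eqVneq x 0; first by rewrite mul0r padic_abs0 mul0r.
have [->|y0] := eqVneq y 0; first by rewrite mulr0 padic_abs0 mulr0.
have [a [b [a0 b0 ->]]] := ratP_int x0.
have [c [e [c0 e0 ->]]] := ratP_int y0.
rewrite mulrACA -invfM -!rmorphM /= !padic_absE ?mulf_neq0 //.
rewrite !abszM !lognM ?absz_gt0 // -expfzDr // !PoszD; congr (_ ^ _).
by rewrite opprD addrACA.
Qed.

Lemma padic_absN x : abs (- x) = abs x.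
Proof.
have [->|x0] := eqVneq x 0; first by rewrite oppr0.
have [a [b [a0 b0 ->]]] := ratP_int x0.
by rewrite -mulNr -rmorphN /= !padic_absE ?oppr_eq0 // abszN.
Qed.

Lemma padic_absB x y : abs (x - y) = abs (y - x).
Proof. by rewrite -padic_absN opprB. Qed.

Lemma padic_absV x : abs x^-1 = (abs x)^-1.
Proof.
have [->|x0] := eqVneq x 0; first by rewrite !(invr0, padic_abs0).
have ax0 : abs x != 0 by rewrite padic_abs_eq0.
by apply: (mulfI ax0); rewrite -padic_absM !divff // padic_abs1.
Qed.

Lemma padic_absD x y : abs (x + y) <= Num.max (abs x) (abs y).
Proof.
have [->|x0] := eqVneq x 0; first by rewrite add0r le_max lexx orbT.
have [->|y0] := eqVneq y 0; first by rewrite addr0 le_max lexx.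
have [xy0|] := eqVneq (x + y) 0; first by rewrite xy0 padic_abs0 le_max padic_abs_ge0.
have [a [b [a0 b0 ->]]] := ratP_int x0.
have [c [e [c0 e0 ->]]] := ratP_int y0.
have b0' : b%:~R != 0 :> rat by rewrite intr_eq0.
have e0' : e%:~R != 0 :> rat by rewrite intr_eq0.
rewrite addf_div // -!rmorphM -rmorphD /= mulf_eq0 negb_or intr_eq0 => /andP[s0 _].
have -> : a%:~R / b%:~R = (a * e)%:~R / (b * e)%:~R :> rat.
  by rewrite !rmorphM /=; field; rewrite b0' e0'.
have -> : c%:~R / e%:~R = (c * b)%:~R / (b * e)%:~R :> rat.
  by rewrite !rmorphM /=; field; rewrite b0' e0'.
rewrite !padic_absE ?mulf_neq0 //.
have mon (m n : int) : m <= n -> p%:R ^ m <= p%:R ^ n :> rat.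
  by move=> mn; apply: ler_weXz2l.
have key (A B : int) : A != 0 -> B != 0 -> A + B != 0 ->
    (minn (logn p (absz A)) (logn p (absz B)) <= logn p (absz (A + B)%R))%N.
  move=> A0 B0 AB0; rewrite -pfactor_dvdn ?absz_gt0 //.
  suff : ((p ^ minn (logn p (absz A)) (logn p (absz B)))%:Z %| A + B)%Z by [].
  by apply: rpredD; rewrite dvdzE /= pfactor_dvdn ?absz_gt0 // ?geq_minl ?geq_minr.
have := key (a * e) (c * b); rewrite !mulf_neq0 // => /(_ isT isT s0).
rewrite le_max geq_min => {key}/orP[] h; apply/orP; [left|right];
  by apply: mon; rewrite lerD2l lerN2 lez_nat.
Qed.

Lemma padic_absD_le x y : abs (x + y) <= abs x + abs y.
Proof.
apply: (le_trans (padic_absD x y)).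
by rewrite ge_max lerDl lerDr !padic_abs_ge0.
Qed.

Lemma padic_abs_dist x y : `|abs x - abs y| <= abs (x - y).
Proof.
have h1 := padic_absD_le (x - y) y; have h2 := padic_absD_le (y - x) x.
rewrite !subrK (padic_absB y) in h1 h2.
by rewrite ler_norml; apply/andP; split; lra.
Qed.

End PadicAbs.

Definition padic_cauchy (p : nat) (p_pr : prime p) : {pred nat -> rat} :=
  fun u => `[< forall e : rat, 0 < e -> exists N, forall m n,
    (N <= m)%N -> (N <= n)%N -> padic_abs p (u m - u n) < e >].

Section CauchyRing.
Variables (p : nat) (p_pr : prime p).
Local Notation abs := (padic_abs p).
Local Notation cauchy := (padic_cauchy p_pr).

Lemma padic_cauchy_bounded u : u \in cauchy ->
  exists2 C : rat, 0 < C & exists N, forall n, (N <= n)%N -> abs (u n) <= C.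
Proof.
move=> /asboolP /(_ 1 ltr01)[N uN]; exists (abs (u N) + 1).
  by rewrite ltr_wpDl // padic_abs_ge0.
exists N => n Nn; rewrite -(subrK (u N) (u n)) addrC.
by rewrite (le_trans (padic_absD_le p_pr _ _)) // lerD2l ltW // uN.
Qed.

Fact padic_cauchy_subring : subring_closed cauchy.
Proof.
split.
- apply/asboolP => e e0; exists 0%N => m n _ _.
  by rewrite subrr padic_abs0.
- move=> u v /asboolP uC /asboolP vC; apply/asboolP => e e0.
  have e20 : 0 < e / 2 by rewrite divr_gt0.
  have [[M uM] [N vN]] := (uC _ e20, vC _ e20).
  exists (maxn M N) => m n; rewrite !geq_max => /andP[Mm Nm] /andP[Mn Nn].
  have -> : (u - v) m - (u - v) n = (u m - u n) + (v n - v m).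
    by rewrite !fctE; ring.
  by rewrite (le_lt_trans (padic_absD_le p_pr _ _)) // (splitr e) ltrD ?uM ?vN.
- move=> u v uC vC; apply/asboolP => e e0.
  have [C C0 [M1 uC1]] := padic_cauchy_bounded uC.
  have [D D0 [N1 vD1]] := padic_cauchy_bounded vC.
  move: uC vC => /asboolP uC /asboolP vC.
  have e20 : 0 < e / 2 by rewrite divr_gt0.
  have [[M uM] [N vN]] := (uC _ (divr_gt0 e20 D0), vC _ (divr_gt0 e20 C0)).
  exists (maxn (maxn M N) (maxn M1 N1)) => m n.
  rewrite !geq_max => /andP[/andP[Mm Nm] /andP[M1m N1m]].
  move=> /andP[/andP[Mn Nn] /andP[M1n N1n]].
  have -> : (u * v) m - (u * v) n = u m * (v m - v n) + (u m - u n) * v n.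
    by rewrite !fctE; ring.
  rewrite (le_lt_trans (padic_absD_le p_pr _ _)) // (splitr e) !padic_absM //.
  have eC : e / 2 = C * (e / 2 / C) by rewrite [RHS]mulrC divfK ?gt_eqF.
  have eD : e / 2 = (e / 2 / D) * D by rewrite [RHS]divfK ?gt_eqF.
  rewrite ltrD //.
    rewrite [ltRHS]eC (le_lt_trans (ler_wpM2r (padic_abs_ge0 p_pr _) (uC1 _ M1m))) //.
    by rewrite ltr_pM2l // vN.
  rewrite [ltRHS]eD (le_lt_trans (ler_wpM2l (padic_abs_ge0 p_pr _) (vD1 _ N1n))) //.
  by rewrite ltr_pM2r // uM.
Qed.

HB.instance Definition _ :=
  GRing.isSubringClosed.Build (nat -> rat) cauchy padic_cauchy_subring.

End CauchyRing.

Record padic_cauchy_seq (p : nat) (p_pr : prime p) := PadicCauchySeq {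
  padic_seq :> nat -> rat;
  _ : padic_seq \in padic_cauchy p_pr }.

HB.instance Definition _ p (p_pr : prime p) :=
  [isSub for @padic_seq p p_pr].
HB.instance Definition _ p (p_pr : prime p) :=
  [Choice of padic_cauchy_seq p_pr by <:].
HB.instance Definition _ p (p_pr : prime p) :=
  [SubChoice_isSubComNzRing of padic_cauchy_seq p_pr by <:].

Definition padic_null (p : nat) (p_pr : prime p) :
    {pred padic_cauchy_seq p_pr} :=
  fun u => `[< forall e : rat, 0 < e -> exists N, forall n,
    (N <= n)%N -> padic_abs p (u n) < e >].

Section NullIdeal.
Variables (p : nat) (p_pr : prime p).
Local Notation abs := (padic_abs p).
Local Notation null := (padic_null (p_pr := p_pr)).

Fact padic_null_idealr : idealr_closed null.
Proof.
split.
- by apply/asboolP => e e0; exists 0%N => n _; rewrite /= padic_abs0.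
- apply/asboolP => /(_ 1 ltr01)[N /(_ N (leqnn N))].
  by rewrite /= padic_abs1 // ltxx.
- move=> a u v /asboolP u0 /asboolP v0; apply/asboolP => e e0.
  have [C C0 [M aC]] := padic_cauchy_bounded (valP a).
  have e20 : 0 < e / 2 by rewrite divr_gt0.
  have [[N1 uN] [N2 vN]] := (u0 _ (divr_gt0 e20 C0), v0 _ e20).
  exists (maxn M (maxn N1 N2)) => n.
  rewrite !geq_max => /and3P[Mn N1n N2n].
  rewrite (le_lt_trans (padic_absD_le p_pr _ _)) // (splitr e).
  rewrite ltrD ?vN // padic_absM //.
  have -> : e / 2 = C * (e / 2 / C) by rewrite [RHS]mulrC divfK ?gt_eqF.
  rewrite (le_lt_trans (ler_wpM2r (padic_abs_ge0 p_pr _) (aC _ Mn))) //.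
  by rewrite ltr_pM2l // uN.
Qed.

HB.instance Definition _ := isIdealr.Build _ null padic_null_idealr.

Lemma padic_notnull u : u \notin null ->
  exists2 c : rat, 0 < c & exists N, forall n, (N <= n)%N -> abs (u n) = c.
Proof.
move=> /asboolPn /existsNP[e /not_implyP[e0 /forallNP uN]].
have /asboolP/(_ e e0)[N uC] := valP u.
have /existsNP[M /not_implyP[NM /negP]] := uN N.
rewrite -leNgt => eM; exists (abs (u M)); first exact: lt_le_trans eM.
exists N => n Nn; apply/eqP; rewrite eq_le; apply/andP; split.
  rewrite -(subrK (u M) (u n)) (le_trans (padic_absD p_pr _ _)) //.
  by rewrite ge_max lexx andbT (le_trans _ eM) // ltW // uC.
have := padic_absD p_pr (u M - u n) (u n); rewrite subrK le_max => /orP[|//].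
by move/(le_trans eM); rewrite leNgt uC.
Qed.

End NullIdeal.

Definition Qp (p : nat) (p_pr : prime p) := {ideal_quot (@padic_null p p_pr)}.

HB.instance Definition _ p (p_pr : prime p) := GRing.ComNzRing.on (Qp p_pr).

Section QpField.
Variables (p : nat) (p_pr : prime p).
Local Notation K := (Qp p_pr).

Definition Qp_inv (x : K) : K := xget 0 [set y | y * x = 1].

Fact Qp_mulVf x : x != 0 -> Qp_inv x * x = 1.
Proof.
move=> x0; rewrite /Qp_inv; case: xgetP => [y -> //|nox]; exfalso.
move: x0 nox; rewrite -[x]reprK; set u := repr x => u0 nou.
have {}u0 : u \notin @padic_null p p_pr.
  apply: contraNN u0 => un; have -> : (0 : K) = \pi_K 0 by rewrite piE.
  by rewrite -Quotient.idealrBE subr0.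
have [c c0 [N uc]] := padic_notnull u0.
have vC : (fun n => (u n)^-1) \in padic_cauchy p_pr.
  have /asboolP uC := valP u.
  apply/asboolP => e e0; have [M uM] := uC (e * (c * c)) (mulr_gt0 e0 (mulr_gt0 c0 c0)).
  exists (maxn M N) => m n; rewrite !geq_max => /andP[Mm Nm] /andP[Mn Nn].
  have um0 : u m != 0 by rewrite -(padic_abs_eq0 p_pr) uc // gt_eqF.
  have un0 : u n != 0 by rewrite -(padic_abs_eq0 p_pr) uc // gt_eqF.
  have -> : (u m)^-1 - (u n)^-1 = (u n - u m) * ((u m)^-1 * (u n)^-1).
    by field; rewrite um0 un0.
  rewrite !padic_absM // !padic_absV // !uc // -invfM.
  by rewrite ltr_pdivrMr ?mulr_gt0 // uM.
apply: (nou (\pi_K (PadicCauchySeq vC))).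
change ((\pi_K (PadicCauchySeq vC) : K) * \pi_K u = 1).
have -> : (1 : K) = \pi_K 1 by rewrite piE.
have -> : (\pi_K (PadicCauchySeq vC) : K) * \pi_K u = \pi_K (PadicCauchySeq vC * u).
  by rewrite piE.
apply/eqP; rewrite -Quotient.idealrBE; apply/asboolP => e e0; exists N => n Nn.
have un0 : u n != 0 by rewrite -(padic_abs_eq0 p_pr) uc // gt_eqF.
by rewrite /= !fctE mulVf // subrr padic_abs0.
Qed.

Fact Qp_inv0 : Qp_inv 0 = 0.
Proof. by rewrite /Qp_inv; case: xgetP => // y _ /eqP; rewrite mulr0 eq_sym oner_eq0. Qed.

End QpField.

HB.instance Definition _ p (p_pr : prime p) :=
  GRing.ComNzRing_isField.Build (Qp p_pr) (@Qp_mulVf p p_pr) (Qp_inv0 p_pr).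

(* The absolute values of a Cauchy sequence converge in rat: they tend to 0 or *)
(* are eventually constant. *)
Definition Qp_abs (p : nat) (p_pr : prime p) (x : Qp p_pr) : rat :=
  lim ((padic_abs p (repr x n) : rat^o) @[n --> \oo]).

Section QpAbs.
Variables (p : nat) (p_pr : prime p).
Local Notation K := (Qp p_pr).
Local Notation abs := (padic_abs p).
Local Notation null := (padic_null (p_pr := p_pr)).
Local Notation absK := (@Qp_abs p p_pr).

Let abs_repr_cvg (x : K) : forall e : rat, 0 < e ->
  exists N, forall n, (N <= n)%N -> `|absK x - abs (repr x n)| < e.
Proof.
suff [l ul] : exists l : rat, forall e : rat, 0 < e ->
    exists N, forall n, (N <= n)%N -> `|l - abs (repr x n)| < e.
  suff -> : absK x = l by [].
  apply: (@cvg_lim _ (metric_hausdorff (T := rat^o))).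
  by apply/cvg_ballP => e /ul[N uN]; exists N.
have [un|/padic_notnull[c c0 [N uc]]] := boolP (repr x \in null); last first.
  by exists c => e e0; exists N => n Nn; rewrite uc // subrr normr0.
exists 0 => e e0; move/asboolP: un => /(_ e e0)[N uN]; exists N => n Nn.
by rewrite sub0r normrN ger0_norm ?padic_abs_ge0 // uN.
Qed.

Lemma Qp_abs_pi (u : padic_cauchy_seq p_pr) (e : rat) : 0 < e ->
  exists N, forall n, (N <= n)%N -> `|absK (\pi u) - abs (u n)| < e.
Proof.
move=> e0; have e20 : 0 < e / 2 by rewrite divr_gt0.
set v := repr (\pi_K u).
have [N vN] := abs_repr_cvg (\pi_K u) e20.
have /asboolP/(_ _ e20)[M uvM] : u - v \in null by rewrite Quotient.idealrBE reprK.
exists (maxn M N) => n; rewrite geq_max => /andP[Mn Nn].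
rewrite -(subrKA (abs (v n))) (le_lt_trans (ler_normD _ _)) // (splitr e).
rewrite ltrD ?vN // (le_lt_trans _ (uvM n Mn)) //= padic_absB //.
exact: padic_abs_dist.
Qed.

Lemma Qp_abs0 : absK 0 = 0.
Proof.
apply/eqP; rewrite -normr_le0; apply/ler_addgt0Pr => e e0; rewrite add0r.
have [N /(_ N (leqnn N))] := Qp_abs_pi 0 e0.
by rewrite piE /= padic_abs0 subr0 => /ltW.
Qed.

Lemma Qp_abs_eq0 x : absK x = 0 -> x = 0.
Proof.
move=> x0; rewrite -[x]reprK (_ : (0 : K) = \pi_K 0); last by rewrite piE.
apply/eqP; rewrite -Quotient.idealrBE subr0.
apply/asboolP => e e0; have [N xN] := Qp_abs_pi (repr x) e0.
exists N => n /xN; rewrite reprK x0 sub0r normrN ger0_norm //.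
exact: padic_abs_ge0.
Qed.

Lemma Qp_absN x : absK (- x) = absK x.
Proof.
apply/eqP; rewrite -subr_eq0 -normr_le0; apply/ler_addgt0Pr => e e0; rewrite add0r.
have e20 : 0 < e / 2 by rewrite divr_gt0.
have [M xM] := Qp_abs_pi (repr x) e20.
have [N yN] := Qp_abs_pi (- repr x) e20.
have := xM _ (leq_maxl M N); have := yN _ (leq_maxr M N).
set n := maxn M N; rewrite reprK /= padic_absN // => h1 h2.
rewrite -[x in - x]reprK (_ : - \pi_K (repr x) = \pi_K (- repr x)); last by rewrite piE.
rewrite -(subrKA (abs (repr x n))) (le_trans (ler_normD _ _)) // (splitr e).
by rewrite lerD ?ltW // distrC.
Qed.

Lemma Qp_absD x y : absK (x + y) <= absK x + absK y.
Proof.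
apply/ler_addgt0Pr => e e0.
have e30 : 0 < e / 3 by rewrite divr_gt0.
have [M xM] := Qp_abs_pi (repr x) e30.
have [N yN] := Qp_abs_pi (repr y) e30.
have [P zP] := Qp_abs_pi (repr x + repr y) e30.
have := xM (maxn M (maxn N P)) (leq_maxl _ _).
have := yN (maxn M (maxn N P)); rewrite !leq_max leqnn orbT => /(_ isT).
have := zP (maxn M (maxn N P)); rewrite !leq_max leqnn !orbT => /(_ isT).
set n := maxn _ _.
have -> : \pi_K (repr x + repr y) = x + y.
  by rewrite -[x in RHS]reprK -[y in RHS]reprK !piE.
rewrite !reprK /= !ltr_norml => /andP[_ h1] /andP[h2 _] /andP[h3 _].
have := padic_absD_le p_pr (repr x n) (repr y n).
move: h1 h2 h3; rewrite fctE.
lra.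
Qed.

Definition Qp_dist (x y : K) : rat := absK (x - y).

Fact Qp_distxx x : Qp_dist x x = 0.
Proof. by rewrite /Qp_dist subrr Qp_abs0. Qed.

Fact Qp_dist_eq0 x y : Qp_dist x y = 0 -> x = y.
Proof. by move=> /Qp_abs_eq0/subr0_eq. Qed.

Fact Qp_dist_sym x y : Qp_dist x y = Qp_dist y x.
Proof. by rewrite /Qp_dist -Qp_absN opprB. Qed.

Fact Qp_dist_triangle y x z : Qp_dist x z <= Qp_dist x y + Qp_dist y z.
Proof. by rewrite /Qp_dist -(subrKA y) Qp_absD. Qed.

End QpAbs.

HB.instance Definition _ p (p_pr : prime p) := isMetric.Build rat (Qp p_pr)
  (@Qp_distxx p p_pr) (@Qp_dist_eq0 p p_pr) (@Qp_dist_sym p p_pr)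
  (@Qp_dist_triangle p p_pr).

Section Analytic.
Variables (p : nat) (p_pr : prime p).
Local Notation K := (Qp p_pr).

Definition mdegree n (a : {ffun 'I_n -> nat}) : nat := (\sum_i a i)%N.

Definition monomial n (a : {ffun 'I_n -> nat}) (h : 'rV[K]_n) : K :=
  \prod_i h 0 i ^+ a i.

(* Since terms tending to 0 are unconditionally summable in Qp, the sum can be *)
(* taken along the boxes of exponents below N. *)
Definition has_power_series n (f : 'rV[K]_n -> K) (x : 'rV[K]_n)
    (s : {ffun 'I_n -> nat} -> K) : Prop :=
  exists2 r : rat, 0 < r &
    (forall e : rat, 0 < e ->
      finite_set [set a | e <= Qp_abs (s a) * r ^+ mdegree a]) /\
    (forall h : 'rV[K]_n, (forall i, Qp_abs (h 0 i) <= r) ->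
      (fun N => \sum_(b : {ffun 'I_n -> 'I_N})
         let a := [ffun i => val (b i)] in s a * monomial a h) @ \oo
      --> f (x + h)).

Definition analytic_at n (f : 'rV[K]_n -> K) (x : 'rV[K]_n) : Prop :=
  exists s, has_power_series f x s.

Definition analytic_on m n (U : set 'rV[K]_m) (f : 'rV[K]_m -> 'rV[K]_n) :
    Prop :=
  forall x, U x -> forall j, analytic_at (fun y => f y 0 j) x.

Record chart (M : topologicalType) (n : nat) := Chart {
  chart_dom : set M;
  chart_map : M -> 'rV[K]_n;
  chart_inv : 'rV[K]_n -> M;
  _ : open chart_dom;
  _ : open (chart_map @` chart_dom);
  _ : {in chart_dom, cancel chart_map chart_inv};
  _ : {within chart_dom, continuous chart_map};
  _ : {within chart_map @` chart_dom, continuous chart_inv} }.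

Definition analytic_atlas (M : topologicalType) n (A : set (chart M n)) :
    Prop :=
  (forall x, exists2 c, A c & chart_dom c x) /\
  (forall c c', A c -> A c' ->
    analytic_on (chart_map c @` (chart_dom c `&` chart_dom c'))
                (chart_map c' \o chart_inv c)).

End Analytic.

HB.mixin Record isTopologicalGroup G & Group G & Topological G := {
  mulg_continuous : continuous (fun z : G * G => (z.1 * z.2)%g);
  invg_continuous : continuous (fun x : G => (x^-1)%g) }.

#[short(type="topologicalGroupType")]
HB.structure Definition TopologicalGroup :=
  { G of Group G & Topological G & isTopologicalGroup G }.

Definition normal_subgroup (G : groupType) (N : set G) : Prop :=
  [/\ N 1%g, forall x y, N x -> N y -> N (x * y)%g,
      forall x, N x -> N (x^-1)%g & forall x g, N x -> N (x ^ g)%g].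

Definition topologically_simple (G : topologicalGroupType) : Prop :=
  (exists x : G, x <> 1%g) /\
  (forall N : set G, closed N -> normal_subgroup N ->
    N = [set 1%g] \/ N = setT).

Definition abstractly_isomorphic (G H : groupType) : Prop :=
  exists f : {multiplicative G -> H}, bijective f.

(* Hausdorff analytic manifolds of pure dimension lie_model_dim; purity is no *)
(* restriction for groups, by homogeneity. *)
Record padicLieGroup (p : nat) (p_pr : prime p) := PadicLieGroup {
  lie_group :> topologicalGroupType;
  lie_model_dim : nat;
  lie_atlas : set (chart p_pr lie_group lie_model_dim);
  lie_hausdorff : hausdorff_space lie_group;
  lie_atlasP : analytic_atlas lie_atlas;
  lie_mulg : forall c1 c2 c3,
    lie_atlas c1 -> lie_atlas c2 -> lie_atlas c3 ->
    analytic_on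
      [set z : 'rV[Qp p_pr]_(lie_model_dim + lie_model_dim) |
        [/\ (chart_map c1 @` chart_dom c1) (lsubmx z),
            (chart_map c2 @` chart_dom c2) (rsubmx z) &
            chart_dom c3 (chart_inv c1 (lsubmx z) *
                          chart_inv c2 (rsubmx z))%g]]
      (fun z => chart_map c3 (chart_inv c1 (lsubmx z) *
                              chart_inv c2 (rsubmx z))%g);
  lie_invg : forall c1 c2, lie_atlas c1 -> lie_atlas c2 ->
    analytic_on
      [set z | (chart_map c1 @` chart_dom c1) z /\
               chart_dom c2 ((chart_inv c1 z)^-1)%g]
      (fun z => chart_map c2 ((chart_inv c1 z)^-1)%g) }.

Section LieAlgebra.
Variables (p : nat) (p_pr : prime p) (G : padicLieGroup p_pr).
Local Notation K := (Qp p_pr).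

Definition analytic_at_one (f : G -> K) : Prop :=
  forall c, lie_atlas c -> chart_dom c 1%g ->
    analytic_at (f \o chart_inv c) (chart_map c 1%g).

(* Point derivations at 1 of the functions analytic near 1: as Qp is totally *)
(* disconnected, these are the derivations of the algebra of germs at 1. The *)
(* value outside that algebra is set to 0 to make the functional unique. *)
Definition point_derivation : {pred (G -> K) -> K^o} := fun D => `[<
  [/\ forall (a : K) f g, analytic_at_one f -> analytic_at_one g ->
        D (fun x => a * f x + g x) = a * D f + D g,
      forall f g, analytic_at_one f -> analytic_at_one g ->
        D (fun x => f x * g x) = D f * g 1%g + f 1%g * D g &
      forall f, ~ analytic_at_one f -> D f = 0] >].

Fact point_derivation_submod : submod_closed point_derivation.
Proof.
split.
  have e0 f : (0 : (G -> K) -> K^o) f = 0 by [].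
  by apply/asboolP; split=> [a f g|f g|f] *; rewrite !e0 ?mulr0 ?mul0r ?addr0.
move=> b D E /asboolP[D1 D2 D3] /asboolP[E1 E2 E3]; apply/asboolP.
split=> [a f g fa ga|f g fa ga|f fa] /=.
- by rewrite !fctE D1 // E1 // /GRing.scale /=; ring.
- by rewrite !fctE D2 // E2 // /GRing.scale /=; ring.
- by rewrite !fctE D3 // E3 // scaler0 addr0.
Qed.

HB.instance Definition _ :=
  GRing.isSubmodClosed.Build K ((G -> K) -> K^o) point_derivation
    point_derivation_submod.

Record lie_algebra := LieAlgebra {
  lie_derivation :> (G -> K) -> K^o;
  _ : lie_derivation \in point_derivation }.

HB.instance Definition _ := [isSub for lie_derivation].
HB.instance Definition _ := [Choice of lie_algebra by <:].
HB.instance Definition _ := [SubChoice_isSubLmodule of lie_algebra by <:].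

(* D extends to the left-invariant vector field f |-> (x |-> D (y |-> f (x y))), *)
(* and the bracket is the value at 1 of the commutator of the vector fields. *)
Definition lie_bracket (D E : lie_algebra) : (G -> K) -> K^o := fun f =>
  if `[< analytic_at_one f >] then
    D (fun x => E (fun y => f (x * y)%g)) - E (fun x => D (fun y => f (x * y)%g))
  else 0.

Definition lie_algebra_abelian : Prop := forall D E, lie_bracket D E = 0.

Definition lie_dimension (d : nat) : Prop :=
  inhabited (Vector.axiom d lie_algebra).

End LieAlgebra.

(* Main.v *)
(* Let U = Zp^d, let C be the Cantor space of 0-1 sequences, and call slot the   *)
(* set (v + p^n U) x (w C), with v in Z^d and w a finite word. Let E be the      *)
(* Higman-Thompson-like group of permutations of U x C generated by the 3-cycles *)
(* of disjoint slots of the same level n, acting between slots by translations   *)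
(* and changes of prefixes; each of them commutes with the translations by       *)
(* p^n U, and E contains the translations by Z^d because a slot splits into two  *)
(* copies of itself. A group N normalised by E and containing a continuous       *)
(* g <> 1 contains E: g moves a slot off itself, so N contains the commutators   *)
(* of the elements of E supported there, hence a 3-cycle, hence all of them.     *)
(* For a countable set R of homeomorphisms of C, the group G generated by U and  *)
(* the conjugates r E r^-1, topologised by its open subgroup U, is therefore     *)
(* topologically simple. As every element of G centralises an open subgroup of   *)
(* U, G is locally a group of translations: this gives the analytic structure    *)
(* and an abelian Lie algebra of dimension d.                                    *)
(* Choosing R, one can encode any t : nat -> bool in some elements of G by       *)
(* t m = false <-> [g1, g3^m g2 g3^-m] = 1. Such a pattern does not change when  *)
(* the g's are multiplied by elements of U commuting with everything in sight,   *)
(* so the countable group generated by the r E r^-1 realises all the patterns of *)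
(* G: only countably many t can give isomorphic groups.                          *)

Require Import Defs.
From HB Require Import structures.
From mathcomp Require Import all_boot all_order all_algebra.
From mathcomp Require Import generic_quotient ring_quotient.
From mathcomp Require Import ring lra zify.
From mathcomp Require Import all_classical topology.

Set Implicit Arguments.
Unset Strict Implicit.
Unset Printing Implicit Defensive.

Import Order.TTheory GRing.Theory Num.Theory.

Local Open Scope classical_set_scope.
Local Open Scope ring_scope.
Local Open Scope quotient_scope.

(** * The p-adic absolute value *)

(** The group is built so that two contrasting facts hold at once: near 1 it is only [Zp^d], acting
    by translations, while globally a rich group of rearrangements of cones makes every closed
    normal subgroup trivial or everything.

    Simplicity. [commutator_moved] and [cycle3_commutator] turn any nontrivial element of a
    normalised subgroup into a 3-cycle of slots. [deep_cycles_conjugate] spreads it to all 3-cycles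
    of the same level, and [cycle3_level_split] passes from fine levels to coarse ones. Hence
    [normalised_contains_elementary], and [normal_contains_gamma] for the countable group [gamma].
    Integer translations are products of 3-cycles ([translate_elementary]), so [gamma] is dense in
    [gamma_group], and a closed normal subgroup that contains [gamma] is the whole group.

    Lie structure. Each element commutes with all sufficiently small translations ([gamma_tame]). In
    charts given by the left cosets of [Zp^d], chart changes, multiplication and inversion are
    therefore affine near each point. A derivation at 1 is determined by its values on the [d]
    coordinates, by division of power series ([derivation_gradient]), and the bracket vanishes
    because mixed second derivatives commute ([iterated_derivation]).

    Many groups. The set of [m] for which [g1] commutes with the conjugate of [g2] by [g3^m] is
    preserved by isomorphisms. So isomorphism classes of parameters are countable
    ([isomorphism_class_countable]), and [inequivalent_family] extracts [2^N] pairwise inequivalent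
    parameters. *)

Section QpAbsTheory.
Variables (p : nat) (p_pr : prime p).
Local Notation K := (Qp p_pr).
Local Notation abs := (@Qp_abs p p_pr).

(** By [Qp_abs_pi] and uniqueness of limits, the absolute value may be computed along any
    representative instead of the chosen one. *)
Lemma Qp_abs_lim (u : padic_cauchy_seq p_pr) (l : rat) :
  (forall e : rat, 0 < e -> exists N, forall n, (N <= n)%N ->
     `|l - padic_abs p (u n)| < e) ->
  abs (\pi u) = l.
Proof.
move=> ul; apply/eqP; rewrite -subr_eq0 -normr_le0; apply/ler_addgt0Pr => e e0.
rewrite add0r (splitr e); have e20 : 0 < e / 2 by rewrite divr_gt0.
have [M uM] := Qp_abs_pi u e20; have [N uN] := ul _ e20.
have h1 := uM _ (leq_maxl M N); have h2 := uN _ (leq_maxr M N).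
rewrite -(subrKA (padic_abs p (u (maxn M N)))).
by rewrite (le_trans (ler_normD _ _)) // lerD // ltW // distrC.
Qed.

Lemma Qp_abs_ge0 (x : K) : 0 <= abs x.
Proof.
rewrite leNgt; apply/negP => x0.
have [N /(_ N (leqnn N))] := Qp_abs_pi (repr x) (e := - abs x) ltac:(by rewrite oppr_gt0).
rewrite reprK ltr_norml opprK => /andP[+ _].
by have := padic_abs_ge0 p_pr (repr x N); lra.
Qed.

Lemma Qp_absM (x y : K) : abs (x * y) = abs x * abs y.
Proof.
set a := abs x; set b := abs y.
have -> : x * y = \pi_K (repr x * repr y) by rewrite -[x in LHS]reprK -[y in LHS]reprK !piE.
apply: Qp_abs_lim => e e0.
have a0 : 0 <= a by apply: Qp_abs_ge0.
have b0 : 0 <= b by apply: Qp_abs_ge0.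
(* With errors below [d] in both factors, the product is off by at most [d * b + a * d + d * d],
   hence by less than [d * (a + b + 1)], as [d <= 1]. *)
pose d := Num.min 1 (e / (a + b + 1)).
have c0 : 0 < a + b + 1 by lra.
have d0 : 0 < d by rewrite lt_min ltr01 divr_gt0.
have [M xM] := Qp_abs_pi (repr x) d0; have [N yN] := Qp_abs_pi (repr y) d0.
exists (maxn M N) => n; rewrite geq_max => /andP[/xM + /yN].
rewrite !reprK -/a -/b /= padic_absM //.
set u := padic_abs p _; set v := padic_abs p _ => h1 h2.
have -> : a * b - u * v = (a - u) * b + a * (b - v) - (a - u) * (b - v) by ring.
have d1 : d <= 1 by rewrite /d ge_min lexx.
have de : d * (a + b + 1) <= e.
  by rewrite -ler_pdivlMr // /d ge_min lexx orbT.
have h3 : `|(a - u) * b| <= d * b by rewrite normrM (ger0_norm b0) ler_wpM2r // ltW.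
have h4 : `|a * (b - v)| <= a * d by rewrite normrM (ger0_norm a0) ler_wpM2l // ltW.
have h5 : `|(a - u) * (b - v)| < d * 1.
  by rewrite normrM ltr_pM // (lt_le_trans h2).
have := ler_normB ((a - u) * b + a * (b - v)) ((a - u) * (b - v)).
have := ler_normD ((a - u) * b) (a * (b - v)).
lra.
Qed.

Lemma Qp_abs_add (x y : K) : abs (x + y) <= Num.max (abs x) (abs y).
Proof.
apply/ler_addgt0Pr => e e0; have e20 : 0 < e / 2 by rewrite divr_gt0.
have [M xM] := Qp_abs_pi (repr x) e20.
have [N yN] := Qp_abs_pi (repr y) e20.
have [P zP] := Qp_abs_pi (repr x + repr y) e20.
have := xM (maxn M (maxn N P)) (leq_maxl _ _).
have := yN (maxn M (maxn N P)); rewrite !leq_max leqnn orbT => /(_ isT).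
have := zP (maxn M (maxn N P)); rewrite !leq_max leqnn !orbT => /(_ isT).
set n := maxn _ _.
have -> : \pi_K (repr x + repr y) = x + y.
  by rewrite -[x in RHS]reprK -[y in RHS]reprK !piE.
rewrite !reprK /= !ltr_norml => /andP[_ h1] /andP[h2 h2'] /andP[h3 h3'].
have := padic_absD p_pr (repr x n) (repr y n); move: h1; rewrite fctE.
rewrite le_max => h1 /orP[h4|h4].
  have : abs x <= Num.max (abs x) (abs y) by rewrite le_max lexx.
  lra.
have : abs y <= Num.max (abs x) (abs y) by rewrite le_max lexx orbT.
lra.
Qed.

Lemma Qp_absD_le (x y : K) c : abs x <= c -> abs y <= c -> abs (x + y) <= c.
Proof. by move=> xc yc; rewrite (le_trans (Qp_abs_add _ _)) // ge_max xc. Qed.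

Lemma Qp_absB_le (x y : K) c : abs x <= c -> abs y <= c -> abs (x - y) <= c.
Proof. by move=> xc yc; rewrite Qp_absD_le ?Qp_absN. Qed.

Lemma Qp_absD_lt (x y : K) c : abs x < c -> abs y < c -> abs (x + y) < c.
Proof. by move=> xc yc; rewrite (le_lt_trans (Qp_abs_add _ _)) // gt_max xc. Qed.

Lemma Qp_absB_lt (x y : K) c : abs x < c -> abs y < c -> abs (x - y) < c.
Proof. by move=> xc yc; rewrite Qp_absD_lt ?Qp_absN. Qed.

Lemma Qp_absC (x y : K) : abs (x - y) = abs (y - x).
Proof. by rewrite -Qp_absN opprB. Qed.

Lemma Qp_abs_sum_le (I : Type) (r : seq I) (P : pred I) (f : I -> K) c : 0 <= c ->
  (forall i, P i -> abs (f i) <= c) -> abs (\sum_(i <- r | P i) f i) <= c.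
Proof.
move=> c0 fc; apply: (big_ind (fun z => abs z <= c)) => //; first by rewrite Qp_abs0.
by move=> x y xc yc; exact: Qp_absD_le xc yc.
Qed.

Lemma Qp_abs_eq0E (x : K) : (abs x == 0) = (x == 0).
Proof.
by apply/eqP/eqP => [/Qp_abs_eq0//|->]; rewrite Qp_abs0.
Qed.

Lemma Qp_abs1 : abs 1 = 1.
Proof.
have : abs 1 * abs 1 = abs 1 by rewrite -Qp_absM mulr1.
have : abs 1 != 0 by rewrite Qp_abs_eq0E oner_eq0.
by move=> n0 /(canRL (mulfK n0)); rewrite divff.
Qed.

Lemma Qp_absV (x : K) : abs x^-1 = (abs x)^-1.
Proof.
have [->|x0] := eqVneq x 0; first by rewrite !(invr0, Qp_abs0).
have ax0 : abs x != 0 by rewrite Qp_abs_eq0E.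
by apply: (mulfI ax0); rewrite -Qp_absM !divff // Qp_abs1.
Qed.

Lemma Qp_absX (x : K) n : abs (x ^+ n) = abs x ^+ n.
Proof. by elim: n => [|n IHn]; rewrite ?expr0 ?Qp_abs1 // !exprS Qp_absM IHn. Qed.

Lemma Qp_abs_nat_le1 n : abs n%:R <= 1.
Proof.
elim: n => [|n IHn]; first by rewrite Qp_abs0 ler01.
by rewrite -natr1 Qp_absD_le // Qp_abs1.
Qed.

Lemma Qp_abs_int_le1 (n : int) : abs n%:~R <= 1.
Proof.
by case: n => n; rewrite ?NegzE ?mulrNz ?Qp_absN -pmulrn Qp_abs_nat_le1.
Qed.

Lemma padic_const_cauchy (q : rat) : (fun _ : nat => q) \in padic_cauchy p_pr.
Proof. by apply/asboolP => e e0; exists 0%N => m n _ _; rewrite subrr padic_abs0. Qed.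

Definition Qp_of_rat (q : rat) : K := \pi_K (PadicCauchySeq (padic_const_cauchy q)).

Lemma Qp_abs_rat q : abs (Qp_of_rat q) = padic_abs p q.
Proof. by apply: Qp_abs_lim => e e0; exists 0%N => n _; rewrite subrr normr0. Qed.

Lemma Qp_of_rat1 : Qp_of_rat 1 = 1.
Proof. by rewrite /Qp_of_rat [RHS]piE; congr (\pi _); apply: val_inj. Qed.

Lemma Qp_of_ratB a b : Qp_of_rat (a - b) = Qp_of_rat a - Qp_of_rat b.
Proof.
rewrite /Qp_of_rat.
transitivity (\pi_K (PadicCauchySeq (padic_const_cauchy a) - PadicCauchySeq (padic_const_cauchy
  b))).
  by congr (\pi _); apply: val_inj.
by rewrite !piE.
Qed.

Lemma Qp_of_ratM a b : Qp_of_rat (a * b) = Qp_of_rat a * Qp_of_rat b.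
Proof.
rewrite /Qp_of_rat.
transitivity (\pi_K (PadicCauchySeq (padic_const_cauchy a) * PadicCauchySeq (padic_const_cauchy
  b))).
  by congr (\pi _); apply: val_inj.
by rewrite !piE.
Qed.

HB.instance Definition _ := GRing.isZmodMorphism.Build rat K Qp_of_rat Qp_of_ratB.
HB.instance Definition _ := GRing.isMonoidMorphism.Build rat K Qp_of_rat (Qp_of_rat1, Qp_of_ratM).

Lemma Qp_rat_dense (x : K) (e : rat) : 0 < e -> exists q, abs (x - Qp_of_rat q) < e.
Proof.
move=> e0; have e20 : 0 < e / 2 by rewrite divr_gt0.
have /asboolP/(_ _ e20)[N uN] := valP (repr x).
exists (repr x N).
have -> : x - Qp_of_rat (repr x N) =
    \pi_K (repr x - PadicCauchySeq (padic_const_cauchy (repr x N))).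
  by rewrite -{1}[x]reprK /Qp_of_rat !piE.
set v := repr x - _.
have [M vM] := Qp_abs_pi v e20.
have := uN (maxn M N) N (leq_maxr _ _) (leqnn _).
have := vM _ (leq_maxl M N).
rewrite (_ : v (maxn M N) = repr x (maxn M N) - repr x N) //.
by rewrite ltr_norml => /andP[_]; lra.
Qed.

(** A rational [q n] within [1 / (n + 1)] of [u n] gives a Cauchy sequence of rationals, and its
    class is the limit. *)
Lemma Qp_complete (u : nat -> K) :
  (forall e : rat, 0 < e -> exists N, forall m n, (N <= m)%N -> (N <= n)%N ->
     abs (u m - u n) < e) ->
  exists l, forall e : rat, 0 < e -> exists N, forall n, (N <= n)%N -> abs (l - u n) < e.
Proof.
move=> uC.
have /choice[q qP] : forall n, exists q, abs (u n - Qp_of_rat q) < n.+1%:R^-1.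
  by move=> n; apply: Qp_rat_dense; rewrite invr_gt0 ltr0n.
have small (e : rat) : 0 < e -> exists N, forall n, (N <= n)%N -> (n.+1%:R^-1 : rat) < e.
  move=> e0; exists (Num.bound e^-1) => n Nn.
  rewrite -[ltRHS]invrK ltf_pV2 ?posrE ?invr_gt0 //.
  apply: (lt_le_trans (archi_boundP _)); first by rewrite invr_ge0 ltW.
  by rewrite ler_nat (leq_trans Nn).
have qC : q \in padic_cauchy p_pr.
  apply/asboolP => e e0; have [N uN] := uC _ e0; have [M sM] := small _ e0.
  exists (maxn M N) => m n; rewrite !geq_max => /andP[Mm Nm] /andP[Mn Nn].
  rewrite -Qp_abs_rat rmorphB.
  have -> : Qp_of_rat (q m) - Qp_of_rat (q n) =
     (u m - u n) - (u m - Qp_of_rat (q m)) + (u n - Qp_of_rat (q n)) by ring.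
  have hm := lt_trans (qP m) (sM _ Mm); have hn := lt_trans (qP n) (sM _ Mn).
  by apply: Qp_absD_lt hn; apply: Qp_absB_lt hm; apply: uN.
exists (\pi_K (PadicCauchySeq qC)) => e e0.
have e20 : 0 < e / 2 by rewrite divr_gt0.
have /asboolP/(_ _ e20)[N qN] := qC; have [M sM] := small _ e0.
exists (maxn M N) => n; rewrite !geq_max => /andP[Mn Nn].
rewrite -(subrKA (Qp_of_rat (q n))) Qp_absD_lt //; last first.
  by rewrite Qp_absC (lt_trans (qP _)) // sM.
have -> : \pi_K (PadicCauchySeq qC) - Qp_of_rat (q n) =
    \pi_K (PadicCauchySeq qC - PadicCauchySeq (padic_const_cauchy (q n))).
  by rewrite !piE.
set v := _ - _; have [L vL] := Qp_abs_pi v e20.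
have := qN (maxn L N) n (leq_maxr _ _) Nn; have := vL _ (leq_maxl L N).
rewrite (_ : v (maxn L N) = q (maxn L N) - q n) //.
by rewrite ltr_norml => /andP[_]; lra.
Qed.

Lemma Qp_abs_p : abs p%:R = p%:R^-1.
Proof.
have -> : p%:R = Qp_of_rat p%:R by rewrite rmorph_nat.
rewrite Qp_abs_rat -[X in padic_abs p X]divr1.
rewrite (_ : p%:R / 1 = (p%:Z)%:~R / 1%:~R) // padic_absE //; last first.
  by rewrite eqz_nat -lt0n prime_gt0.
by rewrite /= logn1 logn_prime // eqxx sub0r.
Qed.

Lemma pinv_gt0 : 0 < (p%:R^-1 : rat).
Proof. by rewrite invr_gt0 ltr0n prime_gt0. Qed.

Lemma pinv_lt1 : (p%:R^-1 : rat) < 1.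
Proof. by rewrite invf_lt1 ?ltr1n ?prime_gt1 // ltr0n prime_gt0. Qed.

Lemma pinv_small (e : rat) : 0 < e -> exists n, (p%:R^-1 : rat) ^+ n < e.
Proof.
move=> e0; exists (Num.bound e^-1); set n := Num.bound _.
have h : e^-1 < n%:R by apply: archi_boundP; rewrite invr_ge0 ltW.
rewrite exprVn -[ltRHS]invrK ltf_pV2 ?posrE ?invr_gt0 ?exprn_gt0 ?ltr0n ?prime_gt0 //.
apply: (lt_le_trans h); rewrite -natrX ler_nat ltnW // ltn_expl //.
exact: prime_gt1.
Qed.

Lemma pinv_le n m : (n <= m)%N -> (p%:R^-1 : rat) ^+ m <= p%:R^-1 ^+ n.
Proof. by move=> nm; rewrite ler_wiXn2l // ltW ?pinv_gt0 ?pinv_lt1. Qed.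

Lemma Qp_abs_int_coprime (m : int) : coprime p `|m| -> abs m%:~R = 1.
Proof.
move=> cpm; have m0 : m != 0.
  by apply: contraL cpm => /eqP->; rewrite prime_coprime // dvdn0.
rewrite -(rmorph_int Qp_of_rat) Qp_abs_rat -[X in padic_abs p X]divr1.
rewrite (_ : m%:~R / 1 = m%:~R / 1%:~R) // padic_absE //.
rewrite /= logn1 sub0r (_ : logn p `|m| = 0%N) //.
apply/eqP; rewrite -leqn0 leqNgt logn_gt0 mem_primes.
by rewrite prime_coprime // in cpm; rewrite (negPf cpm) !andbF.
Qed.

(** In lowest terms a denominator divisible by [p] forces a numerator prime to [p], and then the
    absolute value is a positive power of [p]. *)
Lemma padic_abs_le1_coprime q : padic_abs p q <= 1 -> coprime p `|denq q|.
Proof.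
have [->|q0] := eqVneq q 0; first by rewrite /= coprimen1.
rewrite prime_coprime // => q1; apply/negP => pd.
have pN : logn p `|numq q| = 0%N.
  apply/eqP; rewrite -leqn0 leqNgt logn_gt0 mem_primes absz_gt0 numq_eq0 q0 /=.
  apply/negP => /andP[_ pnum]; have := coprime_num_den q.
  have : (p %| gcdn `|numq q| `|denq q|)%N by rewrite dvdn_gcd pnum.
  by rewrite /coprime => /[swap] /eqP->; rewrite dvdn1 => /eqP p1; move: p_pr; rewrite p1.
move: q1; rewrite /padic_abs (negPf q0) pN subr0; apply/negP; rewrite -ltNge.
rewrite -exprnP exprn_egt1 ?ltr1n ?prime_gt1 //.
by rewrite -lt0n logn_gt0 mem_primes p_pr absz_gt0 denq_neq0.
Qed.

(** The integers are dense in [Zp]: a rational close to [x] has a denominator prime to [p], which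
    Bezout inverts modulo [p^n]. *)
Lemma Qp_abs_le1_int (x : K) n : abs x <= 1 ->
  exists a : int, abs (x - a%:~R) <= p%:R^-1 ^+ n.
Proof.
move=> x1; have pn0 : 0 < (p%:R^-1 : rat) ^+ n by rewrite exprn_gt0 // pinv_gt0.
have [q xq] := Qp_rat_dense x pn0.
have pn1 : (p%:R^-1 : rat) ^+ n <= 1 by rewrite -(expr0 p%:R^-1) pinv_le.
have q1 : padic_abs p q <= 1.
  rewrite -Qp_abs_rat -(subKr x (Qp_of_rat q)) Qp_absB_le //.
  by rewrite (le_trans (ltW xq)).
have cop := padic_abs_le1_coprime q1.
have copn : coprimez (denq q) (p ^ n)%:Z.
  by rewrite coprimezE coprime_sym coprimeXl.
have [[u v] /= uv] := coprimezP _ _ copn.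
have d0 : (denq q)%:~R != 0 :> K.
  by rewrite -Qp_abs_eq0E Qp_abs_int_coprime.
exists (numq q * u).
have -> : x - (numq q * u)%:~R = (x - Qp_of_rat q) +
    (numq q * v)%:~R / (denq q)%:~R * p%:R ^+ n.
  rewrite -[in Qp_of_rat q](divq_num_den q) fmorph_div !rmorph_int.
  have : (1 : K) = u%:~R * (denq q)%:~R + v%:~R * p%:R ^+ n.
    by rewrite -natrX -[(p ^ n)%:R]/((p ^ n)%:Z%:~R) -!rmorphM -rmorphD /= uv.
  rewrite !rmorphM /=; move: (p%:R ^+ n) (u%:~R) (v%:~R) ((numq q)%:~R) d0 => P U V N.
  move: ((denq q)%:~R) => D D0 h.
  have {h} VP : V * P = 1 - U * D by rewrite h addrC addKr.
  rewrite (mulrAC N V) -(mulrA (N / D)) VP mulrBr mulr1 addrA subrK.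
  by rewrite (mulrC U) mulrA divfK.
rewrite Qp_absD_le ?(ltW xq) // Qp_absM Qp_absX Qp_abs_p ler_piMl ?(ltW pn0) //.
by rewrite Qp_absM Qp_absV (Qp_abs_int_coprime cop) invr1 mulr1 Qp_abs_int_le1.
Qed.
End QpAbsTheory.

(** * Summable families in Qp *)

Section Summation.
Variables (p : nat) (p_pr : prime p).
Local Notation K := (Qp p_pr).
Local Notation abs := (@Qp_abs p p_pr).

Definition null_family (I : choiceType) (s : I -> K) : Prop :=
  forall e : rat, 0 < e -> exists J : seq I, forall i, i \notin J -> abs (s i) < e.

(** Summation along the directed set of finite subsets, so that reindexing and regrouping do not
    depend on any enumeration; [has_power_seriesP] relates it to the boxes of the definition of
    analyticity. *)
Definition has_sum (I : choiceType) (s : I -> K) (S : K) : Prop :=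
  forall e : rat, 0 < e -> exists J0 : seq I, forall J, uniq J -> {subset J0 <= J} ->
    abs (S - \sum_(i <- J) s i) < e.

Definition Qp_sum (I : choiceType) (s : I -> K) : K := xget 0 [set S | has_sum s S].

Lemma has_sum_unique (I : choiceType) (s : I -> K) S S' :
  has_sum s S -> has_sum s S' -> S = S'.
Proof.
move=> sS sS'; apply/eqP; rewrite -subr_eq0 -Qp_abs_eq0E.
rewrite eq_le Qp_abs_ge0 andbT; apply/ler_addgt0Pr => e e0; rewrite add0r.
have [J HJ] := sS e e0; have [J' HJ'] := sS' e e0.
have h1 : {subset J <= undup (J ++ J')}.
  by move=> i; rewrite mem_undup mem_cat => ->.
have h2 : {subset J' <= undup (J ++ J')}.
  by move=> i; rewrite mem_undup mem_cat => ->; rewrite orbT.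
rewrite -(subrKA (\sum_(i <- undup (J ++ J')) s i)) ltW // Qp_absD_lt //.
  by rewrite HJ // undup_uniq.
by rewrite Qp_absC HJ' // undup_uniq.
Qed.

Lemma has_sum_ext (I : choiceType) (s t : I -> K) S :
  s =1 t -> has_sum s S -> has_sum t S.
Proof. by move=> /funext->. Qed.

Lemma has_sumD (I : choiceType) (s t : I -> K) S T :
  has_sum s S -> has_sum t T -> has_sum (fun i => s i + t i) (S + T).
Proof.
move=> sS tT e e0; have [J HJ] := sS e e0; have [J' HJ'] := tT e e0.
exists (J ++ J') => L Lu LJ; rewrite big_split /= opprD addrACA.
by rewrite Qp_absD_lt ?HJ ?HJ' // => i iJ; apply: LJ; rewrite mem_cat iJ ?orbT.
Qed.

Lemma has_sumZ (I : choiceType) (c : K) (s : I -> K) S :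
  has_sum s S -> has_sum (fun i => c * s i) (c * S).
Proof.
move=> sS e e0; have [->|c0] := eqVneq c 0.
  exists [::] => L _ _; rewrite mul0r big1 ?subr0 ?Qp_abs0 // => i _.
  by rewrite mul0r.
have ac0 : 0 < abs c by rewrite lt_def Qp_abs_ge0 Qp_abs_eq0E c0.
have [J HJ] := sS (e / abs c) ltac:(by rewrite divr_gt0).
exists J => L Lu LJ; rewrite -mulr_sumr -mulrBr Qp_absM mulrC.
by rewrite -ltr_pdivlMr // HJ.
Qed.

Lemma has_sumB (I : choiceType) (s t : I -> K) S T :
  has_sum s S -> has_sum t T -> has_sum (fun i => s i - t i) (S - T).
Proof.
move=> sS tT; rewrite -[- T]mulN1r; apply: has_sum_ext (has_sumD sS (has_sumZ (-1) tT)).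
by move=> i; rewrite mulN1r.
Qed.

Lemma big_subset_split (I : eqType) (s : I -> K) (J L : seq I) :
  uniq J -> uniq L -> {subset J <= L} ->
  \sum_(i <- L) s i = \sum_(i <- J) s i + \sum_(i <- L | i \notin J) s i.
Proof.
move=> uJ uL JL; rewrite (bigID (mem J)) /=; congr (_ + _).
rewrite -big_filter; apply: perm_big; apply: uniq_perm => //; first exact: filter_uniq.
by move=> i; rewrite mem_filter; apply/andP/idP => [[]//|iJ]; split => //; apply: JL.
Qed.

Lemma has_sum_fin (I : choiceType) (s : I -> K) (J : seq I) :
  uniq J -> (forall i, i \notin J -> s i = 0) -> has_sum s (\sum_(i <- J) s i).
Proof.
move=> uJ sJ e e0; exists J => L uL JL.
rewrite (big_subset_split _ uJ uL JL) [X in _ - (_ + X)]big1 ?addr0 //.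
by rewrite subrr Qp_abs0.
Qed.

Lemma has_sum0 (I : choiceType) : has_sum (fun _ : I => 0) 0.
Proof. by have := @has_sum_fin I (fun _ => 0) [::] isT (fun _ _ => erefl); rewrite big_nil. Qed.

Lemma has_sum_sum (I : choiceType) (J : Type) (r : seq J) (s : J -> I -> K) (S : J -> K) :
  (forall j, has_sum (s j) (S j)) ->
  has_sum (fun i => \sum_(j <- r) s j i) (\sum_(j <- r) S j).
Proof.
move=> sS; elim: r => [|j r IHr].
  by rewrite big_nil; apply: has_sum_ext (has_sum0 I) => i; rewrite big_nil.
rewrite big_cons; apply: has_sum_ext (has_sumD (sS j) IHr) => i.
by rewrite big_cons.
Qed.

Lemma has_sum_le (I : choiceType) (s : I -> K) S c : 0 <= c ->
  (forall i, abs (s i) <= c) -> has_sum s S -> abs S <= c.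
Proof.
move=> c0 sc sS; apply/ler_addgt0Pr => e e0; have [J HJ] := sS e e0.
rewrite -(subrK (\sum_(i <- undup J) s i) S) Qp_absD_le //.
  have /ltW/le_trans := HJ (undup J) (undup_uniq _) (fun i => ltac:(by rewrite mem_undup)).
  by apply; rewrite lerDr.
by rewrite (@le_trans _ _ c) ?lerDl ?(ltW e0) // Qp_abs_sum_le.
Qed.

(** The ultrametric inequality bounds a finite sum by its largest term, so the partial sums over
    finite sets that omit only terms below [p^-n] form a Cauchy sequence. *)
Lemma null_has_sum (I : choiceType) (s : I -> K) : null_family s -> exists S, has_sum s S.
Proof.
move=> sn.
have /choice[J JP] : forall n, exists J : seq I, forall i, i \notin J -> abs (s i) < p%:R^-1 ^+ n.
  by move=> n; apply: sn; rewrite exprn_gt0 // pinv_gt0.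
(* Taking unions makes these exceptional sets increase with [n]. *)
pose L n := undup (flatten [seq J k | k <- iota 0 n.+1]).
have LJ n k i : (k <= n)%N -> i \notin L n -> abs (s i) < p%:R^-1 ^+ k.
  move=> kn iL; apply: JP; apply: contra iL => iJ.
  by rewrite mem_undup; apply/flatten_mapP; exists k => //; rewrite mem_iota add0n ltnS.
have diff n (A : seq I) : uniq A -> {subset L n <= A} ->
    abs (\sum_(i <- A) s i - \sum_(i <- L n) s i) <= p%:R^-1 ^+ n.
  move=> uA LA; rewrite (big_subset_split _ (undup_uniq _) uA LA) addrAC subrr add0r.
  rewrite Qp_abs_sum_le ?exprn_ge0 ?(ltW (pinv_gt0 p_pr)) //.
  by move=> i iL; rewrite ltW // (LJ n).
have Lsub n m : (n <= m)%N -> {subset L n <= L m}.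
  move=> nm i; rewrite !mem_undup => /flatten_mapP[k kn ik]; apply/flatten_mapP.
  by exists k => //; move: kn; rewrite !mem_iota !add0n !ltnS => /leq_trans->.
have [S SP] : exists S, forall e : rat, 0 < e -> exists N, forall n, (N <= n)%N ->
    abs (S - \sum_(i <- L n) s i) < e.
  apply: Qp_complete => e e0; have [N pN] := pinv_small p_pr e0.
  have h n : (N <= n)%N -> abs (\sum_(i <- L n) s i - \sum_(i <- L N) s i) < e.
    by move=> Nn; apply: le_lt_trans pN; rewrite diff ?undup_uniq //; apply: Lsub.
  exists N => m n Nm Nn; rewrite -(subrKA (\sum_(i <- L N) s i)).
  by rewrite Qp_absD_lt ?h // Qp_absC h.
exists S => e e0; have [N pN] := pinv_small p_pr e0; have [M SM] := SP e e0.
exists (L (maxn M N)) => A uA LA.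
rewrite -(subrKA (\sum_(i <- L (maxn M N)) s i)) Qp_absD_lt ?SM ?leq_maxl // Qp_absC.
by rewrite (le_lt_trans (diff _ _ uA LA)) // (le_lt_trans _ pN) // pinv_le // leq_maxr.
Qed.

Lemma Qp_sumP (I : choiceType) (s : I -> K) : null_family s -> has_sum s (Qp_sum s).
Proof. by move=> /null_has_sum[S sS]; rewrite /Qp_sum; case: xgetP => [T _ //|/(_ S)]. Qed.

Lemma Qp_sum_eq (I : choiceType) (s : I -> K) S : has_sum s S -> Qp_sum s = S.
Proof.
move=> sS; rewrite /Qp_sum; case: xgetP => [T _ sT|/(_ S)//].
exact: has_sum_unique sT sS.
Qed.

Lemma has_sum_inj (I J : choiceType) (g : J -> I) (s : I -> K) S :
  injective g -> (forall i, (forall j, i <> g j) -> s i = 0) ->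
  has_sum (s \o g) S -> has_sum s S.
Proof.
move=> gi s0 sS e e0; have [J0 HJ] := sS e e0.
exists (map g J0) => L uL JL.
(* [pre] is the preimage of [L] under [g], computed by choice. *)
pose pre := pmap (fun i => if pselect (exists j, i = g j) is left h then
  Some (projT1 (cid h)) else None) L.
have preP j : (j \in pre) = (g j \in L).
  rewrite mem_pmap; apply/mapP/idP => [[i iL]|gL].
    by case: pselect => // h [->]; case: (cid h) => x /= <-.
  exists (g j) => //; case: pselect => [h|[]]; last by exists j.
  by case: cid => x /= /gi ->.
have preu : uniq pre.
  apply: (@pmap_uniq _ _ _ g) => // i; case: pselect => //= h.
  by case: cid => x /= <-.
have := HJ pre preu; set A := \sum_(i <- pre) _; set B := \sum_(i <- L) _.
suff -> : A = B by apply => j jJ; rewrite preP JL // map_f.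
have sub : {subset map g pre <= L}.
  by move=> i /mapP[j jp ->]; rewrite -preP.
rewrite /B (big_subset_split s _ uL sub) ?map_inj_uniq // big_map [X in _ = _ + X]big_seq_cond.
rewrite [X in _ = _ + X]big1 ?addr0 // => i /andP[iL ni].
by apply: s0 => j ij; move: ni; rewrite ij map_f // preP -ij.
Qed.

(** Regrouping a null family along the fibres of a map. The projections of a product give Fubini in
    both orders, and addition of exponents gives the Cauchy product. *)
Lemma has_sum_fibers (I J : choiceType) (f : I -> J) (s : I -> K) (S : K) (R : J -> K) :
  null_family s -> has_sum s S ->
  (forall j, has_sum (fun i => if f i == j then s i else 0) (R j)) ->
  null_family R /\ has_sum R S.
Proof.
move=> sn sS sR; have half (e : rat) : 0 < e -> 0 < e / 2 /\ e / 2 < e by lra.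
split=> e /half[e20 e2]; have [L sL] := sn _ e20; exists (map f L).
  move=> j jL; apply: le_lt_trans e2; apply: has_sum_le (ltW e20) _ (sR j) => i.
  case: eqP => [fij|]; last by rewrite Qp_abs0 ltW.
  by rewrite ltW // sL //; apply: contra jL => iL; rewrite -fij map_f.
move=> A uA LA; apply: le_lt_trans e2.
(* The difference is the sum of the terms whose image is outside [A], and all of these are small. *)
have := has_sumB sS (has_sum_sum A sR); apply: has_sum_le (ltW e20) _ => i.
have [iA|iA] := boolP (f i \in A).
  rewrite (bigD1_seq (f i)) //= eqxx big1 ?addr0 ?subrr ?Qp_abs0 ?(ltW e20) // => j.
  by rewrite eq_sym => /negPf->.
rewrite big_seq big1 ?subr0 => [|j jA]; last by case: eqP iA jA => // -> /negPf->.
by rewrite ltW // sL //; apply: contra iA => iL; apply: LA; rewrite map_f.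
Qed.

End Summation.

(** * Power series expansions *)

Section PowerSeries.
Variables (p : nat) (p_pr : prime p).
Local Notation K := (Qp p_pr).
Local Notation abs := (@Qp_abs p p_pr).

Section Dim.
Variable n : nat.
Local Notation M := {ffun 'I_n -> nat}.
Implicit Types (s t : M -> K) (a b : M) (f g : 'rV[K]_n -> K) (x h : 'rV[K]_n).

Definition weighted_null (r : rat) s := forall e : rat, 0 < e ->
  exists J : seq M, forall a, a \notin J -> abs (s a) * r ^+ mdegree a < e.

Definition in_polydisc (r : rat) h := forall i, abs (h 0 i) <= r.

(** [has_power_series] with its radius exposed and its box sums replaced by unordered sums. *)
Definition expansion (r : rat) f x s :=
  [/\ 0 < r, weighted_null r s &
      forall h, in_polydisc r h -> has_sum (fun a => s a * monomial a h) (f (x + h))].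

Lemma mdegreeD a b : mdegree (a + b) = (mdegree a + mdegree b)%N.
Proof. by rewrite /mdegree -big_split; apply: eq_bigr => i _; rewrite ffunE. Qed.

Lemma monomialD a b h : monomial (a + b) h = monomial a h * monomial b h.
Proof.
by rewrite /monomial -big_split; apply: eq_bigr => i _; rewrite ffunE exprD.
Qed.

Lemma monomial0 h : monomial (0 : M) h = 1.
Proof. by rewrite /monomial big1 // => i _; rewrite ffunE expr0. Qed.

Lemma mdegree0 : mdegree (0 : M) = 0%N.
Proof. by rewrite /mdegree big1 // => i _; rewrite ffunE. Qed.

Definition unit_exponent (i : 'I_n) : M := [ffun j => (j == i) : nat].

Lemma monomial_unit i h : monomial (unit_exponent i) h = h 0 i.
Proof.
rewrite /monomial (bigD1 i) //= ffunE eqxx expr1 big1 ?mulr1 // => j ji.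
by rewrite ffunE (negPf ji) expr0.
Qed.

Lemma mdegree_unit i : mdegree (unit_exponent i) = 1%N.
Proof.
rewrite /mdegree (bigD1 i) //= ffunE eqxx big1 // => j ji.
by rewrite ffunE (negPf ji).
Qed.

Lemma mdegree_eq0 a : (mdegree a == 0%N) = (a == 0).
Proof.
apply/idP/eqP => [|->]; last by rewrite mdegree0.
rewrite /mdegree sum_nat_eq0 => /forallP a0; apply/ffunP => i.
by rewrite ffunE; apply/eqP/(implyP (a0 i)).
Qed.

Lemma mdegree_eq1 a : mdegree a = 1%N -> exists i, a = unit_exponent i.
Proof.
move=> a1.
have /existsP[i ai] : [exists i, a i != 0%N].
  apply: contra_eqT a1 => /existsPn a0; rewrite /mdegree big1 // => i _.
  by apply/eqP; rewrite -[_ == _]negbK a0.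
exists i; move: a1; rewrite /mdegree (bigD1 i) //= => /eqP.
rewrite -[X in (X + _)%N]prednK ?lt0n // addSn eqSS addn_eq0 sum_nat_eq0.
move=> /andP[ai1 /forallP a0]; apply/ffunP => j; rewrite ffunE.
have [->|ji] := eqVneq j i; last by apply/eqP/(implyP (a0 j)).
by move: ai ai1; case: (a i) => [|[]].
Qed.

Lemma abs_monomial_le r a h : in_polydisc r h -> abs (monomial a h) <= r ^+ mdegree a.
Proof.
move=> hr; rewrite /monomial /mdegree.
elim/big_ind2: _ => [|u1 u2 v1 v2 h1 h2|i _]; first by rewrite Qp_abs1.
  by rewrite Qp_absM exprD ler_pM ?Qp_abs_ge0.
by rewrite Qp_absX lerXn2r ?nnegrE ?Qp_abs_ge0 // (le_trans (Qp_abs_ge0 (h 0 i))).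
Qed.

Lemma weighted_null_le r r' s : 0 <= r' -> r' <= r -> weighted_null r s -> weighted_null r' s.
Proof.
move=> r0 rr sn e /sn[J sJ]; exists J => a /sJ; apply: le_lt_trans.
by rewrite ler_wpM2l ?Qp_abs_ge0 // lerXn2r ?nnegrE // (le_trans r0).
Qed.

Lemma weighted_null_family r s h : in_polydisc r h -> weighted_null r s ->
  null_family (fun a => s a * monomial a h).
Proof.
move=> hr sn e /sn[J sJ]; exists J => a /sJ; apply: le_lt_trans.
by rewrite Qp_absM ler_wpM2l ?Qp_abs_ge0 // abs_monomial_le.
Qed.

Lemma weighted_null_bounded r s : 0 <= r -> weighted_null r s ->
  exists2 C, 0 < C & forall a, abs (s a) * r ^+ mdegree a <= C.
Proof.
move=> r0 /(_ 1 ltr01)[J sJ].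
have pos a : 0 <= abs (s a) * r ^+ mdegree a by rewrite mulr_ge0 ?Qp_abs_ge0 ?exprn_ge0.
exists (1 + \sum_(a <- J) abs (s a) * r ^+ mdegree a).
  by rewrite ltr_pwDl // sumr_ge0.
move=> a; have [aJ|/sJ/ltW a1] := boolP (a \in J).
  rewrite (big_rem a) //= addrCA lerDl addr_ge0 // sumr_ge0 //.
by rewrite (le_trans a1) // lerDl sumr_ge0.
Qed.

Lemma expansion_le r r' f x s : 0 < r' -> r' <= r -> expansion r f x s -> expansion r' f x s.
Proof.
move=> r0 rr [_ sn sf]; split=> //; first exact: weighted_null_le (ltW r0) rr sn.
by move=> h hr; apply: sf => i; apply: le_trans (hr i) rr.
Qed.

Lemma expansion_local r f g x s : (forall h, in_polydisc r h -> f (x + h) = g (x + h)) ->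
  expansion r f x s -> expansion r g x s.
Proof. by move=> fg [r0 sn sf]; split=> // h hr; rewrite -fg //; apply: sf. Qed.

Lemma expansion_Qp_sum r x s : 0 < r -> weighted_null r s ->
  expansion r (fun y => Qp_sum (fun a => s a * monomial a (y - x))) x s.
Proof.
move=> r0 sn; split=> // h hr; rewrite addrC addKr.
by apply: Qp_sumP; apply: weighted_null_family hr sn.
Qed.

Definition box (N : nat) : seq M :=
  [seq ([ffun i => val (b i)] : M) | b : {ffun 'I_n -> 'I_N} <- enum {: {ffun 'I_n -> 'I_N}}].

Lemma box_uniq N : uniq (box N).
Proof.
rewrite map_inj_uniq ?enum_uniq // => b b' /ffunP bb; apply/ffunP => i.
by apply: val_inj; have := bb i; rewrite !ffunE.
Qed.

Lemma box_exhaust (J : seq M) : exists N0, forall N, (N0 <= N)%N -> {subset J <= box N}.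
Proof.
exists (\sum_(a <- J) mdegree a).+1 => N JN a aJ.
have aN i : (a i < N)%N.
  apply: leq_trans JN; rewrite ltnS (big_rem a) //= /mdegree (bigD1 i) //=.
  by rewrite -addnA leq_addr.
apply/mapP; exists [ffun i => Ordinal (aN i)]; first by rewrite mem_enum.
by apply/ffunP => i; rewrite !ffunE.
Qed.

Lemma box_sum_cvg (s : M -> K) S : has_sum s S ->
  (fun N => \sum_(b : {ffun 'I_n -> 'I_N}) let a := [ffun i => val (b i)] in s a) @ \oo --> S.
Proof.
move=> sS; apply/cvg_ballP => e /sS[J HJ]; have [N0 NP] := box_exhaust J.
exists N0 => // N /NP JN.
by have := HJ _ (box_uniq N) JN; rewrite /box big_map big_enum.
Qed.

(** The boxes exhaust all exponents, so the unordered sum is also the limit along boxes; limits in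
    [Qp] are unique. *)
Lemma has_power_seriesP f x s : has_power_series f x s <-> exists r, expansion r f x s.
Proof.
split=> [[r r0 [sfin sf]]|[r [r0 sn sf]]]; exists r => //.
  have sn : weighted_null r s.
    move=> e /sfin /finite_seqP[J JE]; exists J => a aJ.
    rewrite ltNge; apply/negP => ae; have : [set` J] a by rewrite -JE.
    by move=> /= h; rewrite h in aJ.
  split=> // h hr; have := Qp_sumP (weighted_null_family hr sn).
  set S := Qp_sum _ => sS; suff -> : f (x + h) = S by [].
  have h1 := sf h hr; have h2 := box_sum_cvg sS.
  exact: (@cvg_unique _ (metric_hausdorff (T := K)) _ _ _ _ h1 h2).
split=> [e /sn[J sJ]|h /sf/box_sum_cvg//].
apply: (@sub_finite_set _ _ [set` J]) => // a /= ea.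
by apply: contraLR ea => aJ; rewrite -ltNge sJ.
Qed.

Lemma analytic_atP f x : analytic_at f x <-> exists s r, expansion r f x s.
Proof.
by split=> [[s /has_power_seriesP]|[s /has_power_seriesP]]; exists s.
Qed.

Lemma expansion_at r f x s : expansion r f x s -> f x = s 0.
Proof.
move=> [r0 _ /(_ 0)]; rewrite addr0 => sf; apply: has_sum_unique (sf _) _.
  by move=> i; rewrite mxE Qp_abs0 ltW.
have := @has_sum_fin _ _ _ (fun a => s a * monomial a 0) [:: 0] isT.
rewrite big_seq1 monomial0 mulr1; apply=> a; rewrite inE => a0.
have /existsP[i ai] : [exists i, a i != 0%N].
  apply: contraR a0 => /existsPn a0; apply/eqP/ffunP => i; rewrite ffunE.
  by apply/eqP; rewrite -[_ == _]negbK a0.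
by rewrite /monomial (bigD1 i) //= mxE expr0n (negPf ai) mul0r mulr0.
Qed.

Lemma expansion_linear r f g c x s t : expansion r f x s -> expansion r g x t ->
  expansion r (fun y => c * f y + g y) x (fun a => c * s a + t a).
Proof.
move=> [r0 sn sf] [_ tn tg]; split=> //; last first.
  move=> h hr; apply: has_sum_ext (has_sumD (has_sumZ c (sf h hr)) (tg h hr)) => a.
  by rewrite mulrDl mulrA.
move=> e e0; have c0 : 0 < abs c + 1 by rewrite ltr_wpDl // Qp_abs_ge0.
have [J1 sJ] := sn _ (divr_gt0 e0 c0); have [J2 tJ] := tn e e0.
exists (J1 ++ J2) => a; rewrite mem_cat negb_or => /andP[/sJ h1 /tJ h2].
have rg : 0 <= r ^+ mdegree a by rewrite exprn_ge0 // ltW.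
apply: le_lt_trans (ler_wpM2r rg (Qp_abs_add _ _)) _.
rewrite maxr_pMl // gt_max h2 andbT Qp_absM -mulrA.
move: h1; rewrite ltr_pdivlMr // => h1; apply: le_lt_trans h1.
by rewrite mulrC ler_wpM2l ?mulr_ge0 ?Qp_abs_ge0 // lerDl.
Qed.

(** Terms of degree at least 2 scale at least like the square of the radius; this is what makes the
    linear coefficients intrinsic. *)
Lemma expansion_linear_approx r f x s : expansion r f x s ->
  exists C, forall h (rho : rat), 0 <= rho -> in_polydisc rho h -> rho <= r ->
    abs (f (x + h) - s 0 - \sum_i s (unit_exponent i) * h 0 i) <= C * rho ^+ 2.
Proof.
move=> [r0 sn sf]; have [C C0 sC] := weighted_null_bounded (ltW r0) sn.
exists (C / r ^+ 2) => h rho rho0 hrho rr.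
(* The exponents of degree at most 1, whose terms are removed from the series. *)
pose L : seq M := 0 :: [seq unit_exponent i | i <- enum 'I_n].
have Lu : uniq L.
  rewrite /= map_inj_uniq ?enum_uniq ?andbT.
    apply/mapP => -[i _ /(congr1 (@mdegree n))]; by rewrite mdegree0 mdegree_unit.
  by move=> i j /ffunP/(_ i); rewrite !ffunE eqxx; case: eqP.
pose u a := s a * monomial a h.
have hr : in_polydisc r h by move=> i; apply: le_trans (hrho i) rr.
have h1 := has_sum_fin (s := fun a => if a \in L then u a else 0) Lu
  (fun a => ltac:(by move/negPf->)).
have := has_sumB (sf h hr) h1.
have -> : \sum_(a <- L) (if a \in L then u a else 0) = s 0 + \sum_i s (unit_exponent i) * h 0 i.
  rewrite -big_mkcond -big_seq /L big_cons /u monomial0 mulr1 big_map big_enum /=.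
  by congr (_ + _); apply: eq_bigr => i _; rewrite monomial_unit.
have B0 : 0 <= C / r ^+ 2 * rho ^+ 2 by rewrite mulr_ge0 ?sqr_ge0 // divr_ge0 ?sqr_ge0 // ltW.
rewrite opprD addrA; apply: (has_sum_le B0) => a.
rewrite /u; case: ifPn => [_|aL]; first (rewrite subrr Qp_abs0; exact: B0).
have a2 : (2 <= mdegree a)%N.
  rewrite ltnNge; apply: contra aL; rewrite leq_eqVlt ltnS leqn0 mdegree_eq0.
  case/orP => [/eqP/mdegree_eq1[i ->]|/eqP->]; rewrite inE ?eqxx //.
  by rewrite map_f ?orbT // mem_enum.
rewrite subr0 Qp_absM; apply: le_trans (ler_wpM2l (Qp_abs_ge0 _) (abs_monomial_le _ hrho)) _.
have -> : rho ^+ mdegree a = r ^+ mdegree a * (rho / r) ^+ mdegree a.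
  by rewrite -exprMn mulrCA divff ?mulr1 // gt_eqF.
have -> : C / r ^+ 2 * rho ^+ 2 = C * (rho / r) ^+ 2.
  by rewrite exprMn exprVn [RHS]mulrA [RHS]mulrAC.
rewrite mulrA ler_pM ?mulr_ge0 ?Qp_abs_ge0 ?exprn_ge0 ?divr_ge0 ?(ltW r0) //.
by rewrite ler_wiXn2l ?divr_ge0 ?(ltW r0) // ler_pdivrMr // mul1r.
Qed.

(** Evaluated at [p^m] times the [i]-th basis vector, the two expansions agree up to [O(p^(-2m))],
    while a difference of coefficients would contribute at order [p^-m]. *)
Lemma linear_coefficient_unique r r' f x s t i :
  expansion r f x s -> expansion r' f x t -> s (unit_exponent i) = t (unit_exponent i).
Proof.
move=> fs ft; have f0 := expansion_at fs; have f0' := expansion_at ft.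
have [r0 _ _] := fs; have [r0' _ _] := ft.
have [C fC] := expansion_linear_approx fs; have [D fD] := expansion_linear_approx ft.
apply/eqP; rewrite -subr_eq0 -Qp_abs_eq0E eq_le Qp_abs_ge0 andbT.
apply/ler_addgt0Pr => e e0; rewrite add0r.
(* The constants [C] and [D] come without a sign, hence the absolute values; [rho] is then taken
   below [e / (E + 1)]. *)
set E := Num.max `|C| `|D|.
have E0 : 0 <= E by rewrite le_max normr_ge0.
have m0 : 0 < Num.min (Num.min r r') (e / (E + 1)).
  by rewrite !lt_min r0 r0' divr_gt0 // ltr_pwDr.
have [m] := pinv_small p_pr m0; set rho := _ ^+ m.
rewrite !lt_min => /andP[/andP[/ltW rr /ltW rr'] re].
have rho0 : 0 < rho by rewrite exprn_gt0 // pinv_gt0.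
pose h : 'rV[K]_n := \row_j (if j == i then p%:R ^+ m else 0).
have hr : in_polydisc rho h.
  move=> j; rewrite mxE; case: eqP => _; last by rewrite Qp_abs0 ltW.
  by rewrite Qp_absX Qp_abs_p.
have lin u : \sum_j u (unit_exponent j) * h 0 j = u (unit_exponent i) * p%:R ^+ m.
  rewrite (bigD1 i) //= mxE eqxx big1 ?addr0 // => j ji.
  by rewrite mxE (negPf ji) mulr0.
have := fC h rho (ltW rho0) hr rr; have := fD h rho (ltW rho0) hr rr'.
rewrite !lin -f0 -f0' => h1 h2.
have h1' : abs (f (x + h) - f x - t (unit_exponent i) * p%:R ^+ m) <= E * rho ^+ 2.
  by apply: le_trans h1 _; rewrite ler_wpM2r ?sqr_ge0 // le_max (ler_norm D) orbT.
have h2' : abs (f (x + h) - f x - s (unit_exponent i) * p%:R ^+ m) <= E * rho ^+ 2.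
  by apply: le_trans h2 _; rewrite ler_wpM2r ?sqr_ge0 // le_max (ler_norm C).
have := Qp_absB_le h1' h2'.
have -> : f (x + h) - f x - t (unit_exponent i) * p%:R ^+ m -
   (f (x + h) - f x - s (unit_exponent i) * p%:R ^+ m) =
   (s (unit_exponent i) - t (unit_exponent i)) * p%:R ^+ m.
  by rewrite mulrBl opprB addrC subrKA.
rewrite Qp_absM Qp_absX Qp_abs_p expr2 mulrA ler_pM2r // => /le_trans; apply.
move: re; rewrite ltr_pdivlMr ?ltr_pwDr // => re; apply/ltW/(le_lt_trans _ re).
by rewrite mulrC ler_wpM2l ?(ltW rho0) // lerDl.
Qed.

End Dim.
End PowerSeries.

(** * Products, recentring and division of power series *)

Section PowerSeriesOperations.
Variables (p : nat) (p_pr : prime p).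
Local Notation K := (Qp p_pr).
Local Notation abs := (@Qp_abs p p_pr).

Lemma has_sum_fubini (I J : choiceType) (v : I * J -> K) (R : I -> K) S :
  null_family v -> has_sum v S ->
  (forall i, has_sum (fun j => v (i, j)) (R i)) -> has_sum R S.
Proof.
move=> vn vS vR; apply: (proj2 (@has_sum_fibers _ p_pr _ _ fst v S R vn vS _)) => i.
apply: (@has_sum_inj _ _ _ _ (fun j => (i, j))) => [j j' []//|[i' j] ij|].
  by case: eqP => //= ei; case: (ij j); rewrite -ei.
by apply: has_sum_ext (vR i) => j /=; rewrite eqxx.
Qed.

Lemma has_sum_fubini_swap (I J : choiceType) (v : I * J -> K) (R : J -> K) S :
  null_family v -> has_sum v S ->
  (forall j, has_sum (fun i => v (i, j)) (R j)) -> has_sum R S.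
Proof.
move=> vn vS vR; apply: (proj2 (@has_sum_fibers _ p_pr _ _ snd v S R vn vS _)) => j.
apply: (@has_sum_inj _ _ _ _ (fun i => (i, j))) => [i i' []//|[i j'] ij|].
  by case: eqP => //= ei; case: (ij i); rewrite -ei.
by apply: has_sum_ext (vR j) => i /=; rewrite eqxx.
Qed.

Section Dim.
Variable n : nat.
Local Notation M := {ffun 'I_n -> nat}.
Implicit Types (s t : M -> K) (a b : M) (f g : 'rV[K]_n -> K) (x h k : 'rV[K]_n).

(** Written as a sum over all pairs, supported on the fibre of addition above [a], so that
    [has_sum_fibers] applies as it stands. *)
Definition cauchy_product s t a : K :=
  Qp_sum (fun i : M * M => if i.1 + i.2 == a then s i.1 * t i.2 else 0).

(** Outside a finite set of pairs one factor is small, and the other is bounded. *)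
Lemma weighted_null_pair r s t : 0 < r -> weighted_null r s -> weighted_null r t ->
  forall e : rat, 0 < e -> exists J : seq (M * M), forall i, i \notin J ->
    abs (s i.1 * t i.2) * r ^+ mdegree (i.1 + i.2) < e.
Proof.
move=> r0 sn tn e e0.
have [C C0 sC] := weighted_null_bounded (ltW r0) sn.
have [D D0 tD] := weighted_null_bounded (ltW r0) tn.
have [J1 sJ] := sn _ (divr_gt0 e0 D0); have [J2 tJ] := tn _ (divr_gt0 e0 C0).
exists [seq (a, b) | a <- J1, b <- J2] => -[a b] /= abJ.
have pos u c : 0 <= abs (u c) * r ^+ mdegree c.
  by rewrite mulr_ge0 ?Qp_abs_ge0 ?exprn_ge0 ?(ltW r0).
rewrite Qp_absM mdegreeD exprD mulrACA.
have [aJ|/sJ] := boolP (a \in J1); last first.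
  rewrite ltr_pdivlMr // => /(le_lt_trans _); apply.
  by rewrite ler_wpM2l ?pos.
have /tJ : b \notin J2.
  by apply: contra abJ => bJ; apply/allpairsP; exists (a, b).
rewrite ltr_pdivlMr // => /(le_lt_trans _); apply.
by rewrite mulrC ler_wpM2l ?pos.
Qed.

Lemma cauchy_product_has_sum r s t a : 0 < r -> weighted_null r s -> weighted_null r t ->
  has_sum (fun i : M * M => if i.1 + i.2 == a then s i.1 * t i.2 else 0)
    (cauchy_product s t a).
Proof.
move=> r0 sn tn; apply: Qp_sumP => e e0.
have ra : 0 < r ^+ mdegree a by rewrite exprn_gt0.
have [J HJ] := weighted_null_pair r0 sn tn (mulr_gt0 e0 ra).
exists J => i /HJ; case: eqP => [->|_ _]; last by rewrite Qp_abs0.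
by rewrite ltr_pM2r.
Qed.

Lemma expansionM r f g x s t : expansion r f x s -> expansion r g x t ->
  expansion r (fun y => f y * g y) x (cauchy_product s t).
Proof.
move=> [r0 sn sf] [_ tn tg]; split=> //.
  move=> e e0; have e20 : 0 < e / 2 by rewrite divr_gt0.
  have [J HJ] := weighted_null_pair r0 sn tn e20.
  exists [seq i.1 + i.2 | i <- J] => a aJ.
  have ra : 0 < r ^+ mdegree a by rewrite exprn_gt0.
  apply: (@le_lt_trans _ _ (e / 2)); last by lra.
  rewrite -ler_pdivlMr //; have := cauchy_product_has_sum a r0 sn tn.
  have q0 : 0 <= e / 2 / r ^+ mdegree a by rewrite divr_ge0 ?ltW.
  apply: (has_sum_le q0) => i; case: eqP => [ia|_]; last by rewrite Qp_abs0.
  rewrite ler_pdivlMr // -ia ltW // HJ //.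
  by apply: contra aJ => iJ; rewrite -ia; apply/mapP; exists i.
move=> h hr.
pose v (i : M * M) := s i.1 * t i.2 * monomial (i.1 + i.2) h.
have vn : null_family v.
  move=> e /(weighted_null_pair r0 sn tn)[J HJ]; exists J => i /HJ.
  apply: le_lt_trans; rewrite /v Qp_absM ler_wpM2l ?Qp_abs_ge0 //.
  exact: abs_monomial_le.
have vE b c : v (b, c) = s b * monomial b h * (t c * monomial c h).
  by rewrite /v /= monomialD mulrACA.
have vS := Qp_sumP vn.
(* Summed by rows, the double family gives the product of the two values; summed along the fibres of
   addition, it gives the Cauchy product. *)
have : has_sum (fun b => s b * monomial b h * g (x + h)) (Qp_sum v).
  apply: (has_sum_fubini vn vS) => b.
  by apply: has_sum_ext (has_sumZ _ (tg h hr)) => c; rewrite vE.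
have h2 := has_sumZ (g (x + h)) (sf h hr).
move=> /has_sum_unique h1; have {}h1 := h1 _ (has_sum_ext (fun b => mulrC _ _) h2).
rewrite mulrC -h1; apply: (proj2 (@has_sum_fibers _ _ _ _ (fun i => i.1 + i.2) _ _ _ vn vS _)) => a.
rewrite mulrC; apply: has_sum_ext (has_sumZ (monomial a h) (cauchy_product_has_sum a r0 sn tn))
  => i.
by case: eqP => [ia|_]; rewrite ?mulr0 // /v ia mulrC.
Qed.

(** The Leibniz rule at the level of coefficients: an exponent of degree 1 splits only as itself
    plus 0, in either order. *)
Lemma cauchy_product_unit s t i : cauchy_product s t (unit_exponent i) =
  s (unit_exponent i) * t 0 + s 0 * t (unit_exponent i).
Proof.
set d := unit_exponent i.
have d0 : d != 0 by rewrite -mdegree_eq0 mdegree_unit.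
apply: Qp_sum_eq; have := @has_sum_fin _ p_pr _
   (fun i : M * M => if i.1 + i.2 == d then s i.1 * t i.2 else 0) [:: (d, 0); (0, d)].
rewrite !big_cons big_nil /= addr0 add0r eqxx addr0; apply.
  by rewrite inE andbT xpair_eqE negb_and d0.
move=> [a b] abJ; case: eqP => //= abd; exfalso; move: abJ; rewrite -abd => /negP; apply.
have := congr1 (@mdegree n) abd; rewrite mdegreeD mdegree_unit.
rewrite !inE !xpair_eqE.
case: (mdegree a) (mdegree_eq0 a) => [|[|//]] /esym; last first.
  case: (mdegree b) (mdegree_eq0 b) => [|//] /esym/eqP-> _ _.
  by rewrite addr0 !eqxx.
by move=> /eqP-> _; rewrite add0r !eqxx orbT.
Qed.

Definition le_exponent b a := [forall i, (b i <= a i)%N].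
Definition sub_exponent a b : M := [ffun i => (a i - b i)%N].
Definition exponent_binomial a b : nat := (\prod_i 'C(a i, b i))%N.

Lemma exponent_binomial_eq0 a b : ~~ le_exponent b a -> exponent_binomial a b = 0%N.
Proof.
move=> /forallPn[i]; rewrite -ltnNge => ab.
by rewrite /exponent_binomial (bigD1 i) //= bin_small.
Qed.

Lemma sub_exponentK a b : le_exponent b a -> b + sub_exponent a b = a.
Proof. by move=> /forallP ba; apply/ffunP => i; rewrite !ffunE; apply: subnKC. Qed.

Lemma le_exponent_box a b : le_exponent b a -> b \in box n (mdegree a).+1.
Proof.
move=> /forallP ba.
have bN i : (b i < (mdegree a).+1)%N.
  by rewrite ltnS (leq_trans (ba i)) // /mdegree (bigD1 i) //= leq_addr.
apply/mapP; exists [ffun i => Ordinal (bN i)]; first by rewrite mem_enum.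
by apply/ffunP => i; rewrite !ffunE.
Qed.

Lemma monomial_binomial a h k : monomial a (h + k) =
  \sum_(b <- box n (mdegree a).+1)
    (exponent_binomial a b)%:R * monomial (sub_exponent a b) h * monomial b k.
Proof.
set N := (mdegree a).+1; rewrite /box big_map big_enum /= /monomial.
transitivity (\prod_i \sum_(j < N) ('C(a i, j)%:R * h 0 i ^+ (a i - j) * k 0 i ^+ j)).
  apply: eq_bigr => i _; rewrite mxE exprDn.
  have aN : ((a i).+1 <= N)%N by rewrite ltnS /mdegree (bigD1 i) //= leq_addr.
  rewrite (big_ord_widen N (fun j => h 0 i ^+ (a i - j) * k 0 i ^+ j *+ 'C(a i, j))) //.
  rewrite [LHS]big_mkcond; apply: eq_bigr => j _; case: ltnP => aj.
    by rewrite -mulr_natl mulrA.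
  by rewrite bin_small // !mul0r.
rewrite bigA_distr_bigA; apply: eq_bigr => b _.
rewrite /exponent_binomial natr_prod !big_split /=.
by congr (_ * _ * _); apply: eq_bigr => i _; rewrite !ffunE.
Qed.

(** The coefficient of [k^b] after expanding every [(h + k)^a]. Where [b] exceeds [a] the
    subtraction of exponents is truncated, but the binomial coefficient is then 0. *)
Definition recentered s h b : K :=
  Qp_sum (fun a => s a * (exponent_binomial a b)%:R * monomial (sub_exponent a b) h).

Lemma abs_recentered_term r s h a b : 0 <= r -> in_polydisc r h ->
  abs (s a * (exponent_binomial a b)%:R * monomial (sub_exponent a b) h) * r ^+ mdegree b <=
  if le_exponent b a then abs (s a) * r ^+ mdegree a else 0.
Proof.
move=> r0 hr; case: ifPn => [ba|/exponent_binomial_eq0->]; last first.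
  by rewrite mulr0 mul0r Qp_abs0 mul0r.
rewrite -[in mdegree a](sub_exponentK ba) mdegreeD exprD mulrA [leRHS]mulrAC ler_wpM2r
  ?exprn_ge0 //.
rewrite Qp_absM; apply: ler_pM; rewrite ?Qp_abs_ge0 ?abs_monomial_le //.
by rewrite Qp_absM ler_piMr ?Qp_abs_ge0 // Qp_abs_nat_le1.
Qed.

Lemma recentered_has_sum r s h b : 0 < r -> in_polydisc r h -> weighted_null r s ->
  has_sum (fun a => s a * (exponent_binomial a b)%:R * monomial (sub_exponent a b) h)
    (recentered s h b).
Proof.
move=> r0 hr sn; apply: Qp_sumP => e e0.
have rb : 0 < r ^+ mdegree b by rewrite exprn_gt0.
have [J sJ] := sn _ (mulr_gt0 e0 rb); exists J => a /sJ lt.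
rewrite -(ltr_pM2r rb); apply: le_lt_trans (abs_recentered_term s a b (ltW r0) hr) _.
by case: ifP => _ //; rewrite mulr_gt0.
Qed.

(** Every point of an ultrametric polydisc is a centre of it, so the radius does not shrink; the
    binomial expansion is a double sum over a null family, summed in the other order. *)
Lemma expansion_recenter r f x s h : in_polydisc r h -> expansion r f x s ->
  expansion r f (x + h) (recentered s h).
Proof.
move=> hr [r0 sn sf]; split=> //.
  move=> e e0; have e20 : 0 < e / 2 by rewrite divr_gt0.
  have [J HJ] := sn _ e20.
  exists (flatten [seq box n (mdegree a).+1 | a <- J]) => b bJ.
  have rb : 0 < r ^+ mdegree b by rewrite exprn_gt0.
  apply: (@le_lt_trans _ _ (e / 2)); last by lra.
  rewrite -ler_pdivlMr //; have := recentered_has_sum b r0 hr sn.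
  have q0 : 0 <= e / 2 / r ^+ mdegree b by rewrite divr_ge0 ?ltW.
  apply: (has_sum_le q0) => a; rewrite ler_pdivlMr //.
  apply: le_trans (abs_recentered_term s a b (ltW r0) hr) _.
  case: ifPn => ba; last exact: ltW.
  rewrite ltW // HJ //; apply: contra bJ => aJ; apply/flatten_mapP.
  by exists a => //; apply: le_exponent_box.
move=> k kr.
pose v (i : M * M) := s i.1 * (exponent_binomial i.1 i.2)%:R *
  monomial (sub_exponent i.1 i.2) h * monomial i.2 k.
have vn : null_family v.
  move=> e e0; have [J HJ] := sn e e0.
  exists [seq (a, b) | a <- J, b <- box n (mdegree a).+1] => -[a b] abJ.
  apply: (@le_lt_trans _ _ (if le_exponent b a then abs (s a) * r ^+ mdegree a else 0)).
    apply: le_trans (abs_recentered_term s a b (ltW r0) hr).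
    by rewrite /v /= Qp_absM ler_wpM2l ?Qp_abs_ge0 // abs_monomial_le.
  case: ifPn => // ba; apply: HJ; apply: contra abJ => aJ.
  by apply/allpairsPdep; exists a, b; split => //; apply: le_exponent_box.
have vS := Qp_sumP vn.
have hkr : in_polydisc r (h + k) by move=> i; rewrite mxE Qp_absD_le.
have h1 : has_sum (fun a => s a * monomial a (h + k)) (Qp_sum v).
  apply: (has_sum_fubini vn vS) => a; rewrite monomial_binomial mulr_sumr.
  have := @has_sum_fin _ p_pr _ (fun b => v (a, b)) (box n (mdegree a).+1) (box_uniq _ _).
  rewrite (eq_bigr (fun b => s a * ((exponent_binomial a b)%:R *
     monomial (sub_exponent a b) h * monomial b k))); last first.
    by move=> b _; rewrite /v /= !mulrA.
  apply=> b bN; rewrite /v /= exponent_binomial_eq0 ?mulr0 ?mul0r //.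
  by apply: contra bN; apply: le_exponent_box.
have h2 := sf _ hkr; rewrite -addrA (has_sum_unique h2 h1).
apply: (has_sum_fubini_swap vn vS) => b; rewrite mulrC.
apply: has_sum_ext (has_sumZ (monomial b k) (recentered_has_sum b r0 hr sn)) => a.
by rewrite /v /= mulrC.
Qed.

Definition partial_coefficients (i : 'I_n) s b : K := s (b + unit_exponent i) * (b i).+1%:R.

Lemma add_unitE b (i j : 'I_n) : (b + unit_exponent i) j = (b j + (j == i))%N.
Proof. by rewrite !ffunE. Qed.

Lemma add_unit_inj (i : 'I_n) : injective (fun b : M => b + unit_exponent i).
Proof.
by move=> b b' /ffunP bb; apply/ffunP => j; have := bb j; rewrite !ffunE => /addIn.
Qed.

Lemma weighted_null_shift r s (i : 'I_n) : 0 < r -> weighted_null r s ->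
  weighted_null r (fun b => s (b + unit_exponent i)).
Proof.
move=> r0 sn e e0; have [J sJ] := sn _ (mulr_gt0 e0 r0).
exists [seq sub_exponent a (unit_exponent i) | a <- J] => b bJ.
have : b + unit_exponent i \notin J.
  apply: contra bJ => bJ; apply/mapP; exists (b + unit_exponent i) => //.
  by apply/ffunP => j; rewrite !ffunE addnK.
by move=> /sJ; rewrite mdegreeD mdegree_unit addn1 exprSr mulrA ltr_pM2r.
Qed.

Lemma weighted_null_partial r s (i : 'I_n) : 0 < r -> weighted_null r s ->
  weighted_null r (partial_coefficients i s).
Proof.
move=> r0 sn e /(weighted_null_shift i r0 sn)[J HJ]; exists J => a /HJ.
apply: le_lt_trans; rewrite ler_wpM2r ?exprn_ge0 ?(ltW r0) // Qp_absM.
by rewrite ler_piMr ?Qp_abs_ge0 // Qp_abs_nat_le1.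
Qed.

(** The linear coefficient at [x + h] is the value at [h] of the formal partial derivative, which is
    thus again analytic in [h]. *)
Lemma recentered_unit r s h i : 0 < r -> in_polydisc r h -> weighted_null r s ->
  recentered s h (unit_exponent i) =
  Qp_sum (fun b => partial_coefficients i s b * monomial b h).
Proof.
move=> r0 hr sn; apply: Qp_sum_eq.
have := Qp_sumP (weighted_null_family hr (weighted_null_partial i r0 sn)).
set S := Qp_sum _ => sS; apply: (has_sum_inj (@add_unit_inj i)).
  move=> a ia; rewrite exponent_binomial_eq0 ?mulr0 ?mul0r //.
  apply/negP => ua; apply: (ia (sub_exponent a (unit_exponent i))).
  by rewrite addrC sub_exponentK.
apply: has_sum_ext sS => b; rewrite /partial_coefficients /=.
have -> : sub_exponent (b + unit_exponent i) (unit_exponent i) = b.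
  by apply/ffunP => j; rewrite !ffunE addnK.
congr (_ * _%:R * _); rewrite /exponent_binomial (bigD1 i) //= add_unitE ffunE eqxx bin1 addn1.
by rewrite big1 ?muln1 // => j ji; rewrite add_unitE ffunE (negPf ji) bin0.
Qed.

(** Each nonconstant monomial is divided by the first variable that occurs in it; the quotients by
    variable [i] form this series. *)
Definition hadamard_coefficients (i : 'I_n) s b : K :=
  if [forall j : 'I_n, (j < i)%N ==> (b j == 0%N)] then s (b + unit_exponent i) else 0.

Lemma weighted_null_hadamard r s (i : 'I_n) : 0 < r -> weighted_null r s ->
  weighted_null r (hadamard_coefficients i s).
Proof.
move=> r0 sn e e0; have [J HJ] := weighted_null_shift i r0 sn e0; exists J => a aJ.
by rewrite /hadamard_coefficients; case: ifP => _; [exact: HJ|rewrite Qp_abs0 mul0r].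
Qed.

(** Hadamard's lemma for power series: the nonzero exponents are partitioned by the index of their
    first nonzero entry. *)
Lemma expansion_hadamard r f x s h : expansion r f x s -> in_polydisc r h ->
  f (x + h) = s 0 +
    \sum_i h 0 i * Qp_sum (fun b => hadamard_coefficients i s b * monomial b h).
Proof.
move=> [r0 sn sf] hr; apply: has_sum_unique (sf h hr) _.
pose u a := s a * monomial a h.
pose first (i : 'I_n) a := (0 < a i)%N && [forall j : 'I_n, (j < i)%N ==> (a j == 0%N)].
have S1 i : has_sum (fun a => if first i a then u a else 0)
   (h 0 i * Qp_sum (fun b => hadamard_coefficients i s b * monomial b h)).
  apply: (has_sum_inj (@add_unit_inj i)).
    move=> a ia; case: ifP => // /andP[ai _]; exfalso.
    apply: (ia (sub_exponent a (unit_exponent i))); rewrite addrC sub_exponentK //.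
    by apply/forallP => j; rewrite ffunE; case: eqP => [->|].
  have := Qp_sumP (weighted_null_family hr (weighted_null_hadamard i r0 sn)).
  move=> /(has_sumZ (h 0 i)); apply: has_sum_ext => b; rewrite /= /hadamard_coefficients.
  have -> : first i (b + unit_exponent i) = [forall j : 'I_n, (j < i)%N ==> (b j == 0%N)].
    rewrite /first add_unitE eqxx addn1 /=; apply: eq_forallb => j; rewrite add_unitE.
    by case: (ltngtP j i) => //= ji; rewrite (_ : (j == i) = false) ?addn0 // -val_eqE /= ltn_eqF.
  case: ifP => _; last by rewrite mul0r mulr0.
  by rewrite /u monomialD monomial_unit mulrC mulrA.
have S0 := @has_sum_fin _ p_pr _ (fun a => if a == 0 then s a else 0) [:: 0] isT.
have {}S0 : has_sum (fun a => if a == 0 then s a else 0) (s 0).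
  by rewrite big_seq1 eqxx in S0; apply: S0 => a; rewrite inE => /negPf->.
apply: has_sum_ext (has_sumD S0 (has_sum_sum (index_enum 'I_n) S1)) => a /=.
have [->|a0] := eqVneq a 0.
  by rewrite monomial0 mulr1 big1 ?addr0 // => i _; rewrite /first ffunE.
rewrite add0r.
have /existsP[i0 i0P] : [exists i, a i != 0%N].
  apply: contraR a0 => /existsPn a0; apply/eqP/ffunP => i; rewrite ffunE.
  by apply/eqP; rewrite -[_ == _]negbK a0.
case: (@arg_minnP _ i0 (fun i => a i != 0%N) (fun i : 'I_n => val i) i0P) => i ai imin.
have fi : first i a.
  rewrite /first lt0n ai; apply/forallP => j; apply/implyP => ji.
  by apply: contraTT ji => /imin; rewrite -leqNgt.
rewrite (bigD1 i) //= fi big1 ?addr0 // => j ji; case: ifP => // /andP[aj /forallP fj].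
have [lt|gt|/val_inj eq] := ltngtP j i; last by rewrite eq eqxx in ji.
- by have := imin j; rewrite -lt0n aj leqNgt lt => /(_ isT).
- by have := implyP (fj i) gt; rewrite (negPf ai).
Qed.

End Dim.
End PowerSeriesOperations.

(** * Groups generated by a set; bijections; words and cones *)

Section GeneratedSubgroup.
Variable G : groupType.
Local Open Scope group_scope.

Definition is_subgroup (N : set G) :=
  [/\ N 1, forall x y, N x -> N y -> N (x * y) & forall x, N x -> N x^-1].

Inductive generated (S : set G) : set G :=
| generated1 : generated S 1
| generated_mem x : S x -> generated S x
| generatedM x y : generated S x -> generated S y -> generated S (x * y)
| generatedV x : generated S x -> generated S x^-1.

Lemma generated_sub S N : is_subgroup N -> S `<=` N -> generated S `<=` N.
Proof. by move=> [N1 NM NV] SN x; elim=> [|y /SN||] *; auto. Qed.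

(** Elements are values of finite words in the generators and their inverses; the Boolean of a
    letter selects between the two. *)
Lemma generated_countable (I : Type) (e : I -> G) S : S `<=` range e ->
  exists e' : seq (I * bool) -> G, generated S `<=` range e'.
Proof.
move=> Se; pose gen (i : I * bool) := if i.2 then e i.1 else (e i.1)^-1.
pose word (l : seq (I * bool)) := foldr (fun i x => gen i * x) 1 l.
have wordM l l' : word (l ++ l') = word l * word l'.
  by elim: l => [|i l IHl]; rewrite ?mul1g //= IHl mulgA.
exists word => x.
elim=> [|y /Se[i _ <-]|y z _ [l _ <-] _ [l' _ <-]|y _ [l _ <-]].
- by exists [::].
- by exists [:: (i, true)] => //; rewrite /word /= mulg1.
- by exists (l ++ l').
exists (rev [seq (i.1, ~~ i.2) | i <- l]) => //.
elim: l => [|i l IHl]; first by rewrite invg1.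
rewrite /= rev_cons -cats1 wordM IHl invgM /= mulg1; congr (_ * _).
by rewrite /gen; case: i => i [] //=; rewrite invgK.
Qed.

End GeneratedSubgroup.

Section Selfbij.
Variable X : Type.

Record selfbij := Selfbij {
  bfun :> X -> X;
  binv : X -> X;
  bfunK : cancel bfun binv;
  binvK : cancel binv bfun }.

Lemma selfbijP (f g : selfbij) : bfun f =1 bfun g -> f = g.
Proof.
case: f g => [f f' fK f'K] [g g' gK g'K] /= /funext fg.
rewrite -{}fg in gK g'K *.
have e : f' = g' by apply/funext => x; rewrite -{1}(g'K x) fK.
rewrite -{}e in gK g'K *.
by congr Selfbij; apply: Prop_irrelevance.
Qed.

HB.instance Definition _ := gen_eqMixin selfbij.
HB.instance Definition _ := gen_choiceMixin selfbij.

Definition selfbij_one : selfbij := @Selfbij id id (fun=> erefl) (fun=> erefl).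
Definition selfbij_mul (f g : selfbij) : selfbij :=
  Selfbij (can_comp (bfunK f) (bfunK g)) (can_comp (binvK g) (binvK f)).
Definition selfbij_inv (f : selfbij) : selfbij := Selfbij (binvK f) (bfunK f).

Fact selfbij_mulA : associative selfbij_mul. Proof. by move=> f g h; apply: selfbijP. Qed.
Fact selfbij_mul1 : left_id selfbij_one selfbij_mul. Proof. by move=> f; apply: selfbijP. Qed.
Fact selfbij_mulr1 : right_id selfbij_one selfbij_mul. Proof. by move=> f; apply: selfbijP. Qed.
Fact selfbij_mulV : left_inverse selfbij_one selfbij_inv selfbij_mul.
Proof. by move=> f; apply: selfbijP => x /=; rewrite bfunK. Qed.
Fact selfbij_mulrV : right_inverse selfbij_one selfbij_inv selfbij_mul.
Proof. by move=> f; apply: selfbijP => x /=; rewrite binvK. Qed.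

HB.instance Definition _ := isGroup.Build selfbij
  selfbij_mulA selfbij_mul1 selfbij_mulr1 selfbij_mulV selfbij_mulrV.

Lemma selfbij_mulE (f g : selfbij) x : (f * g)%g x = f (g x). Proof. by []. Qed.
Lemma selfbijK (f : selfbij) x : (f^-1)%g (f x) = x. Proof. exact: bfunK. Qed.
Lemma selfbijVK (f : selfbij) x : f ((f^-1)%g x) = x. Proof. exact: binvK. Qed.
Lemma selfbij_inv_eq (f : selfbij) x y : f x = y -> (f^-1)%g y = x.
Proof. by move=> <-; rewrite selfbijK. Qed.

(** The identity is the default when the two maps are not inverse to each other, so permutations can
    be written down before this is checked. *)
Definition selfbij_of (f g : X -> X) : selfbij :=
  if pselect (cancel f g /\ cancel g f) is left H then Selfbij (proj1 H) (proj2 H)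
  else 1%g.

Lemma selfbij_ofE f g : cancel f g -> cancel g f -> selfbij_of f g =1 f.
Proof. by rewrite /selfbij_of; case: pselect => // H fK gK; case: H. Qed.

End Selfbij.

Local Notation C := (nat -> bool).

Definition prefixed (w : seq bool) (c : C) : C :=
  fun i => if (i < size w)%N then nth false w i else c (i - size w)%N.
Definition strip (w : seq bool) (c : C) : C := fun i => c (i + size w)%N.
Definition starts (w : seq bool) (c : C) : bool := mkseq c (size w) == w.
Definition incomparable (w w' : seq bool) := ~~ prefix w w' && ~~ prefix w' w.
Arguments incomparable : simpl never.

Lemma starts_prefixed w c : starts w (prefixed w c).
Proof.
apply/eqP/(@eq_from_nth _ false); rewrite size_mkseq // => i iw.
by rewrite nth_mkseq // /prefixed iw.
Qed.

Lemma prefixedK w c : strip w (prefixed w c) = c.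
Proof.
by apply/funext => i; rewrite /strip /prefixed ltnNge leq_addl /= addnK.
Qed.

Lemma stripK w c : starts w c -> prefixed w (strip w c) = c.
Proof.
move=> /eqP wc; apply/funext => i; rewrite /prefixed /strip.
case: ltnP => [iw|wi]; last by rewrite subnK.
by rewrite -[in LHS]wc nth_mkseq.
Qed.

Lemma prefixed_cat w w' c : prefixed (w ++ w') c = prefixed w (prefixed w' c).
Proof.
apply/funext => i; rewrite /prefixed size_cat nth_cat.
case: (ltnP i (size w)) => iw; first by rewrite ltn_addr.
by rewrite ltn_subLR // subnDA.
Qed.

Lemma incomparable_sym w w' : incomparable w w' = incomparable w' w.
Proof. by rewrite /incomparable andbC. Qed.

Lemma starts_incomparable w w' c : incomparable w w' -> starts w c -> ~~ starts w' c.
Proof.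
move=> /andP[n1 n2] /eqP wc; apply/negP => /eqP wc'.
have key (u v : seq bool) : mkseq c (size u) = u -> mkseq c (size v) = v ->
    (size u <= size v)%N -> prefix u v.
  move=> uc vc uv; rewrite prefixE -[in take _ v]vc -{2}uc.
  by rewrite /mkseq -map_take take_iota (minn_idPl uv).
case: (leqP (size w) (size w')) => [h|/ltnW h].
  by rewrite (key _ _ wc wc' h) in n1.
by rewrite (key _ _ wc' wc h) in n2.
Qed.

Lemma incomparable_size w w' : size w = size w' -> w != w' -> incomparable w w'.
Proof.
move=> ww ne; rewrite /incomparable !prefixE !take_oversize ?ww //.
by rewrite [w' == w]eq_sym ne.
Qed.

Lemma incomparable_cat2l w u u' : incomparable (w ++ u) (w ++ u') = incomparable u u'.
Proof.
by rewrite /incomparable !prefixE !size_cat !take_cat !ltnNge !leq_addr /= !addKn !eqseq_cat //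
  !eqxx.
Qed.

Lemma incomparable_take w b : (size b <= size w)%N -> take (size b) w != b -> incomparable w b.
Proof.
move=> bw ne; rewrite /incomparable !prefixE ne andbT.
rewrite take_oversize //; apply: contra ne => /eqP ->.
by rewrite take_size.
Qed.

Lemma incomparable_catr w r e : incomparable w r -> incomparable w (r ++ e).
Proof.
move=> wr; have /andP[n1 n2] := wr; apply/andP; split; last first.
  by apply: contra n2 => /(prefix_trans _); apply; rewrite prefix_prefix.
apply/negP => /prefixP[t rt]; pose c := prefixed (r ++ e) (fun=> false).
have : starts w c by rewrite /c rt prefixed_cat starts_prefixed.
by move=> /(starts_incomparable wr); rewrite /c prefixed_cat starts_prefixed.
Qed.

(** * Three-cycles of slots *)

(** What the group construction uses of [Zp^d]: the filtration by the subgroups [p^n Zp^d], with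
    finite quotients between successive ones, and the dense countable subgroup [Z^d]. *)
Record filtered_zmod := FilteredZmod {
  fz_sort :> zmodType;
  level : nat -> set fz_sort;
  lattice : set fz_sort;
  level0 : forall u, level 0 u;
  level_zmod : forall n, level n 0 /\ forall u v, level n u -> level n v -> level n (u - v);
  level_decr : forall n u, level n.+1 u -> level n u;
  level_sep : forall u, (forall n, level n u) -> u = 0;
  level_cosets : forall n, exists bs : seq fz_sort,
    [/\ uniq bs, forall b, b \in bs -> level n b /\ lattice b,
        forall b b', b \in bs -> b' \in bs -> level n.+1 (b - b') -> b = b' &
        forall u, level n u -> exists2 b, b \in bs & level n.+1 (u - b)];
  lattice_zmod : lattice 0 /\ forall u v, lattice u -> lattice v -> lattice (u - v);
  lattice_dense : forall u n, exists2 a, lattice a & level n (u - a);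
  lattice_countable : exists e : nat -> fz_sort, lattice `<=` range e }.

Arguments level {f}.
Arguments lattice {f}.

Section Slots.
Variable U : filtered_zmod.
Local Notation C := (nat -> bool).
Local Notation X := (U * C)%type.
Local Notation S := (selfbij X).
Implicit Types (u v y : U) (c : C) (s r : U * seq bool) (P Q : set U) (x : X) (g h : S).

Lemma levelN n u : level n u -> level n (- u).
Proof. by move=> nu; rewrite -sub0r; apply: (level_zmod _ n).2 => //;
  apply: (level_zmod _ n).1. Qed.

Lemma levelD n u v : level n u -> level n v -> level n (u + v).
Proof. by move=> nu /levelN nv; rewrite -[v]opprK; apply: (level_zmod _ n).2. Qed.

Lemma level_le m n u : (m <= n)%N -> level n u -> level m u.
Proof.
by move=> /subnK <-; elim: (n - m)%N => [//|k IHk] /level_decr.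
Qed.

Lemma latticeN u : lattice u -> lattice (- u).
Proof. by move=> nu; rewrite -sub0r; apply: (lattice_zmod _).2 => //;
  apply: (lattice_zmod _).1. Qed.

Lemma latticeD u v : lattice u -> lattice v -> lattice (u + v).
Proof. by move=> nu /latticeN nv; rewrite -[v]opprK; apply: (lattice_zmod _).2. Qed.

(* A slot s = (v, w) with offsets P is the set of (v + y, w c) with y in P. *)
Definition pt s y c : X := (s.1 + y, prefixed s.2 c).

Definition in_slot P s : set X := [set x | P (x.1 - s.1) /\ starts s.2 x.2].

Definition slot_move s s' x : X := (x.1 - s.1 + s'.1, prefixed s'.2 (strip s.2 x.2)).

Lemma in_slot_pt P s y c : P y -> in_slot P s (pt s y c).
Proof. by split; rewrite /= ?starts_prefixed // addrC addKr. Qed.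

Lemma in_slotP P s x : in_slot P s x -> exists y c, P y /\ x = pt s y c.
Proof.
case: x => u c [/= Pu sc]; exists (u - s.1), (strip s.2 c); split=> //.
by rewrite /pt stripK // addrC subrK.
Qed.

Lemma slot_move_pt s s' y c : slot_move s s' (pt s y c) = pt s' y c.
Proof. by rewrite /slot_move /pt /= prefixedK (addrC s.1) addrK addrC. Qed.

Lemma slot_disjoint P Q s s' x : incomparable s.2 s'.2 -> in_slot P s x -> ~ in_slot Q s' x.
Proof. by move=> ss' [_ sx] [_ s'x]; move: (starts_incomparable ss' sx); rewrite s'x. Qed.

Definition cycle3_fun P s1 s2 s3 x : X :=
  if `[< in_slot P s1 x >] then slot_move s1 s2 x
  else if `[< in_slot P s2 x >] then slot_move s2 s3 x
  else if `[< in_slot P s3 x >] then slot_move s3 s1 x else x.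

(** The inverse is the cycle in reverse order; the pair of maps is a permutation as soon as the
    three words are incomparable. *)
Definition cycle3 P s1 s2 s3 : S :=
  selfbij_of (cycle3_fun P s1 s2 s3) (cycle3_fun P s3 s2 s1).

Definition is_cycle3 P s1 s2 s3 g :=
  [/\ forall y c, P y -> g (pt s1 y c) = pt s2 y c,
      forall y c, P y -> g (pt s2 y c) = pt s3 y c,
      forall y c, P y -> g (pt s3 y c) = pt s1 y c &
      forall x, ~ in_slot P s1 x -> ~ in_slot P s2 x -> ~ in_slot P s3 x -> g x = x].

Definition incomparable3 s1 s2 s3 :=
  [&& incomparable s1.2 s2.2, incomparable s2.2 s3.2 & incomparable s1.2 s3.2].

Lemma incomparable3_rot s1 s2 s3 : incomparable3 s1 s2 s3 = incomparable3 s2 s3 s1.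
Proof.
rewrite /incomparable3 (incomparable_sym s3.2 s1.2) (incomparable_sym s2.2 s1.2).
by case: incomparable; case: incomparable; case: incomparable.
Qed.

Lemma incomparable3_rev s1 s2 s3 : incomparable3 s1 s2 s3 = incomparable3 s3 s2 s1.
Proof.
rewrite /incomparable3 (incomparable_sym s3.2 s2.2) (incomparable_sym s2.2 s1.2).
rewrite (incomparable_sym s3.2 s1.2).
by case: incomparable; case: incomparable; case: incomparable.
Qed.

Lemma cycle3_funP P s1 s2 s3 : incomparable3 s1 s2 s3 ->
  [/\ forall y c, P y -> cycle3_fun P s1 s2 s3 (pt s1 y c) = pt s2 y c,
      forall y c, P y -> cycle3_fun P s1 s2 s3 (pt s2 y c) = pt s3 y c,
      forall y c, P y -> cycle3_fun P s1 s2 s3 (pt s3 y c) = pt s1 y c &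
      forall x, ~ in_slot P s1 x -> ~ in_slot P s2 x -> ~ in_slot P s3 x ->
        cycle3_fun P s1 s2 s3 x = x].
Proof.
case/and3P => i12 i23 i13; rewrite /cycle3_fun.
have i21 : incomparable s2.2 s1.2 by rewrite incomparable_sym.
have i32 : incomparable s3.2 s2.2 by rewrite incomparable_sym.
have i31 : incomparable s3.2 s1.2 by rewrite incomparable_sym.
split=> [y c Py|y c Py|y c Py|x n1 n2 n3].
- by rewrite asboolT ?slot_move_pt //; apply: in_slot_pt.
- rewrite asboolF; last exact: slot_disjoint i21 (in_slot_pt _ _ Py).
  by rewrite asboolT ?slot_move_pt //; apply: in_slot_pt.
- rewrite asboolF; last exact: slot_disjoint i31 (in_slot_pt _ _ Py).
  rewrite asboolF; last exact: slot_disjoint i32 (in_slot_pt _ _ Py).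
  by rewrite asboolT ?slot_move_pt //; apply: in_slot_pt.
- by rewrite !asboolF.
Qed.

Lemma slot_case P s1 s2 s3 x :
  [\/ in_slot P s1 x, in_slot P s2 x, in_slot P s3 x |
    [/\ ~ in_slot P s1 x, ~ in_slot P s2 x & ~ in_slot P s3 x]].
Proof.
have [h1|h1] := pselect (in_slot P s1 x); first by constructor 1.
have [h2|h2] := pselect (in_slot P s2 x); first by constructor 2.
by have [h3|h3] := pselect (in_slot P s3 x); [constructor 3|constructor 4].
Qed.

Lemma cycle3_fun_can P s1 s2 s3 : incomparable3 s1 s2 s3 ->
  cancel (cycle3_fun P s1 s2 s3) (cycle3_fun P s3 s2 s1).
Proof.
move=> i3; have [a1 a2 a3 a0] := cycle3_funP P i3.
rewrite incomparable3_rev in i3; have [b1 b2 b3 b0] := cycle3_funP P i3.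
move=> x; have [/in_slotP[y [c [Py ->]]]|/in_slotP[y [c [Py ->]]]|/in_slotP[y [c [Py ->]]]
  |[h1 h2 h3]] :=
  slot_case P s1 s2 s3 x.
- by rewrite a1 // b2.
- by rewrite a2 // b1.
- by rewrite a3 // b3.
- by rewrite a0 // b0.
Qed.

Lemma cycle3P P s1 s2 s3 : incomparable3 s1 s2 s3 -> is_cycle3 P s1 s2 s3 (cycle3 P s1 s2 s3).
Proof.
move=> i3; have E : cycle3 P s1 s2 s3 =1 cycle3_fun P s1 s2 s3.
  by apply: selfbij_ofE; apply: cycle3_fun_can => //; rewrite -incomparable3_rev.
have [a1 a2 a3 a0] := cycle3_funP P i3.
by split=> *; rewrite E; auto.
Qed.

(** The four conditions determine [g] at every point. Identities between products of 3-cycles are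
    proved below by checking them. *)
Lemma cycle3_unique P s1 s2 s3 g : incomparable3 s1 s2 s3 -> is_cycle3 P s1 s2 s3 g ->
  g = cycle3 P s1 s2 s3.
Proof.
move=> i3 [b1 b2 b3 b0]; have [a1 a2 a3 a0] := cycle3P P i3; apply: selfbijP => x.
have [/in_slotP[y [c [Py ->]]]|/in_slotP[y [c [Py ->]]]|/in_slotP[y [c [Py ->]]]|[h1 h2 h3]] :=
  slot_case P s1 s2 s3 x.
- by rewrite a1 // b1.
- by rewrite a2 // b2.
- by rewrite a3 // b3.
- by rewrite a0 // b0.
Qed.

Lemma cycle3_rot P s1 s2 s3 : incomparable3 s1 s2 s3 -> cycle3 P s1 s2 s3 = cycle3 P s2 s3 s1.
Proof.
move=> i3; apply: cycle3_unique; first by rewrite -incomparable3_rot.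
by have [a1 a2 a3 a0] := cycle3P P i3; split=> // x *; apply: a0.
Qed.

Lemma cycle3V P s1 s2 s3 : incomparable3 s1 s2 s3 -> (cycle3 P s1 s2 s3)^-1%g = cycle3 P s3 s2 s1.
Proof.
move=> i3; apply: cycle3_unique; first by rewrite -incomparable3_rev.
have [a1 a2 a3 a0] := cycle3P P i3.
by split=> [y c Py|y c Py|y c Py|x h3 h2 h1]; apply: selfbij_inv_eq; auto.
Qed.

Definition carries P g s s' := forall y c, P y -> g (pt s y c) = pt s' y c.

Lemma cycle3_conj P g s1 s2 s3 s1' s2' s3' :
  incomparable3 s1 s2 s3 -> incomparable3 s1' s2' s3' ->
  carries P g s1 s1' -> carries P g s2 s2' -> carries P g s3 s3' ->
  (g * cycle3 P s1 s2 s3 * g^-1)%g = cycle3 P s1' s2' s3'.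
Proof.
move=> i3 i3' g1 g2 g3; apply: cycle3_unique => //.
have [a1 a2 a3 a0] := cycle3P P i3.
have gV s s' : carries P g s s' -> carries P (g^-1)%g s' s.
  by move=> gs y c Py; rewrite -gs // selfbijK.
have ns s s' x : carries P g s s' -> ~ in_slot P s' x -> ~ in_slot P s ((g^-1)%g x).
  move=> gs ns' /in_slotP[y [c [Py e]]]; apply: ns'.
  by rewrite -(selfbijVK g x) e gs //; apply: in_slot_pt.
split=> [y c Py|y c Py|y c Py|x h1 h2 h3]; rewrite !selfbij_mulE.
- by rewrite (gV _ _ g1) // a1 // g2.
- by rewrite (gV _ _ g2) // a2 // g3.
- by rewrite (gV _ _ g3) // a3 // g1.
- by rewrite a0 ?selfbijVK //; apply: ns; eassumption.
Qed.

Lemma cycle3_fix P s1 s2 s3 s : incomparable3 s1 s2 s3 ->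
  incomparable s.2 s1.2 -> incomparable s.2 s2.2 -> incomparable s.2 s3.2 ->
  carries P (cycle3 P s1 s2 s3) s s.
Proof.
move=> i3 h1 h2 h3 y c Py; have [_ _ _ ->] := cycle3P P i3 => //;
  by apply: slot_disjoint (in_slot_pt _ _ Py).
Qed.

(** In the symmetric group, the commutator of [(1 2 3)] and [(1 4 5)] is [(1 2 4)], with maps
    composed from right to left. Thus commutators produced inside a normal subgroup are again
    3-cycles. *)
Lemma cycle3_commutator P s1 s2 s3 s4 s5 :
  pairwise incomparable [:: s1.2; s2.2; s3.2; s4.2; s5.2] ->
  (cycle3 P s1 s2 s3 * cycle3 P s1 s4 s5 * (cycle3 P s1 s2 s3)^-1 * (cycle3 P s1 s4 s5)^-1)%g
  = cycle3 P s1 s2 s4.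
Proof.
move=> /= /and5P[/and5P[i12 i13 i14 i15 _] /and4P[i23 i24 i25 _] /and3P[i34 i35 _] /andP[i45 _] _].
have sy := incomparable_sym.
have ia : incomparable3 s1 s2 s3 by rewrite /incomparable3 i12 i23.
have ib : incomparable3 s1 s4 s5 by rewrite /incomparable3 i14 i45.
have ic : incomparable3 s1 s2 s4 by rewrite /incomparable3 i12 i24.
have ia' := ia; rewrite incomparable3_rev in ia'.
have ib' := ib; rewrite incomparable3_rev in ib'.
rewrite !cycle3V //; apply: cycle3_unique => //.
have [a1 a2 a3 a0] := cycle3P P ia; have [b1 b2 b3 b0] := cycle3P P ib.
have [a1' a2' a3' a0'] := cycle3P P ia'; have [b1' b2' b3' b0'] := cycle3P P ib'.
have a4 := @cycle3_fix P _ _ _ s4 ia ltac:(by rewrite sy) ltac:(by rewrite sy) ltac:(by rewrite sy).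
have a5 := @cycle3_fix P _ _ _ s5 ia ltac:(by rewrite sy) ltac:(by rewrite sy) ltac:(by rewrite sy).
have a4' := @cycle3_fix P _ _ _ s4 ia' ltac:(by rewrite sy) ltac:(by rewrite sy) ltac:(by
  rewrite sy).
have a5' := @cycle3_fix P _ _ _ s5 ia' ltac:(by rewrite sy) ltac:(by rewrite sy) ltac:(by
  rewrite sy).
have b2x := @cycle3_fix P _ _ _ s2 ib ltac:(by rewrite sy) i24 i25.
have b3x := @cycle3_fix P _ _ _ s3 ib ltac:(by rewrite sy) i34 i35.
have b2x' := @cycle3_fix P _ _ _ s2 ib' i25 i24 ltac:(by rewrite sy).
have b3x' := @cycle3_fix P _ _ _ s3 ib' i35 i34 ltac:(by rewrite sy).
split=> [y c Py|y c Py|y c Py|x h1 h2 h4]; rewrite !selfbij_mulE.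
- by rewrite b3' // a5' // b3 // a1.
- by rewrite b2x' // a2' // b1 // a4.
- by rewrite b2' // a3' // b3x // a3.
have [/in_slotP[y [c [Py ->]]]|h3] := pselect (in_slot P s3 x).
  by rewrite b3x' // a1' // b2x // a2.
have [/in_slotP[y [c [Py ->]]]|h5] := pselect (in_slot P s5 x).
  by rewrite b1' // a4' // b2 // a5.
by rewrite b0' // a0' // b0 // a0.
Qed.

End Slots.

(** * The elementary group *)

Section Elementary.
Variable U : filtered_zmod.
Local Notation C := (nat -> bool).
Local Notation X := (U * C)%type.
Local Notation S := (selfbij X).
Implicit Types (u v y : U) (c : C) (s r : U * seq bool) (P Q : set U) (x : X) (g h : S).

(** Length 4 guarantees spare cones ([fresh_blocks]), and base points in the lattice keep the set of
    3-cycles countable. *)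
Definition deep s := (4 <= size s.2)%N /\ lattice s.1.

Definition elementary_gen (n : nat) : set S := [set g | exists s1 s2 s3,
  [/\ deep s1, deep s2, deep s3, incomparable3 s1 s2 s3 & g = cycle3 (level n) s1 s2 s3]].

Definition elementary : set S := generated (fun g => exists n, elementary_gen n g).

Definition supported (D : set X) g := forall x, ~ D x -> g x = x.

Definition blocks : seq (seq bool) :=
  [seq [:: a.1.1; a.1.2; a.2.1; a.2.2] | a : (bool * bool) * (bool * bool)
     <- [seq (a, b) | a <- [seq (e, f) | e <- [:: true; false], f <- [:: true; false]],
                      b <- [seq (e, f) | e <- [:: true; false], f <- [:: true; false]]]].

(** A word of length at least 4 is comparable with only one of the sixteen words of length 4, namely
    its beginning; six words leave at least ten of them free. *)
Lemma fresh_blocks (ws : seq (seq bool)) : (size ws <= 6)%N ->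
  all (fun w => 4 <= size w)%N ws ->
  exists b1 b2 b3 b4, all (fun b => (size b == 4)%N && all (incomparable b) ws) [:: b1; b2; b3;
    b4] /\
    pairwise incomparable [:: b1; b2; b3; b4].
Proof.
move=> ws6 /allP ws4; pose used := [seq take 4 w | w <- ws].
pose fresh := [seq b <- blocks | b \notin used].
have fsize : (10 <= size fresh)%N.
  have : (16 <= size fresh + size used)%N.
    rewrite /fresh size_filter -[16%N]/(size blocks) -(count_predC (mem used)) addnC leq_add2l.
    rewrite -size_filter; apply: uniq_leq_size; first exact: filter_uniq.
    by move=> b; rewrite mem_filter => /andP[].
  by rewrite size_map; lia.
have funiq : uniq fresh by apply: filter_uniq.
have fP b : b \in fresh -> (size b == 4)%N && all (incomparable b) ws.
  rewrite mem_filter => /andP[bu bb]; have b4 : size b = 4%N.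
    by apply/eqP; have /allP := erefl : all (fun b : seq bool => size b == 4%N) blocks; apply.
  rewrite b4 eqxx; apply/allP => w ww; rewrite incomparable_sym incomparable_take ?b4 ?ws4 //.
  by apply: contraNneq bu => <-; apply: map_f.
case: fresh fsize funiq fP => [|b1 [|b2 [|b3 [|b4 l]]]] // _ fu fP.
have {}fP b : b \in [:: b1; b2; b3; b4] -> (size b == 4)%N && all (incomparable b) ws.
  by move=> bb; apply: fP; move: bb; rewrite !inE => /or4P[] ->; rewrite ?orbT.
exists b1, b2, b3, b4; split; first exact/allP.
have := take_uniq 4 fu; rewrite /= take0 -/(uniq [:: b1; b2; b3; b4]).
rewrite uniq_pairwise; apply: (@sub_in_pairwise _ (mem [:: b1; b2; b3; b4])); last exact/allP.
move=> a b /fP/andP[/eqP a4 _] /fP/andP[/eqP bb4 _] ne.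
by apply: incomparable_size => //; rewrite a4.
Qed.

Section Normalised.
Variable N : set S.
Hypothesis Nsub : is_subgroup N.
Hypothesis Nnorm : forall e g, elementary e -> N g -> N (e * g * e^-1)%g.

Lemma elementary_cycle3 n s1 s2 s3 : deep s1 -> deep s2 -> deep s3 ->
  incomparable3 s1 s2 s3 -> elementary (cycle3 (level n) s1 s2 s3).
Proof. by move=> d1 d2 d3 i3; apply: generated_mem; exists n, s1, s2, s3. Qed.

Lemma supportedM D g h : supported D g -> supported D h -> supported D (g * h)%g.
Proof. by move=> Dg Dh x nD; rewrite selfbij_mulE Dh // Dg. Qed.

Lemma supportedV D g : supported D g -> supported D (g^-1)%g.
Proof. by move=> Dg x nD; apply: selfbij_inv_eq; apply: Dg. Qed.

Lemma supported_stable D g x : supported D g -> D x -> D (g x).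
Proof.
move=> Dg Dx; apply: contrapT => nD; apply: (nD); rewrite (_ : g x = x) //.
by rewrite -{2}(selfbijK g x) (supportedV Dg).
Qed.

Lemma supported_commute D g h : supported D g -> (forall x, D x -> h x = x) ->
  (g * h = h * g)%g.
Proof.
move=> Dg Dh; apply: selfbijP => x; rewrite !selfbij_mulE.
have [Dx|nD] := pselect (D x).
  by rewrite (Dh x Dx) (Dh (g x)) //; apply: supported_stable.
rewrite (Dg x nD) Dg // => Dhx; apply: nD; have := Dh _ Dhx.
by move/(congr1 (h^-1)%g); rewrite !selfbijK => <-.
Qed.

(** The conjugate [k] of [h1^-1] by [g] is supported on the image of [D], which is disjoint from
    [D]. Hence [k * h1], which lies in [N], has the same commutator with [h2] as [h1]. *)
Lemma commutator_moved D g h1 h2 : N g -> (forall x, D x -> ~ D (g x)) ->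
  elementary h1 -> elementary h2 -> supported D h1 -> supported D h2 ->
  N (h1 * h2 * h1^-1 * h2^-1)%g.
Proof.
move=> Ng gD e1 e2 D1 D2; have [N1 NM NV] := Nsub.
pose k := (g * h1^-1 * g^-1)%g.
have Nkh : N (k * h1)%g.
  have := Nnorm (generatedV e1) (NV _ Ng); rewrite invgK => /(NM _ _ Ng).
  by rewrite /k !mulgA.
have Dk x : D x -> k x = x.
  move=> Dx; rewrite /k !selfbij_mulE (supportedV D1) ?selfbijVK // => DV.
  by apply: (gD _ DV); rewrite selfbijVK.
have := NM _ _ Nkh (Nnorm e2 (NV _ Nkh)).
have Dc : supported D (h1 * h2 * h1^-1 * h2^-1)%g.
  by apply: supportedM; [apply: supportedM; [exact: supportedM|]|]; apply: supportedV.
suff -> : (k * h1 * (h2 * (k * h1)^-1 * h2^-1) = h1 * h2 * h1^-1 * h2^-1)%g by [].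
rewrite invgM !mulgA -(mulgA _ _ h2^-1%g).
have DkV x : D x -> (k^-1)%g x = x by move=> Dx; apply: selfbij_inv_eq; apply: Dk.
rewrite -(supported_commute (supportedV D2) DkV).
by rewrite -[RHS](mulgK k) (supported_commute Dc Dk) !mulgA.
Qed.

(** Conjugation by the cycle of [s1], [r], [q] carries [s1] to [r] and fixes [s2] and [s3]; the slot
    [q] completes the 3-cycle. *)
Lemma cycle3_replace n s1 s2 s3 r q : deep s1 -> deep s2 -> deep s3 -> deep r -> deep q ->
  pairwise incomparable [:: s1.2; s2.2; s3.2; r.2; q.2] ->
  N (cycle3 (level n) s1 s2 s3) -> N (cycle3 (level n) r s2 s3).
Proof.
move=> d1 d2 d3 dr dq /= /and5P[/and5P[i12 i13 i1r i1q _] /and4P[i23 i2r i2q _]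
  /and3P[i3r i3q _] /andP[irq _] _] Ns.
have sy := incomparable_sym.
have i3 : incomparable3 s1 r q by rewrite /incomparable3 i1r irq.
have i123 : incomparable3 s1 s2 s3 by rewrite /incomparable3 i12 i23.
have ir23 : incomparable3 r s2 s3 by rewrite /incomparable3 (sy r.2) i2r i23 (sy r.2).
rewrite -(@cycle3_conj _ (level n) (cycle3 (level n) s1 r q) s1 s2 s3) //.
- by apply: Nnorm => //; apply: elementary_cycle3.
- by have [] := cycle3P (level n) i3.
- by apply: cycle3_fix => //; rewrite sy.
- by apply: cycle3_fix => //; rewrite sy.
Qed.

Lemma cycle3_replace3 n s1 s2 s3 r1 r2 r3 q :
  deep s1 -> deep s2 -> deep s3 -> deep r1 -> deep r2 -> deep r3 -> deep q ->
  pairwise incomparable [:: s1.2; s2.2; s3.2; r1.2; r2.2; r3.2; q.2] ->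
  N (cycle3 (level n) s1 s2 s3) -> N (cycle3 (level n) r1 r2 r3).
Proof.
move=> d1 d2 d3 e1 e2 e3 dq /= /andP[/and5P[i12 i13 j11 j12 /and3P[j13 i1q _]]].
move=> /andP[/and5P[i23 j21 j22 j23 /andP[i2q _]]].
move=> /and5P[/and5P[j31 j32 j33 i3q _] /and4P[k12 k13 k1q _] /and3P[k23 k2q _] /andP[k3q _] _].
have sy := incomparable_sym.
move=> Ns.
have {Ns} := @cycle3_replace n s1 s2 s3 r1 q d1 d2 d3 e1 dq _ Ns.
rewrite /= i12 i13 j11 i1q i23 j21 i2q j31 i3q k1q => /(_ isT).
rewrite cycle3_rot; last by rewrite /incomparable3 !(sy r1.2) j21 i23.
move=> Ns; have {Ns} := @cycle3_replace n s2 s3 r1 r2 q d2 d3 e1 e2 dq _ Ns.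
rewrite /= i23 j21 j22 i2q j31 j32 i3q k12 k1q k2q => /(_ isT).
rewrite cycle3_rot; last by rewrite /incomparable3 !(sy r2.2) j32 j31 k12.
move=> Ns; have {Ns} := @cycle3_replace n s3 r1 r2 r3 q d3 e1 e2 e3 dq _ Ns.
rewrite /= j31 j32 j33 i3q k12 k13 k1q k23 k2q k3q => /(_ isT).
by rewrite cycle3_rot // /incomparable3 !(sy r3.2) k13 k12.
Qed.

(** The two triples may overlap, so the passage goes through a third triple of fresh slots,
    incomparable with both; a fourth fresh slot is the spare one of [cycle3_replace3]. *)
Lemma deep_cycles_conjugate n s1 s2 s3 s1' s2' s3' :
  deep s1 -> deep s2 -> deep s3 -> incomparable3 s1 s2 s3 ->
  deep s1' -> deep s2' -> deep s3' -> incomparable3 s1' s2' s3' ->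
  N (cycle3 (level n) s1 s2 s3) -> N (cycle3 (level n) s1' s2' s3').
Proof.
move=> d1 d2 d3 /and3P[i12 i23 i13] e1 e2 e3 /and3P[j12 j23 j13].
have [] := @fresh_blocks [:: s1.2; s2.2; s3.2; s1'.2; s2'.2; s3'.2] erefl.
  by rewrite /= d1.1 d2.1 d3.1 e1.1 e2.1 e3.1.
move=> b1 [b2 [b3 [b4 [/= /and5P[h1 h2 h3 h4 _]]]]].
move=> /and4P[/and4P[k12 k13 k14 _] /and3P[k23 k24 _] /andP[k34 _] _].
have sy := incomparable_sym.
have db b : size b = 4%N -> deep (0, b) by move=> bs; split; rewrite ?bs //;
  apply: (lattice_zmod _).1.
move: h1 h2 h3 h4.
move=> /andP[/eqP/db f1 /and5P[a11 a12 a13 a14 /and3P[a15 a16 _]]].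
move=> /andP[/eqP/db f2 /and5P[a21 a22 a23 a24 /and3P[a25 a26 _]]].
move=> /andP[/eqP/db f3 /and5P[a31 a32 a33 a34 /and3P[a35 a36 _]]].
move=> /andP[/eqP/db f4 /and5P[a41 a42 a43 a44 /and3P[a45 a46 _]]].
move=> Ns; apply: (cycle3_replace3 f1 f2 f3 e1 e2 e3 f4); last first.
  apply: (cycle3_replace3 d1 d2 d3 f1 f2 f3 f4) Ns => /=.
  rewrite i12 i13 i23 k12 k13 k14 k23 k24 k34 !(sy s1.2) !(sy s2.2) !(sy s3.2).
  by rewrite a11 a12 a13 a21 a22 a23 a31 a32 a33 a41 a42 a43.
rewrite /= j12 j13 j23 k12 k13 k14 k23 k24 k34 a14 a15 a16 a24 a25 a26 a34 a35 a36.
by rewrite !(sy _ b4) a44 a45 a46.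
Qed.

Definition slot_shift s b : U * seq bool := (s.1 + b, s.2).

(** A slot of level [n] is a finite disjoint union of slots of level [n + 1] with the same word, so
    a cycle of level [n] is the product of the cycles of the pieces. *)
Lemma cycle3_level_split n : elementary_gen n.+1 `<=` N -> elementary_gen n `<=` N.
Proof.
move=> sub _ [s1 [s2 [s3 [d1 d2 d3 i3 ->]]]]; have [N1 NM NV] := Nsub.
have [bs [ubs bsl bsd bsc]] := level_cosets U n.
(* The union of the cosets represented by [L]; one coset at a time is added by induction on [L]. *)
pose P (L : seq U) : set U := [set y | exists2 b, b \in L & level n.+1 (y - b)].
suff key (L : seq U) : uniq L -> {subset L <= bs} -> N (cycle3 (P L) s1 s2 s3).
  have -> : level n = P bs; last exact: key.
  apply/seteqP; split=> [y /bsc//|y [b /bsl[bn _] yb]].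
  by rewrite -(subrK b y); apply: levelD => //; apply: level_decr.
elim: L => [_ _|b L IHL /= /andP[bL uL] Lbs].
  suff <- : 1%g = cycle3 (P [::]) s1 s2 s3 by [].
  by apply: cycle3_unique => //; split=> [y c [b]|y c [b]|y c [b]|].
have bbs : b \in bs by apply: Lbs; rewrite mem_head.
have {}Lbs : {subset L <= bs} by move=> a aL; apply: Lbs; rewrite inE aL orbT.
have i3b : incomparable3 (slot_shift s1 b) (slot_shift s2 b) (slot_shift s3 b) by [].
have Nb : N (cycle3 (level n.+1) (slot_shift s1 b) (slot_shift s2 b) (slot_shift s3 b)).
  have ds s : deep s -> deep (slot_shift s b).
    by move=> [s4 sl]; split=> //; apply: latticeD => //; apply: (bsl b bbs).2.
  by apply: sub; exists (slot_shift s1 b), (slot_shift s2 b), (slot_shift s3 b); split; auto.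
have [a1 a2 a3 a0] := cycle3P (level n.+1) i3b.
have [b1 b2 b3 b0] := cycle3P (P L) i3.
have disj y : P L y -> ~ level n.+1 (y - b).
  move=> [a aL ya] yb; have : level n.+1 (a - b).
    by rewrite -(subrKA y) addrC; apply: levelD => //; rewrite -opprB; apply: levelN.
  by move/(bsd _ _ (Lbs _ aL) bbs) => e; rewrite -e aL in bL.
have ptb s y c : pt s y c = pt (slot_shift s b) (y - b) c.
  by rewrite /pt /slot_shift /= addrA addrAC addrK.
have inb s x : in_slot (level n.+1) (slot_shift s b) x -> in_slot (P (b :: L)) s x.
  by move=> [xs sx]; split=> //; exists b; rewrite ?mem_head //; rewrite /= opprD addrA in xs.
have inL s x : in_slot (P L) s x -> in_slot (P (b :: L)) s x.
  by move=> [[a aL xa] sx]; split=> //; exists a; rewrite ?inE ?aL ?orbT.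
suff <- : (cycle3 (level n.+1) (slot_shift s1 b) (slot_shift s2 b) (slot_shift s3 b) *
   cycle3 (P L) s1 s2 s3)%g = cycle3 (P (b :: L)) s1 s2 s3 by apply: NM => //; apply: IHL.
have /and3P[i12 i23 i13] := i3.
have [i21 [i32 i31]] : incomparable s2.2 s1.2 /\ incomparable s3.2 s2.2 /\ incomparable s3.2 s1.2.
  by rewrite !(incomparable_sym _ s1.2) (incomparable_sym s3.2).
have outb s s' y c : (s' = s \/ incomparable s.2 s'.2) -> P L y ->
    ~ in_slot (level n.+1) (slot_shift s' b) (pt s y c).
  case=> [->|ss'] Py.
    by case=> /= + _; rewrite opprD addrA (addrC s.1) addrK; apply: disj.
  by apply: (@slot_disjoint _ (P L) _ s) => //; apply: in_slot_pt.
have outL s s' y c : (s' = s \/ incomparable s.2 s'.2) -> level n.+1 (y - b) ->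
    ~ in_slot (P L) s' (pt s y c).
  case=> [->|ss'] yb.
    by case=> /= + _; rewrite (addrC s.1) addrK => /disj.
  by rewrite ptb; apply: (@slot_disjoint _ (level n.+1) _ (slot_shift s b)) => //;
    apply: in_slot_pt.
apply: cycle3_unique => //; split=> [y c|y c|y c|x h1 h2 h3].
- case=> a; rewrite inE => /orP[/eqP-> yb|aL ya]; rewrite selfbij_mulE.
    rewrite b0; [|by apply: outL; auto..].
    by rewrite [in LHS]ptb a1 // -ptb.
  have Py : P L y by exists a.
  by rewrite b1 // a0 //; apply: outb; auto.
- case=> a; rewrite inE => /orP[/eqP-> yb|aL ya]; rewrite selfbij_mulE.
    rewrite b0; [|by apply: outL; auto..].
    by rewrite [in LHS]ptb a2 // -ptb.
  have Py : P L y by exists a.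
  by rewrite b2 // a0 //; apply: outb; auto.
- case=> a; rewrite inE => /orP[/eqP-> yb|aL ya]; rewrite selfbij_mulE.
    rewrite b0; [|by apply: outL; auto..].
    by rewrite [in LHS]ptb a3 // -ptb.
  have Py : P L y by exists a.
  by rewrite b3 // a0 //; apply: outb; auto.
- by rewrite selfbij_mulE b0 ?a0 //; auto.
Qed.

End Normalised.
End Elementary.

Arguments elementary_gen {U}.
Arguments elementary {U}.

(** * Normalised subgroups contain the elementary group; translations are elementary *)

Section ElementaryTheory.
Variable U : filtered_zmod.
Local Notation C := (nat -> bool).
Local Notation X := (U * C)%type.
Local Notation S := (selfbij X).
Implicit Types (u v : U) (c : C) (s r : U * seq bool) (P Q : set U) (x y z : X) (g h : S).

Definition slot_near k x z := level k (x.1 - z.1) /\ forall i, (i < k)%N -> x.2 i = z.2 i.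

Definition slot_continuous g := forall x l, exists k, forall z, slot_near k x z -> slot_near l
  (g x) (g z).

Lemma slot_near_sym k x z : slot_near k x z -> slot_near k z x.
Proof. by move=> [n1 n2]; split=> [|i ik]; [rewrite -opprB; apply: levelN|rewrite n2]. Qed.

Lemma slot_near_trans k x y z : slot_near k x y -> slot_near k y z -> slot_near k x z.
Proof.
move=> [n1 n2] [m1 m2]; split=> [|i ik]; last by rewrite n2 ?m2.
by rewrite -(subrKA y.1); apply: levelD.
Qed.

Lemma slot_near_le k l x z : (l <= k)%N -> slot_near k x z -> slot_near l x z.
Proof.
move=> lk [n1 n2]; split=> [|i il]; first exact: level_le lk n1.
by rewrite n2 // (leq_trans il).
Qed.

Lemma slot_near_eq x z : (forall k, slot_near k x z) -> x = z.
Proof.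
move=> xz; rewrite [x]surjective_pairing [z]surjective_pairing; congr pair.
  by apply/eqP; rewrite -subr_eq0; apply/eqP/level_sep => k; case: (xz k).
by apply/funext => i; case: (xz i.+1) => _; apply.
Qed.

Lemma slot_continuousM g h : slot_continuous g -> slot_continuous h -> slot_continuous (g * h)%g.
Proof.
move=> cg ch x l; have [m gm] := cg (h x) l; have [k hk] := ch x m.
by exists k => z /hk/gm.
Qed.

Lemma moved_slot g : slot_continuous g -> g <> 1%g ->
  exists n s, deep s /\ forall x, in_slot (level n) s x -> ~ in_slot (level n) s (g x).
Proof.
move=> cg g1; have [x gx] : exists x, g x <> x.
  by apply: contrapT => /forallNP gx; apply: g1; apply: selfbijP => x; apply: contrapT; apply: gx.
have [l gxl] : exists l, ~ slot_near l (g x) x.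
  by apply: contrapT => /forallNP nx; apply: gx; apply: slot_near_eq => k; apply: contrapT;
    apply: nx.
(* With [k >= l], a point of the slot around [x] whose image stayed in the slot would have an image
   [l]-near [x]; with [k >= k0] that image is [l]-near [g x]. The bound 4 makes the slot deep. *)
have [k0 gk0] := cg x l; pose k := maxn (maxn k0 l) 4.
have [v lv xv] := lattice_dense x.1 k.
exists k, (v, mkseq x.2 k); split.
  by split => //; rewrite size_mkseq leq_maxr.
have nearD z : in_slot (level k) (v, mkseq x.2 k) z -> slot_near k x z.
  move=> [/= zv /eqP]; rewrite size_mkseq => e; split; last first.
    by move=> i ik; rewrite -(nth_mkseq false x.2 ik) -e nth_mkseq.
  by rewrite -(subrKA v); apply: levelD => //; rewrite -opprB; apply: levelN.
move=> z /nearD xz /nearD xgz; apply: gxl; apply: slot_near_sym.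
apply: slot_near_trans (slot_near_le _ xgz) _; first by rewrite /k !leq_max leqnn orbT.
apply: slot_near_sym; apply: gk0; apply: slot_near_le xz.
by rewrite /k !leq_max leqnn.
Qed.

Lemma cycle3_supported D P s1 s2 s3 : incomparable3 s1 s2 s3 -> in_slot P s1 `<=` D ->
  in_slot P s2 `<=` D -> in_slot P s3 `<=` D -> supported D (cycle3 P s1 s2 s3).
Proof.
move=> i3 h1 h2 h3 x nD; have [_ _ _ fix0] := cycle3P P i3.
by apply: fix0; [move/h1|move/h2|move/h3].
Qed.

Lemma in_slot_cat n m v w w' x : (n <= m)%N -> in_slot (level m) (v, w ++ w') x ->
  in_slot (level n) (v, w) x.
Proof.
move=> nm [/= xv /eqP xw]; split; first exact: level_le nm xv.
have := congr1 (take (size w)) xw; rewrite take_size_cat //.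
rewrite /mkseq -map_take take_iota size_cat (minn_idPl (leq_addr _ _)) => e.
exact/eqP.
Qed.

(** Inside a slot moved off itself there is room for two 3-cycles with one slot in common. Their
    commutator lies in [N] and is a 3-cycle, at every level at least that of the moved slot;
    conjugation gives all 3-cycles of these levels, and splitting gives the coarser ones. *)
Lemma normalised_contains_elementary (N : set S) g : is_subgroup N ->
  (forall e h, elementary e -> N h -> N (e * h * e^-1)%g) ->
  N g -> slot_continuous g -> g <> 1%g -> elementary `<=` N.
Proof.
move=> Nsub Nnorm Ng cg g1; have [n0 [[v w] [ds moved]]] := moved_slot cg g1.
(* Eight disjoint subslots, of which the commutator needs five. *)
pose s (a b c : bool) : U * seq bool := (v, w ++ [:: a; b; c]).
have dss (a b c : bool) : deep (s a b c).
  by case: ds => /= w4 lv; split=> //=; rewrite size_cat addn3 leqW // leqW // leqW.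
have inc (a b c a' b' c' : bool) : [:: a; b; c] != [:: a'; b'; c'] ->
    incomparable (s a b c).2 (s a' b' c').2.
  by move=> ne; rewrite incomparable_cat2l incomparable_size.
have small m : (n0 <= m)%N -> elementary_gen m `<=` N.
  move=> nm _ [s1 [s2 [s3 [d1 d2 d3 i3 ->]]]].
  pose a := cycle3 (level m) (s true true true) (s true true false) (s true false true).
  pose b := cycle3 (level m) (s true true true) (s true false false) (s false true true).
  have Nab : N (a * b * a^-1 * b^-1)%g.
    apply: (commutator_moved Nsub Nnorm Ng moved).
    - by apply: elementary_cycle3 => //; rewrite /incomparable3 !inc.
    - by apply: elementary_cycle3 => //; rewrite /incomparable3 !inc.
    - by apply: cycle3_supported; rewrite ?/incomparable3 ?inc // => x; apply: in_slot_cat.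
    - by apply: cycle3_supported; rewrite ?/incomparable3 ?inc // => x; apply: in_slot_cat.
  rewrite cycle3_commutator in Nab; last by rewrite /= !inc.
  by apply: (deep_cycles_conjugate Nnorm _ _ _ _ d1 d2 d3 i3 Nab) => //;
    rewrite /incomparable3 !inc.
have all_levels k m : (n0 <= m + k)%N -> elementary_gen m `<=` N.
  elim: k m => [|k IHk] m; first by rewrite addn0; apply: small.
  by rewrite addnS -addSn => /IHk; apply: cycle3_level_split.
apply: generated_sub => // h [m]; apply: (all_levels n0).
by rewrite leq_addl.
Qed.

Definition translate u : S :=
  selfbij_of (fun x : X => (x.1 + u, x.2)) (fun x : X => (x.1 - u, x.2)).

Lemma translateE u x : translate u x = (x.1 + u, x.2).
Proof.
by rewrite /translate selfbij_ofE => // -[a c] /=; rewrite ?addrK ?subrK.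
Qed.

Lemma translateD u v : translate (u + v) = (translate u * translate v)%g.
Proof.
by apply: selfbijP => x; rewrite selfbij_mulE !translateE /= -addrA (addrC v).
Qed.

Lemma translate0 : translate 0 = 1%g.
Proof. by apply: selfbijP => -[a c]; rewrite translateE /= addr0. Qed.

Lemma translateN u : translate (- u) = (translate u)^-1%g.
Proof. by apply: (mulgI (translate u)); rewrite -translateD subrr mulgV translate0. Qed.

Lemma translate_inj : injective translate.
Proof.
move=> u v /(congr1 (fun g : S => (g (0, fun=> false)).1)).
by rewrite !translateE /= !add0r.
Qed.

Lemma translate_comm u v : (translate u * translate v = translate v * translate u)%g.
Proof. by rewrite -!translateD addrC. Qed.

Definition slot_translate w b : S :=
  selfbij_of (fun x : X => if starts w x.2 then (x.1 + b, x.2) else x)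
             (fun x : X => if starts w x.2 then (x.1 - b, x.2) else x).

Lemma slot_translateE w b x :
  slot_translate w b x = if starts w x.2 then (x.1 + b, x.2) else x.
Proof.
rewrite /slot_translate selfbij_ofE //.
  by move=> [a c] /=; case wc: (starts w c) => /=; rewrite wc ?addrK.
by move=> [a c] /=; case wc: (starts w c) => /=; rewrite wc ?subrK.
Qed.

Lemma slot_translateN w b : slot_translate w (- b) = (slot_translate w b)^-1%g.
Proof.
apply: (mulgI (slot_translate w b)); rewrite mulgV; apply: selfbijP => x.
rewrite selfbij_mulE !slot_translateE; case: x => a c /=.
by case wc: (starts w c) => /=; rewrite wc ?subrK.
Qed.

Lemma slot_translate_split w b :
  slot_translate w b = (slot_translate (rcons w false) b * slot_translate (rcons w true) b)%g.
Proof.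
have st (c : C) e : starts (rcons w e) c = starts w c && (c (size w) == e).
  by rewrite /starts size_rcons mkseqS eqseq_rcons.
apply: selfbijP => -[a c]; rewrite selfbij_mulE !slot_translateE /= !st.
by case wc: (starts w c) => /=; case e: (c (size w)) => /=; rewrite ?st ?wc ?e.
Qed.

(** At level 0 a slot is a whole cone, whatever its base point. Two cycles of the same three cones,
    with base points [b] and 0 on the cone [w], have a quotient that translates [w] by [b] and [w']
    by [- b]. *)
Lemma slot_translate_opposite w w' b : (4 <= size w)%N -> (4 <= size w')%N ->
  incomparable w w' -> lattice b ->
  elementary (slot_translate w b * (slot_translate w' b)^-1)%g.
Proof.
move=> w4 w4' ww' lb.
have [] := @fresh_blocks [:: w; w'] isT; first by rewrite /= w4 w4'.
move=> q [_ [_ [_ [/= /andP[/andP[/eqP q4 /and3P[qw qw' _]] _] _]]]].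
have l0 : lattice (0 : U) by apply: (lattice_zmod _).1.
have d0 : deep ((0 : U), q) by split; rewrite //= q4.
have ds u w0 : lattice u -> (4 <= size w0)%N -> deep (u, w0) by split.
have i3 (u : U) : incomparable3 (0 : U, q) (u, w) (0 : U, w').
  by rewrite /incomparable3 qw ww' qw'.
have e3 u : lattice u -> elementary (cycle3 (level 0) (0, q) (u, w) (0, w')).
  by move=> lu; apply: elementary_cycle3 => //; apply: ds.
have [a1 a2 a3 a0] := cycle3P (level 0) (i3 b).
have [b1 b2 b3 b0] := cycle3P (level 0) (i3 0).
suff <- : (cycle3 (level 0) (0 : U, q) (b, w) (0 : U, w') *
    (cycle3 (level 0) (0 : U, q) (0, w) (0 : U, w'))^-1)%g =
    (slot_translate w b * (slot_translate w' b)^-1)%g.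
  by apply: generatedM; [apply: e3|apply: generatedV; apply: e3].
have w'w : incomparable w' w by rewrite incomparable_sym.
have P0 (y : U) : level 0 y by apply: level0.
have st w0 w1 c : incomparable w1 w0 -> starts w0 (prefixed w1 c) = false.
  by move=> ii; apply/negbTE; apply: starts_incomparable ii (starts_prefixed _ _).
apply: selfbijP => x; rewrite !selfbij_mulE -slot_translateN !slot_translateE.
have [/in_slotP[y [c [_ ->]]]|/in_slotP[y [c [_ ->]]]|/in_slotP[y [c [_ ->]]]|[h1 h2 h3]] :=
  slot_case (level 0) (0 : U, q) (0 : U, w) (0 : U, w') x.
- rewrite (selfbij_inv_eq (b3 y c (P0 y))) a3 //=.
  by rewrite (st _ _ _ qw') /= (st _ _ _ qw).
- rewrite (selfbij_inv_eq (b1 y c (P0 y))) a1 //= (st _ _ _ ww') /= starts_prefixed.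
  by rewrite /pt /= add0r addrC.
- rewrite (selfbij_inv_eq (b2 y c (P0 y))).
  have -> : pt (0 : U, w) y c = pt (b, w) (y - b) c by rewrite /pt /= add0r (addrC b) subrK.
  by rewrite a2 //= starts_prefixed /= (st _ _ _ w'w) /pt /= !add0r.
have b0' : (cycle3 (level 0) (0 : U, q) (0, w) (0 : U, w'))^-1%g x = x.
  by apply: selfbij_inv_eq; apply: b0.
rewrite b0' a0 //; last by move=> [_ sx]; apply: h2; split=> //; apply: P0.
have -> : starts w' x.2 = false by apply/negP => sx; apply: h3; split=> //; apply: P0.
by have -> : starts w x.2 = false by apply/negP => sx; apply: h2; split=> //; apply: P0.
Qed.

(** Let [T_w] be the translation on the cone [w], and split a disjoint cone [r] into halves [r0] and
    [r1]. The quotients [T_w / T_r0], [T_w / T_r1] and [T_w / T_r] are elementary and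
    [T_r = T_r0 T_r1], so the first two divided by the third leave [T_w]. *)
Lemma slot_translate_deep w b : (4 <= size w)%N -> lattice b -> elementary (slot_translate w b).
Proof.
move=> w4 lb.
have [] := @fresh_blocks [:: w] isT; first by rewrite /= w4.
move=> r [_ [_ [_ [/= /andP[/andP[/eqP r4 /andP[rw _]] _] _]]]].
have rs e : (4 <= size (rcons r e))%N by rewrite size_rcons r4.
have wr : incomparable w r by rewrite incomparable_sym.
have wre e : incomparable w (rcons r e) by rewrite -cats1 incomparable_catr.
have A := slot_translate_opposite w4 (_ : 4 <= size r)%N wr lb.
have B e := slot_translate_opposite w4 (rs e) (wre e) lb.
have {}A := A ltac:(by rewrite r4).
move: A; rewrite (slot_translate_split r) invgM mulgA => A.
have comm (v u : seq bool) (d : U) : (slot_translate v d * slot_translate u d =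
  slot_translate u d * slot_translate v d)%g.
  apply: selfbijP => x; rewrite !selfbij_mulE !slot_translateE.
  by case sv: (starts v x.2); case su: (starts u x.2); rewrite /= ?sv ?su.
have := generatedM (generatedM (B false) (B true)) (generatedV A).
move: (comm (rcons r true) (rcons r false) b) (comm w (rcons r false) b).
move: (slot_translate w b) (slot_translate (rcons r false) b) (slot_translate (rcons r true) b).
move=> f a e ae fa; rewrite !invgM !invgK !mulgA.
rewrite -(mulgA (f * a^-1 * f * e^-1)%g) -ae mulgA (mulgVK e) -(mulgA (f * a^-1)%g) fa.
by rewrite mulgA mulgVK mulgK.
Qed.

Lemma translate_elementary b : lattice b -> elementary (translate b).
Proof.
move=> lb; suff H w : elementary (slot_translate w b).
  exact: (H [::]).
have [k] : exists k, (4 <= size w + k)%N by exists 4; rewrite leq_addl.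
elim: k w => [|k IHk] w; first by rewrite addn0 => /slot_translate_deep; apply.
by move=> wk; rewrite slot_translate_split; apply: generatedM; apply: IHk;
  rewrite size_rcons addSnnS.
Qed.

End ElementaryTheory.

(** * The groups attached to a family of maps of the Cantor space *)

Section Ambient.
Variable U : filtered_zmod.
Local Notation C := (nat -> bool).
Local Notation X := (U * C)%type.
Local Notation S := (selfbij X).
Implicit Types (u v y : U) (s r : U * seq bool) (P Q : set U) (x z : X) (g h : S).

Definition centralises_level n g :=
  forall u, level n u -> (g * translate u = translate u * g)%g.

Lemma centralises_level_le m n g : (m <= n)%N -> centralises_level m g -> centralises_level n g.
Proof. by move=> mn cg u /(level_le mn)/cg. Qed.

Lemma centralises_levelM n g h :
  centralises_level n g -> centralises_level n h -> centralises_level n (g * h)%g.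
Proof. by move=> cg ch u nu; rewrite -mulgA ch // mulgA cg // mulgA. Qed.

Lemma centralises_levelV n g : centralises_level n g -> centralises_level n (g^-1)%g.
Proof.
move=> cg u nu; apply: (mulgI g); apply: (mulIg g).
by rewrite !mulgA mulgV mul1g -!mulgA mulVg mulg1 -cg.
Qed.

Lemma translate_centralises n u : centralises_level n (translate u).
Proof. by move=> v _; apply: translate_comm. Qed.

(** A translation by an element of level [n] preserves each slot of level [n] and shifts all offsets
    alike. *)
Lemma cycle3_centralises n s1 s2 s3 : incomparable3 s1 s2 s3 ->
  centralises_level n (cycle3 (level n) s1 s2 s3).
Proof.
move=> i3 u nu; apply: (mulIg (translate u)^-1%g); rewrite mulgK; apply/esym.
have [a1 a2 a3 a0] := cycle3P (level n) i3.
have tr s y c : (translate u) (pt s y c) = pt s (y + u) c by rewrite translateE /= -addrA.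
have trV s y c : ((translate u)^-1)%g (pt s y c) = pt s (y - u) c.
  by apply: selfbij_inv_eq; rewrite tr subrK.
have inV s x : ~ in_slot (level n) s x -> ~ in_slot (level n) s (((translate u)^-1)%g x).
  move=> ns [xs sx]; apply: ns; move: xs sx; rewrite -translateN translateE /= => xs sx; split=> //.
  have -> : x.1 - s.1 = (x.1 - u - s.1) + u by rewrite (addrAC x.1) subrK.
  exact: levelD.
apply: cycle3_unique => //; split=> [y c yn|y c yn|y c yn|x h1 h2 h3]; rewrite !selfbij_mulE.
- by rewrite trV a1 ?tr ?subrK //; apply: (level_zmod _ n).2.
- by rewrite trV a2 ?tr ?subrK //; apply: (level_zmod _ n).2.
- by rewrite trV a3 ?tr ?subrK //; apply: (level_zmod _ n).2.
- by rewrite a0 ?selfbijVK //; apply: inV.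
Qed.

Lemma slot_near_slot_move s s' l k x z : (l + size s.2 <= k)%N -> slot_near k x z ->
  slot_near l (slot_move s s' x) (slot_move s s' z).
Proof.
move=> lk [n1 n2]; split=> [|i il] /=.
  rewrite opprD addrACA subrr addr0 opprB addrA subrK.
  by apply: level_le n1; apply: leq_trans lk; apply: leq_addr.
rewrite /prefixed /strip; case: ltnP => // wi; apply: n2; apply: leq_trans lk.
by rewrite ltn_add2r (leq_ltn_trans _ il) // leq_subr.
Qed.

Lemma slot_near_starts w k x z : (size w <= k)%N -> slot_near k x z -> starts w x.2 = starts w z.2.
Proof.
move=> wk [_ n2]; rewrite /starts; congr (_ == _); apply: (@eq_from_nth _ false).
  by rewrite !size_mkseq.
by rewrite size_mkseq => i iw; rewrite !nth_mkseq // n2 // (leq_trans iw).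
Qed.

Lemma slot_near_in_slot n s k x z : (n <= k)%N -> (size s.2 <= k)%N -> slot_near k x z ->
  in_slot (level n) s x -> in_slot (level n) s z.
Proof.
move=> nk sk xz [xn sx]; split; last by rewrite -(slot_near_starts sk xz).
have -> : z.1 - s.1 = (x.1 - s.1) - (x.1 - z.1) by rewrite opprB [RHS]addrC subrKA.
by apply: (level_zmod _ n).2 => //; apply: level_le nk xz.1.
Qed.

Lemma cycle3_continuous n s1 s2 s3 : incomparable3 s1 s2 s3 ->
  slot_continuous (cycle3 (level n) s1 s2 s3).
Proof.
move=> i3 x l; pose k := (n + l + size s1.2 + size s2.2 + size s3.2)%N.
exists k => z xz.
have E : cycle3 (level n) s1 s2 s3 =1 cycle3_fun (level n) s1 s2 s3.
  by apply: selfbij_ofE; apply: cycle3_fun_can; rewrite // -incomparable3_rev.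
have same s : (size s.2 <= k)%N -> `[< in_slot (level n) s x >] = `[< in_slot (level n) s z >].
  have nk : (n <= k)%N by rewrite /k; lia.
  by move=> sk; apply/asboolP/asboolP;
    [exact: slot_near_in_slot nk sk xz|exact: slot_near_in_slot nk sk (slot_near_sym xz)].
rewrite !E /cycle3_fun !same; [|by rewrite /k; lia..].
case: ifP => _; first by apply: slot_near_slot_move xz; rewrite /k; lia.
case: ifP => _; first by apply: slot_near_slot_move xz; rewrite /k; lia.
case: ifP => _; first by apply: slot_near_slot_move xz; rewrite /k; lia.
by apply: slot_near_le xz; rewrite /k; lia.
Qed.

Lemma translate_continuous u : slot_continuous (translate u).
Proof.
move=> x l; exists l => z [n1 n2]; rewrite !translateE; split=> //=.
by rewrite opprD addrACA subrr addr0.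
Qed.

Definition agree k (c d : C) := forall i, (i < k)%N -> c i = d i.
Definition cantor_continuous (f : C -> C) :=
  forall c l, exists k, forall d, agree k c d -> agree l (f c) (f d).

Definition on_cone_fun (w : seq bool) (f : C -> C) : X -> X :=
  fun x => if starts w x.2 then (x.1, prefixed w (f (strip w x.2))) else x.

Definition on_cone w (f : selfbij C) : S :=
  selfbij_of (on_cone_fun w f) (on_cone_fun w (f^-1)%g).

Lemma on_coneE w f : on_cone w f =1 on_cone_fun w f.
Proof.
apply: selfbij_ofE => -[u c]; rewrite /on_cone_fun /=; case wc: (starts w c) => /=.
- by rewrite starts_prefixed prefixedK bfunK stripK.
- by rewrite wc.
- by rewrite starts_prefixed prefixedK binvK stripK.
- by rewrite wc.
Qed.

Lemma on_coneM w f f' : on_cone w (f * f')%g = (on_cone w f * on_cone w f')%g.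
Proof.
apply: selfbijP => -[u c]; rewrite selfbij_mulE !on_coneE /on_cone_fun /=.
case wc: (starts w c) => /=; last by rewrite wc.
by rewrite starts_prefixed prefixedK.
Qed.

Lemma on_cone1 w : on_cone w 1%g = 1%g.
Proof.
apply: selfbijP => -[u c]; rewrite on_coneE /on_cone_fun /=.
by case wc: (starts w c) => //; rewrite stripK.
Qed.

Lemma on_coneV w f : on_cone w (f^-1)%g = (on_cone w f)^-1%g.
Proof. by apply: (mulgI (on_cone w f)); rewrite -on_coneM !mulgV on_cone1. Qed.

Lemma on_cone_pt w f u c : on_cone w f (u, prefixed w c) = (u, prefixed w (f c)).
Proof. by rewrite on_coneE /on_cone_fun /= starts_prefixed prefixedK. Qed.

Lemma on_cone_out w f x : ~~ starts w x.2 -> on_cone w f x = x.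
Proof. by rewrite on_coneE /on_cone_fun => /negPf->. Qed.

Lemma on_cone_centralises n w f : centralises_level n (on_cone w f).
Proof.
move=> u _; apply: selfbijP => x; rewrite !selfbij_mulE !translateE !on_coneE /on_cone_fun /=.
by case: ifP.
Qed.

Lemma on_cone_continuous w (f : selfbij C) : cantor_continuous f -> slot_continuous (on_cone w f).
Proof.
move=> cf x l; have [k kf] := cf (strip w x.2) l.
exists (l + k + size w)%N => z xz.
have sw : starts w x.2 = starts w z.2 by apply: slot_near_starts xz; lia.
rewrite !on_coneE /on_cone_fun sw; case: ifP => _; last by apply: slot_near_le xz; lia.
case: xz => n1 n2; split=> [|i il] /=; first by apply: level_le n1; lia.
rewrite /prefixed; case: ltnP => // wi; apply: kf; last by rewrite (leq_ltn_trans _ il) // leq_subr.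
by move=> j jk; rewrite /strip n2 //; lia.
Qed.

End Ambient.

(** * The countable group and its extension by all translations *)

Section TheGroup.
Variables (U : filtered_zmod) (I : countType) (phi : I -> selfbij (nat -> bool)).
Hypothesis phi_continuous : forall i, cantor_continuous (phi i).
Hypothesis phiV_continuous : forall i, cantor_continuous (phi i)^-1%g.
Local Notation C := (nat -> bool).
Local Notation X := (U * C)%type.
Local Notation S := (selfbij X).
Implicit Types (u v : U) (g h : S).

Definition w1 := [:: false; false; false; false].
Definition w2 := [:: false; false; false; true].
Definition w3 := [:: false; false; true; false].

(** The index [None] puts the elementary group itself among the conjugates. Each map acts on one
    cone only, which leaves room for a second copy on another cone. *)
Definition rho (i : option I) : S := if i is Some j then on_cone U w1 (phi j) else 1%g.

Definition gamma_gen : set S := [set g | exists i n e, elementary_gen n e /\ g =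
  (rho i * e * (rho i)^-1)%g].
Definition gamma : set S := generated gamma_gen.
Definition gamma_group : set S := [set g | exists h u, gamma h /\ g = (h * translate u)%g].

Lemma gamma_conj i e : elementary e -> gamma (rho i * e * (rho i)^-1)%g.
Proof.
elim=> [|h [n he]|x y _ IHx _ IHy|x _ IHx].
- by rewrite mulg1 mulgV; apply: generated1.
- by apply: generated_mem; exists i, n, h.
- have -> : (rho i * (x * y) / rho i = rho i * x / rho i * (rho i * y / rho i))%g.
    by rewrite !mulgA mulgVK.
  exact: generatedM.
- have -> : (rho i * x^-1 / rho i = (rho i * x / rho i)^-1)%g by rewrite !invgM invgK mulgA.
  exact: generatedV.
Qed.

Lemma elementary_gamma e : elementary e -> gamma e.
Proof. by move=> /(gamma_conj None); rewrite /= mul1g invg1 mulg1. Qed.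

Lemma gamma_tame g : gamma g -> (exists n, centralises_level n g) /\ slot_continuous g.
Proof.
(* Continuity of the inverse is carried along so that the induction passes through inverses. *)
suff H : gamma g -> (exists n, centralises_level n g) /\ slot_continuous g /\ slot_continuous
  g^-1%g.
  by move=> /H[? []].
have rho_cent i n : centralises_level n (rho i).
  by case: i => [i|] /=; [apply: on_cone_centralises|rewrite -translate0;
    apply: translate_centralises].
have c1 : slot_continuous (1%g : S) by rewrite -translate0; apply: translate_continuous.
have rho_cont i : slot_continuous (rho i) /\ slot_continuous (rho i)^-1%g.
  case: i => [i|] /=; last by rewrite invg1.
  by rewrite -on_coneV; split; apply: on_cone_continuous.
elim=> [|h [i [n [e [[s1 [s2 [s3 [d1 d2 d3 i3 ->]]]] ->]]]]
  |x y _ [[n nx] [cx cx']] _ [[m my] [cy cy']]|x _ [[n nx] [cx cx']]].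
- by rewrite invg1; split=> //; exists 0%N; rewrite -translate0; apply: translate_centralises.
- split.
    exists n; apply: centralises_levelM; last exact: centralises_levelV.
    by apply: centralises_levelM => //; apply: cycle3_centralises.
  have [r1 r2] := rho_cont i; rewrite !invgM invgK mulgA.
  by split; do 2 ?[apply: slot_continuousM => //]; rewrite ?cycle3V //;
    apply: cycle3_continuous; rewrite // -incomparable3_rev.
- split; last by rewrite invgM; split; apply: slot_continuousM.
  exists (maxn n m); apply: centralises_levelM.
    by apply: centralises_level_le nx; apply: leq_maxl.
  by apply: centralises_level_le my; apply: leq_maxr.
- by rewrite invgK; split=> //; exists n; apply: centralises_levelV.
Qed.

Lemma gamma_group_tame g : gamma_group g -> (exists n, centralises_level n g) /\ slot_continuous g.
Proof.
move=> [h [u [/gamma_tame[[n nh] ch] ->]]]; split.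
  by exists n; apply: centralises_levelM nh _; apply: translate_centralises.
by apply: slot_continuousM ch _; apply: translate_continuous.
Qed.

Lemma lattice_gamma u : lattice u -> gamma (translate u).
Proof. by move=> /translate_elementary/elementary_gamma. Qed.

(** Translations by the dense lattice lie in [gamma], so the remaining translation can be made as
    small as desired. This gives closure under products, density of [gamma] and the reduction of
    patterns to [gamma]. *)
Lemma gamma_group_dense g n : gamma_group g ->
  exists h u, [/\ gamma h, level n u & g = (h * translate u)%g].
Proof.
move=> [h [u [gh ->]]]; have [a la ua] := lattice_dense u n.
exists (h * translate a)%g, (u - a); split=> //.
  by apply: generatedM gh _; apply: lattice_gamma.
by rewrite -mulgA -translateD addrC subrK.
Qed.

Lemma gamma_gamma_group g : gamma g -> gamma_group g.
Proof. by move=> gg; exists g, 0; rewrite translate0 mulg1. Qed.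

Lemma translate_gamma_group u : gamma_group (translate u).
Proof. by exists 1%g, u; rewrite mul1g; split=> //; apply: generated1. Qed.

(** The translation part of [g] is first made small enough to commute with the [gamma] part of
    [h]. *)
Lemma gamma_groupM g h : gamma_group g -> gamma_group h -> gamma_group (g * h)%g.
Proof.
move=> Gg [h' [v [h'G ->]]]; have [[n nh] _] := gamma_tame h'G.
have [g' [u [g'G nu ->]]] := gamma_group_dense n Gg.
exists (g' * h')%g, (u + v); split; first exact: generatedM.
by rewrite translateD !mulgA -(mulgA g') -nh // !mulgA.
Qed.

Lemma gamma_groupV g : gamma_group g -> gamma_group g^-1%g.
Proof.
move=> [h [u [hG ->]]]; rewrite invgM -translateN.
by apply: gamma_groupM; [apply: translate_gamma_group|apply: gamma_gamma_group; apply: generatedV].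
Qed.

(** A generator is given by an index, a level and three slots with base points in the countable
    lattice. *)
Lemma gamma_countable : exists (J : countType) (e : J -> S), gamma `<=` range e.
Proof.
have [l lP] := lattice_countable U.
pose gen (i : option I * nat * ((nat * seq bool) * (nat * seq bool) * (nat * seq bool))) : S :=
  let: (i, n, ((a1, v1), (a2, v2), (a3, v3))) := i in
  (rho i * cycle3 (level n) (l a1, v1) (l a2, v2) (l a3, v3) * (rho i)^-1)%g.
have sub : gamma_gen `<=` range gen.
  move=> _ [i [n [_ [[[b1 v1] [[b2 v2] [[b3 v3] [d1 d2 d3 i3 ->]]]] ->]]]].
  have [[a1 _ e1] [a2 _ e2] [a3 _ e3]] : [/\ range l b1, range l b2 & range l b3].
    by split; apply: lP; [case: d1|case: d2|case: d3].
  by exists (i, n, ((a1, v1), (a2, v2), (a3, v3))) => //=; rewrite e1 e2 e3.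
by have [e' e'P] := generated_countable sub; exists _, e'.
Qed.

(** For each [i], the conjugate of [N] by the inverse of [rho i] is normalised by the elementary
    group, so [normalised_contains_elementary] applies to it. *)
Lemma normal_contains_gamma (N : set S) g : is_subgroup N -> N `<=` gamma_group ->
  (forall h k, gamma h -> N k -> N (h * k * h^-1)%g) -> N g -> g <> 1%g -> gamma `<=` N.
Proof.
move=> Nsub NG Nnorm Ng g1.
have [N1 NM NV] := Nsub.
suff H i e : elementary e -> N (rho i * e * (rho i)^-1)%g.
  apply: (generated_sub Nsub) => _ [i [n [e [he ->]]]]; apply: H.
  by apply: generated_mem; exists n.
pose N' : set S := [set k | N (rho i * k * (rho i)^-1)%g].
have N'sub : is_subgroup N'.
  split; rewrite /N' /=; first by rewrite mulg1 mulgV.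
    move=> x y Nx Ny; have := NM _ _ Nx Ny.
    by rewrite !mulgA mulgVK.
  by move=> x Nx; have := NV _ Nx; rewrite !invgM invgK mulgA.
move=> ee; apply: (@normalised_contains_elementary _ N' ((rho i)^-1 * g * rho i)%g) => //.
- move=> f k ef; rewrite /N' /= => Nk; have := Nnorm _ _ (gamma_conj i ef) Nk.
  by rewrite !invgM invgK !mulgA !mulgVK.
- by rewrite /N' /= !mulgA mulgV mul1g mulgK.
- have [_ cg] := gamma_group_tame (NG _ Ng).
  have : slot_continuous (rho i) /\ slot_continuous (rho i)^-1%g.
    case: i {N' N'sub} => [i|] /=.
      by rewrite -on_coneV; split; apply: on_cone_continuous.
    by rewrite invg1 -translate0; split; apply: translate_continuous.
  by move=> [r1 r2]; do 2 ?[apply: slot_continuousM => //].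
- move=> e1; apply: g1; apply: (mulgI (rho i)^-1%g); apply: (mulIg (rho i)).
  by rewrite e1 mulg1 mulVg.
Qed.

End TheGroup.

(** * Commutation patterns *)

Section CommutationPattern.
Variable G : groupType.
Local Open Scope group_scope.

Definition commutation_pattern (g1 g2 g3 : G) (m : nat) : Prop :=
  commute g1 (g3 ^+ m * g2 * (g3 ^+ m)^-1).

(** The powers of [c] cancel in the conjugate, and [a] and [b] then come out as the same factor on
    both sides. *)
Lemma commutation_pattern_central g1 g2 g3 a b c :
  commute g1 a -> commute g1 b -> commute g1 c ->
  commute g2 a -> commute g2 b -> commute g2 c ->
  commute g3 a -> commute g3 b -> commute g3 c ->
  commute a b -> commute a c -> commute b c -> forall m,
  commutation_pattern (g1 * a) (g2 * b) (g3 * c) m <-> commutation_pattern g1 g2 g3 m.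
Proof.
move=> a1 b1 c1 a2 b2 c2 a3 b3 c3 ab ac bc m; rewrite /commutation_pattern.
set y := g3 ^+ m * g2 * (g3 ^+ m)^-1.
have -> : (g3 * c) ^+ m * (g2 * b) * ((g3 * c) ^+ m)^-1 = y * b.
  rewrite expgMn // invgM /y.
  have dgb : commute (c ^+ m) (g2 * b).
    by apply/commute_sym/commuteX/commute_sym/commuteM; apply/commute_sym.
  have bV : commute b (g3 ^+ m)^-1 by apply/commuteV/commuteX/commute_sym.
  by rewrite -(mulgA (g3 ^+ m) (c ^+ m)) dgb !mulgA mulgK -(mulgA _ b) bV mulgA.
have comm_y d : commute g2 d -> commute g3 d -> commute d y.
  move=> d2 d3; apply: commuteM; last by apply/commuteV/commuteX/commute_sym.
  by apply: commuteM; [apply/commuteX|]; apply/commute_sym.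
have ya := comm_y a a2 a3; have yb := comm_y b b2 b3.
have e1 : g1 * a * (y * b) = g1 * y * (a * b).
  by rewrite -mulgA (mulgA a) ya !mulgA.
have e2 : y * b * (g1 * a) = y * g1 * (a * b).
  by rewrite -mulgA (mulgA b) -b1 ab !mulgA.
rewrite /commute e1 e2; split=> [|->//]; exact: mulIg.
Qed.

End CommutationPattern.

(** * Pairs of Cantor maps acting on two disjoint cones *)

Section Twins.
Variables (U : filtered_zmod) (I : countType) (phi : I -> selfbij (nat -> bool)).
Local Notation C := (nat -> bool).
Local Notation S := (selfbij (U * C)%type).
Implicit Types (f : selfbij C).

Definition twin f f' : S := (on_cone U w1 f * on_cone U w2 f')%g.

(** It is the commutator of [rho] with a 3-cycle [e] that carries the cone [w1] to [w2]: both
    [rho e rho^-1] and [e^-1] lie in [gamma], and [e rho^-1 e^-1] is the inverse map on [w2]. *)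
Lemma twin_gamma i : gamma phi (twin (phi i) (phi i)^-1%g).
Proof.
pose s1 : U * seq bool := (0, w1); pose s2 : U * seq bool := (0, w2).
pose s3 : U * seq bool := (0, w3).
have i3 : incomparable3 s1 s2 s3 by [].
have l0 : lattice (0 : U) by apply: (lattice_zmod _).1.
pose e := cycle3 (level 0) s1 s2 s3.
have ee : elementary e by apply: elementary_cycle3.
have : gamma phi (rho U phi (Some i) * e * (rho U phi (Some i))^-1 * e^-1)%g.
  by apply: generatedM (@gamma_conj U _ phi (Some i) _ ee) _; apply: generatedV;
    apply: elementary_gamma.
have [e1 e2 e3 e0] := cycle3P (level 0) i3.
suff E : (e * on_cone U w1 (phi i)^-1%g * e^-1)%g = on_cone U w2 (phi i)^-1%g.
  by rewrite /twin -E on_coneV /= !mulgA.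
have lv (y : U) : level 0 y by apply: level0.
have out w w' c : incomparable w' w -> ~~ starts w (prefixed w' c).
  by move=> ii; apply: starts_incomparable ii (starts_prefixed _ _).
apply: selfbijP => x; rewrite !selfbij_mulE.
have [/in_slotP[y [c [_ ->]]]|/in_slotP[y [c [_ ->]]]|/in_slotP[y [c [_ ->]]]|[h1 h2 h3]] :=
  slot_case (level 0) s1 s2 s3 x.
- rewrite (selfbij_inv_eq (e3 y c (lv y))) /pt /= on_cone_out ?out //.
  by rewrite on_cone_out ?out // -[LHS]/(e (pt s3 y c)) e3.
- rewrite (selfbij_inv_eq (e1 y c (lv y))) /pt /= !on_cone_pt.
  by rewrite -[LHS]/(e (pt s1 y _)) e1.
- rewrite (selfbij_inv_eq (e2 y c (lv y))) /pt /= on_cone_out ?out //.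
  by rewrite on_cone_out ?out // -[LHS]/(e (pt s2 y c)) e2.
have fx : e x = x by apply: e0.
have n1 : ~~ starts w1 x.2 by apply/negP => sx; apply: h1; split=> //; apply: lv.
have n2 : ~~ starts w2 x.2 by apply/negP => sx; apply: h2; split=> //; apply: lv.
by rewrite (selfbij_inv_eq fx) on_cone_out // fx on_cone_out.
Qed.

Lemma twinM f f' g g' : (twin f f' * twin g g')%g = twin (f * g)%g (f' * g')%g.
Proof.
have comm a b : (on_cone U w1 a * on_cone U w2 b = on_cone U w2 b * on_cone U w1 a)%g.
  apply: (@supported_commute U [set x | starts w1 x.2]).
    by move=> x /negP nx; apply: on_cone_out.
  by move=> x sx; apply: on_cone_out; apply: starts_incomparable sx.
by rewrite /twin !on_coneM !mulgA -(mulgA _ _ (on_cone U w1 g)) -comm !mulgA.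
Qed.

Lemma twin1 : twin 1%g 1%g = 1%g.
Proof. by rewrite /twin !on_cone1 mulg1. Qed.

Lemma twinV f f' : ((twin f f')^-1 = twin (f^-1)%g (f'^-1)%g)%g.
Proof. by apply: (mulgI (twin f f')); rewrite twinM !mulgV twin1. Qed.

Lemma twinX f f' m : (twin f f' ^+ m = twin (f ^+ m)%g (f' ^+ m)%g)%g.
Proof. by elim: m => [|m IHm]; rewrite ?twin1 // !expgS IHm twinM. Qed.

Lemma twin_inj f f' g g' : twin f f' = twin g g' -> f = g /\ f' = g'.
Proof.
move=> e.
have e1 c : (twin f f') (0, prefixed w1 c) = (twin g g') (0, prefixed w1 c) by rewrite e.
have e2 c : (twin f f') (0, prefixed w2 c) = (twin g g') (0, prefixed w2 c) by rewrite e.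
have o1 c : ~~ starts w2 (prefixed w1 c) by apply: starts_incomparable (starts_prefixed _ _).
have o2 c : ~~ starts w1 (prefixed w2 c) by apply: starts_incomparable (starts_prefixed _ _).
split; apply: selfbijP => c.
  have := e1 c; rewrite !selfbij_mulE !(@on_cone_out U w2) ?o1 // !on_cone_pt.
  by case=> /(congr1 (strip w1)); rewrite !prefixedK.
have := e2 c; rewrite !selfbij_mulE !on_cone_pt !(@on_cone_out U w1) ?o2 //.
by case=> /(congr1 (strip w2)); rewrite !prefixedK.
Qed.

Lemma commutation_pattern_twin f1 f1' f2 f2' f3 f3' m :
  commutation_pattern (twin f1 f1') (twin f2 f2') (twin f3 f3') m <->
  commutation_pattern f1 f2 f3 m /\ commutation_pattern f1' f2' f3' m.
Proof.
rewrite /commutation_pattern twinX twinV !twinM /commute !twinM.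
by split=> [/twin_inj//|[-> ->]].
Qed.

End Twins.

Section GammaGroupPatterns.
Variables (U : filtered_zmod) (I : countType) (phi : I -> selfbij (nat -> bool)).
Hypothesis phi_continuous : forall i, cantor_continuous (phi i).
Hypothesis phiV_continuous : forall i, cantor_continuous (phi i)^-1%g.
Local Notation C := (nat -> bool).
Local Notation S := (selfbij (U * C)%type).

(** Each element is written as one of [gamma] times a translation so small that it commutes with all
    three; [commutation_pattern_central] then removes the translations. *)
Lemma gamma_group_pattern (g1 g2 g3 : S) :
  gamma_group phi g1 -> gamma_group phi g2 -> gamma_group phi g3 ->
  exists h1 h2 h3 : S, [/\ gamma phi h1, gamma phi h2, gamma phi h3 &
    forall m, commutation_pattern g1 g2 g3 m <-> commutation_pattern h1 h2 h3 m].
Proof.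
move=> G1 G2 G3.
have [[n1 c1] _] := gamma_group_tame phi_continuous phiV_continuous G1.
have [[n2 c2] _] := gamma_group_tame phi_continuous phiV_continuous G2.
have [[n3 c3] _] := gamma_group_tame phi_continuous phiV_continuous G3.
pose n := maxn n1 (maxn n2 n3).
have {}c1 : centralises_level n g1 by apply: centralises_level_le c1; rewrite leq_max leqnn.
have {}c2 : centralises_level n g2 by apply: centralises_level_le c2; rewrite !leq_max leqnn orbT.
have {}c3 : centralises_level n g3 by apply: centralises_level_le c3; rewrite !leq_max leqnn !orbT.
have [h1 [u1 [gh1 l1 e1]]] := gamma_group_dense n G1.
have [h2 [u2 [gh2 l2 e2]]] := gamma_group_dense n G2.
have [h3 [u3 [gh3 l3 e3]]] := gamma_group_dense n G3.
exists h1, h2, h3; split=> // m.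
have cent (g h : S) (u v : U) : centralises_level n g -> level n v -> g = (h * translate u)%g ->
    commute h (translate v).
  move=> cg lv e; have -> : h = (g * translate (- u))%g by rewrite e translateN mulgK.
  have := centralises_levelM cg (@translate_centralises U n (- u)); exact.
rewrite e1 e2 e3; apply: commutation_pattern_central; try exact: translate_comm.
- exact: cent c1 l1 e1.
- exact: cent c1 l2 e1.
- exact: cent c1 l3 e1.
- exact: cent c2 l1 e2.
- exact: cent c2 l2 e2.
- exact: cent c2 l3 e2.
- exact: cent c3 l1 e3.
- exact: cent c3 l2 e3.
- exact: cent c3 l3 e3.
Qed.

End GammaGroupPatterns.

(** * Maps of the Cantor space that encode a binary sequence *)

Section CantorMaps.
Local Notation C := (nat -> bool).
Local Notation S := (selfbij C).

(* A permutation of nat with a single orbit ... 5, 3, 1, 0, 2, 4, ... *)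
Definition zig (i : nat) : nat := if odd i then (if i == 1%N then 0 else i.-2) else i.+2.
Definition zag (i : nat) : nat := if odd i then i.+2 else (if i == 0%N then 1 else i.-2).

Lemma zigK : cancel zig zag.
Proof. by rewrite /zig /zag => -[|[|i]] //=; case oi: (odd i); rewrite /= ?negbK ?oi. Qed.

Lemma zagK : cancel zag zig.
Proof. by rewrite /zig /zag => -[|[|i]] //=; case oi: (odd i); rewrite /= ?negbK ?oi. Qed.

Definition flip_fun (f : nat -> bool) (c : C) : C := fun i => c i (+) f i.
Lemma flip_funK f : cancel (flip_fun f) (flip_fun f).
Proof. by move=> c; apply/funext => i; rewrite /flip_fun -addbA addbb addbF. Qed.
Definition flip f : S := Selfbij (flip_funK f) (flip_funK f).

(** Adding bit 0 to bit 1 detects whether a flip touches bit 0 ([control_flip]). *)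
Definition control_fun (c : C) : C := fun i => if i == 1%N then c 1 (+) c 0 else c i.
Lemma control_funK : cancel control_fun control_fun.
Proof.
move=> c; apply/funext => i; rewrite /control_fun /=.
by case: eqP => // ->; rewrite -addbA addbb addbF.
Qed.
Definition control : S := Selfbij control_funK control_funK.

Definition shift_fun (c : C) : C := c \o zig.
Definition unshift_fun (c : C) : C := c \o zag.
Lemma shift_funK : cancel shift_fun unshift_fun.
Proof. by move=> c; apply/funext => i /=; rewrite /unshift_fun /shift_fun /= zagK. Qed.
Lemma unshift_funK : cancel unshift_fun shift_fun.
Proof. by move=> c; apply/funext => i /=; rewrite /unshift_fun /shift_fun /= zigK. Qed.
Definition shift : S := Selfbij shift_funK unshift_funK.

Lemma shift_flip f : (shift * flip f * shift^-1)%g = flip (f \o zig).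
Proof.
apply: selfbijP => c; apply/funext => i; rewrite !selfbij_mulE /=.
by rewrite /shift_fun /flip_fun /unshift_fun /= zigK.
Qed.

Lemma unshift_flip f : (shift^-1 * flip f * shift)%g = flip (f \o zag).
Proof.
apply: selfbijP => c; apply/funext => i; rewrite !selfbij_mulE /=.
by rewrite /shift_fun /flip_fun /unshift_fun /= zagK.
Qed.

Lemma control_flip f : commute control (flip f) <-> f 0 = false.
Proof.
split=> [/(congr1 (fun g : S => g (fun=> false) 1%N))|f0].
  by rewrite !selfbij_mulE /= /control_fun /flip_fun /=; case: (f 0) => //; case: (f 1%N).
apply: selfbijP => c; apply/funext => i; rewrite !selfbij_mulE /= /control_fun /flip_fun /=.
by case: eqP => // ->; rewrite f0 addbF addbAC.
Qed.

(** The orbit of 0 runs through the even positions under [zig], where [t] is stored, and through odd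
    positions from its first step on under [zag]. The odd ones are left false because the second
    cone of a twin carries the inverse maps. *)
Definition spread (t : nat -> bool) (i : nat) := ~~ odd i && t i./2.

Definition encoding (t : nat -> bool) (i : option bool) : S :=
  match i with None => shift | Some true => flip (spread t) | Some false => control end.

Lemma encodingV t i : ((encoding t i)^-1)%g = if i is Some _ then encoding t i else shift^-1%g.
Proof. by case: i => [[]|] //; apply: selfbijP. Qed.

Lemma zig_iter0 m : iter m zig 0 = m.*2.
Proof. by elim: m => // m IHm; rewrite iterS IHm /zig odd_double doubleS. Qed.

Lemma zag_iter0 m : iter m.+1 zag 0 = m.*2.+1.
Proof. by elim: m => // m IHm; rewrite iterS IHm /zag /= odd_double doubleS. Qed.

Lemma conj_shift_flip f m : (shift ^+ m * flip f * (shift ^+ m)^-1)%g = flip (f \o iter m zig).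
Proof.
elim: m => [|m IHm]; first by rewrite mul1g invg1 mulg1.
rewrite expgS invgM !mulgA -(mulgA shift) -(mulgA shift) IHm shift_flip.
by congr flip; apply/funext => i /=; rewrite -iterSr.
Qed.

Lemma conj_unshift_flip f m :
  ((shift^-1) ^+ m * flip f * ((shift^-1) ^+ m)^-1)%g = flip (f \o iter m zag).
Proof.
elim: m => [|m IHm]; first by rewrite mul1g invg1 mulg1.
rewrite expgS invgM invgK !mulgA -(mulgA shift^-1%g) -(mulgA shift^-1%g) IHm unshift_flip.
by congr flip; apply/funext => i /=; rewrite -iterSr.
Qed.

Lemma encoding_pattern t m : commutation_pattern (encoding t (Some false))
  (encoding t (Some true)) (encoding t None) m <-> t m = false.
Proof.
rewrite /commutation_pattern conj_shift_flip control_flip /= zig_iter0 /spread.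
by rewrite odd_double doubleK.
Qed.

Lemma encoding_pattern_opposite t m : t m = false ->
  commutation_pattern ((encoding t (Some false))^-1)%g
    ((encoding t (Some true))^-1)%g ((encoding t None)^-1)%g m.
Proof.
move=> tm; rewrite !encodingV /commutation_pattern conj_unshift_flip control_flip /=.
(* At [m = 0] the bit read is [t 0]; afterwards the backward orbit is at odd positions. *)
by case: m tm => [|m] tm; rewrite ?zag_iter0 /spread //= odd_double.
Qed.

Lemma encoding_continuous t i : cantor_continuous (encoding t i).
Proof.
case: i => [[]|] c l /=.
- by exists l => d cd i il; rewrite /= /flip_fun cd.
- by exists (l + 2)%N => d cd i il; rewrite /= /control_fun !cd //; lia.
- by exists (l + 2)%N => d cd i il; rewrite /= /shift_fun /= cd // /zig; case: ifP => _;
  [case: ifP => _; lia|lia].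
Qed.

Lemma encodingV_continuous t i : cantor_continuous ((encoding t i)^-1)%g.
Proof.
rewrite encodingV; case: i => [b|]; first exact: encoding_continuous.
move=> c l; exists (l + 2)%N => d cd i il.
by rewrite /= /unshift_fun /= cd // /zag; case: ifP => _; [lia|case: ifP => _; lia].
Qed.

End CantorMaps.

Section EncodedPatterns.
Variables (U : filtered_zmod) (t : nat -> bool).

(** On the first cone the twins commute exactly when [t m] is false, and on the second cone they
    commute at least then, so the conjunction is the intended pattern. *)
Lemma gamma_encodes : exists g1 g2 g3 : selfbij (U * (nat -> bool)),
  [/\ gamma (encoding t) g1, gamma (encoding t) g2, gamma (encoding t) g3 &
      forall m, commutation_pattern g1 g2 g3 m <-> t m = false].
Proof.
pose e i := twin U (encoding t i) ((encoding t i)^-1)%g.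
exists (e (Some false)), (e (Some true)), (e None).
split; try exact: twin_gamma.
move=> m; rewrite commutation_pattern_twin encoding_pattern; split=> [[]//|tm].
by split=> //; apply: encoding_pattern_opposite.
Qed.

End EncodedPatterns.

(** * Integral vectors *)

Section IntegralVectors.
Variables (p : nat) (p_pr : prime p) (d : nat).
Local Notation K := (Qp p_pr).
Local Notation abs := (@Qp_abs p p_pr).

Definition integral_pred : {pred 'rV[K]_d} := fun v => [forall i, abs (v 0 i) <= 1].

Fact integral_zmod_closed : zmod_closed integral_pred.
Proof.
split=> [|u v /forallP uP /forallP vP].
  by apply/forallP => i; rewrite mxE Qp_abs0.
by apply/forallP => i; rewrite !mxE Qp_absB_le ?uP ?vP.
Qed.

HB.instance Definition _ := GRing.isZmodClosed.Build 'rV[K]_d integral_pred integral_zmod_closed.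

Record integral_vec := IntegralVec { vec : 'rV[K]_d; _ : vec \in integral_pred }.

HB.instance Definition _ := [isSub for vec].
HB.instance Definition _ := [Choice of integral_vec by <:].
HB.instance Definition _ := [SubChoice_isSubZmodule of integral_vec by <:].

Definition vec_level (n : nat) : set integral_vec :=
  [set u | forall i, abs (vec u 0 i) <= p%:R^-1 ^+ n].

Lemma vec_le1 (u : integral_vec) i : abs (vec u 0 i) <= 1.
Proof. by have /forallP := valP u. Qed.

Fact int_vec_exists (a : 'rV[int]_d) : {u : integral_vec | vec u = \row_i (a 0 i)%:~R}.
Proof.
have aP : (\row_i (a 0 i)%:~R : 'rV[K]_d) \in integral_pred.
  by apply/forallP => i; rewrite mxE Qp_abs_int_le1.
by exists (IntegralVec aP).
Qed.

Definition int_vec a := sval (int_vec_exists a).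

Lemma int_vecE a : vec (int_vec a) = \row_i (a 0 i)%:~R.
Proof. exact: (svalP (int_vec_exists a)). Qed.

Definition vec_lattice : set integral_vec := range int_vec.

Lemma vecB (u v : integral_vec) : vec (u - v) = vec u - vec v.
Proof. exact: (raddfB val). Qed.

Lemma vecD (u v : integral_vec) : vec (u + v) = vec u + vec v.
Proof. exact: (raddfD val). Qed.

Lemma vecN (u : integral_vec) : vec (- u) = - vec u.
Proof. exact: (raddfN val). Qed.

Lemma vec0 : vec (0 : integral_vec) = 0.
Proof. exact: (raddf0 val). Qed.

Lemma vecBE (u v : integral_vec) i : vec (u - v) 0 i = vec u 0 i - vec v 0 i.
Proof. by rewrite vecB !mxE. Qed.

Lemma vec_inj : injective vec.
Proof. exact: val_inj. Qed.

Fact vec_level0 u : vec_level 0 u. Proof. by move=> i; rewrite vec_le1. Qed.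

Fact vec_level_zmod n : vec_level n 0 /\
  forall u v, vec_level n u -> vec_level n v -> vec_level n (u - v).
Proof.
split=> [i|u v nu nv i]; first by rewrite vec0 mxE Qp_abs0 exprn_ge0 // ltW // pinv_gt0.
by rewrite vecB !mxE Qp_absB_le.
Qed.

Fact vec_level_decr n u : vec_level n.+1 u -> vec_level n u.
Proof. by move=> nu i; apply: le_trans (nu i) _; rewrite pinv_le. Qed.

Fact vec_level_sep u : (forall n, vec_level n u) -> u = 0.
Proof.
move=> nu; apply: vec_inj; rewrite vec0; apply/rowP => i; rewrite mxE.
apply: Qp_abs_eq0; apply/eqP; rewrite eq_le Qp_abs_ge0 andbT leNgt; apply/negP => u0.
have [n /(le_lt_trans (nu n i))] := pinv_small p_pr u0.
by rewrite ltxx.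
Qed.

Definition digit_vec n (f : {ffun 'I_d -> 'I_p}) : integral_vec :=
  int_vec (\row_i ((p ^ n)%:Z * (f i : nat)%:Z)).

Lemma digit_vecE n f i : vec (digit_vec n f) 0 i = p%:R ^+ n * (f i : nat)%:R.
Proof. by rewrite int_vecE !mxE rmorphM /= -natrX. Qed.

Lemma abs_lt_p_inj (j j' : 'I_p) : abs ((j : nat)%:R - (j' : nat)%:R) <= p%:R^-1 -> j = j'.
Proof.
have -> : (j : nat)%:R - (j' : nat)%:R = (j%:Z - j'%:Z)%:~R :> K by rewrite rmorphB.
have [/eqP|jj] := eqVneq (j%:Z - j'%:Z) 0.
  by rewrite subr_eq0 eqz_nat => /eqP/val_inj.
rewrite Qp_abs_int_coprime; first by rewrite leNgt pinv_lt1.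
rewrite prime_coprime // gtnNdvd ?absz_gt0 //.
by have := ltn_ord j; have := ltn_ord j'; lia.
Qed.

(** The digit is the residue modulo [p] of an integer close to the integral number [x / p^n]. *)
Lemma digit_exists n (x : K) : abs x <= p%:R^-1 ^+ n ->
  exists j : 'I_p, abs (x - p%:R ^+ n * (j : nat)%:R) <= p%:R^-1 ^+ n.+1.
Proof.
move=> xn; have pn0 : p%:R ^+ n != 0 :> K.
  by rewrite -Qp_abs_eq0E Qp_absX Qp_abs_p gt_eqF // exprn_gt0 // pinv_gt0.
have pa0 : 0 < (p%:R^-1 : rat) ^+ n by rewrite exprn_gt0 // pinv_gt0.
have [|a xa] := @Qp_abs_le1_int p p_pr (x / p%:R ^+ n) 1.
  by rewrite Qp_absM Qp_absV Qp_absX Qp_abs_p ler_pdivrMr // mul1r.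
have p0 : (0 < p)%N by apply: prime_gt0.
have jp : (`|(a %% p)%Z|%N < p)%N.
  by rewrite -ltz_nat gez0_abs ?ltz_pmod ?modz_ge0 // eqz_nat -lt0n.
exists (Ordinal jp) => /=.
rewrite -[x in x - _](divfK pn0) mulrC -mulrBr Qp_absM Qp_absX Qp_abs_p exprSr ler_pM2l //.
rewrite -(subrKA a%:~R); apply: Qp_absD_le; first by rewrite expr1 in xa.
have -> : a%:~R - `|(a %% p)%Z|%:R = (a %/ p)%Z%:~R * p%:R :> K.
  have -> : `|(a %% p)%Z|%:R = (a %% p)%Z%:~R :> K.
    by rewrite -[in RHS](@gez0_abs (a %% p)%Z) ?modz_ge0 // eqz_nat -lt0n.
  by rewrite {1}(divz_eq a p) rmorphD rmorphM /= addrK.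
rewrite Qp_absM Qp_abs_p ler_piMl ?Qp_abs_int_le1 //.
by rewrite ltW // pinv_gt0.
Qed.

Fact vec_level_cosets n : exists bs : seq integral_vec,
    [/\ uniq bs, forall b, b \in bs -> vec_level n b /\ vec_lattice b,
        forall b b', b \in bs -> b' \in bs -> vec_level n.+1 (b - b') -> b = b' &
        forall u, vec_level n u -> exists2 b, b \in bs & vec_level n.+1 (u - b)].
Proof.
have pa0 : 0 < (p%:R^-1 : rat) ^+ n by rewrite exprn_gt0 // pinv_gt0.
have inj f g : vec_level n.+1 (digit_vec n f - digit_vec n g) -> f = g.
  move=> fg; apply/ffunP => i; apply: abs_lt_p_inj; have := fg i.
  rewrite vecBE !digit_vecE -mulrBr Qp_absM Qp_absX Qp_abs_p exprSr ler_pM2l //.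
exists [seq digit_vec n f | f <- enum {: {ffun 'I_d -> 'I_p}}]; split.
- rewrite map_inj_uniq; first exact: enum_uniq.
  move=> f g e; apply: inj.
  by rewrite e subrr; apply: (vec_level_zmod n.+1).1.
- move=> _ /mapP[f _ ->]; split; last by exists (\row_i ((p ^ n)%:Z * (f i : nat)%:Z)).
  move=> i; rewrite digit_vecE Qp_absM Qp_absX Qp_abs_p ler_piMr ?(ltW pa0) //.
  exact: Qp_abs_nat_le1.
- by move=> _ _ /mapP[f _ ->] /mapP[g _ ->] /inj->.
- move=> u nu; have /choice[f fP] := fun i => digit_exists (nu i).
  exists (digit_vec n [ffun i => f i]); first by rewrite map_f // mem_enum.
  by move=> i; rewrite vecBE digit_vecE ffunE.
Qed.

Fact vec_lattice_zmod : vec_lattice 0 /\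
  forall u v, vec_lattice u -> vec_lattice v -> vec_lattice (u - v).
Proof.
split; first by exists 0 => //; apply: vec_inj; rewrite int_vecE vec0; apply/rowP => i;
  rewrite !mxE.
move=> _ _ [a _ <-] [b _ <-]; exists (a - b) => //; apply: vec_inj.
by apply/rowP => i; rewrite vecBE !int_vecE !mxE rmorphB.
Qed.

Fact vec_lattice_dense u n : exists2 a, vec_lattice a & vec_level n (u - a).
Proof.
have /choice[a aP] := fun i => Qp_abs_le1_int n (vec_le1 u i).
exists (int_vec (\row_i a i)); first by exists (\row_i a i).
by move=> i; rewrite vecBE int_vecE !mxE.
Qed.

Fact vec_lattice_countable : exists e : nat -> integral_vec, vec_lattice `<=` range e.
Proof.
exists (fun n => if unpickle n is Some a then int_vec a else 0).
by move=> _ [a _ <-]; exists (pickle a) => //; rewrite pickleK.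
Qed.

Definition integral_filtered : filtered_zmod :=
  FilteredZmod vec_level0 vec_level_zmod vec_level_decr vec_level_sep vec_level_cosets
    vec_lattice_zmod vec_lattice_dense vec_lattice_countable.

End IntegralVectors.

(** * The topological group *)

Section AffineAnalytic.
Variables (p : nat) (p_pr : prime p) (n : nat).
Local Notation K := (Qp p_pr).
Local Notation abs := (@Qp_abs p p_pr).
Local Notation M := {ffun 'I_n -> nat}.
Implicit Types (x h : 'rV[K]_n).

Lemma expansion_monomial r x (b : M) : 0 < r ->
  expansion r (fun y => monomial b (y - x)) x (fun a => (a == b)%:R).
Proof.
move=> r0; split=> // [e e0|h hr].
  exists [:: b] => a; rewrite inE => /negPf->.
  by rewrite Qp_abs0 mul0r.
rewrite addrC addKr.
have := @has_sum_fin _ p_pr _ (fun a => (a == b)%:R * monomial a h) [:: b] isT.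
rewrite big_seq1 eqxx mul1r; apply=> a; rewrite inE => /negPf->.
by rewrite mul0r.
Qed.

(** The coefficients have the shape that [expansion_linear] yields for [(k - 1) * 1 + 1]. *)
Lemma expansion_const r x (k : K) : 0 < r ->
  expansion r (fun=> k) x (fun a : M => (k - 1) * (a == 0)%:R + (a == 0)%:R).
Proof.
move=> r0; have h1 := expansion_monomial x 0 r0.
apply: expansion_local (expansion_linear (k - 1) h1 h1) => h _.
by rewrite monomial0 mulr1 subrK.
Qed.

(** Covers the three cases of the Lie structure: [l] is one coordinate for chart changes and
    inversion ([e] is 1 or -1), and one from each factor for multiplication. *)
Lemma affine_analytic_at (f : 'rV[K]_n -> K) x r e (l : seq 'I_n) : 0 < r ->
  (forall h, in_polydisc r h -> f (x + h) = f x + e * \sum_(i <- l) h 0 i) ->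
  analytic_at f x.
Proof.
move=> r0 fx; apply/analytic_atP.
have [s ls] : exists s, expansion r (fun y => \sum_(i <- l) (y - x) 0 i) x s.
  elim: l {fx} => [|i l [s IHs]].
    eexists; apply: expansion_local (expansion_const x 0 r0) => h _.
    by rewrite big_nil.
  exists (fun a => 1 * (a == unit_exponent i)%:R + s a).
  apply: expansion_local (expansion_linear 1 (expansion_monomial x (unit_exponent i) r0) IHs)
    => h _.
  by rewrite monomial_unit mul1r big_cons.
eexists; exists r.
apply: expansion_local (expansion_linear e ls (expansion_const x (f x) r0)) => h hr.
by rewrite fx // addrC (addrC x) addrK.
Qed.

End AffineAnalytic.

Section SolenoidGroup.
Variables (p : nat) (p_pr : prime p) (d : nat) (t : nat -> bool).
Local Notation K := (Qp p_pr).
Local Notation abs := (@Qp_abs p p_pr).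
Local Notation C := (nat -> bool).
Local Notation V := (integral_filtered p_pr d).
Local Notation S := (selfbij (V * C)%type).

Let level_maxl n m (u : V) : level (maxn n m) u -> level n u.
Proof. exact: level_le (leq_maxl n m). Qed.

Let level_maxr n m (u : V) : level (maxn n m) u -> level m u.
Proof. exact: level_le (leq_maxr n m). Qed.

Record solenoid_group := SolenoidGroup {
  sg_bij : S;
  sg_bijP : gamma_group (encoding t) sg_bij }.
Local Notation G := solenoid_group.

Lemma sg_bij_inj : injective sg_bij.
Proof.
by move=> [g gP] [h hP] /= e; rewrite -{}e in hP *; congr SolenoidGroup; apply: Prop_irrelevance.
Qed.

HB.instance Definition _ := gen_eqMixin G.
HB.instance Definition _ := gen_choiceMixin G.

Let tame g := @gamma_group_tame V _ (encoding t) (encoding_continuous t) (encodingV_continuous t) g.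

Definition sg_mul (g h : G) : G := SolenoidGroup
  (gamma_groupM (encoding_continuous t) (encodingV_continuous t) (sg_bijP g) (sg_bijP h)).
Definition sg_inv (g : G) : G := SolenoidGroup
  (gamma_groupV (encoding_continuous t) (encodingV_continuous t) (sg_bijP g)).
Definition sg_one : G := SolenoidGroup (gamma_gamma_group (generated1 _)).

Fact sg_mulA : associative sg_mul. Proof. by move=> f g h; apply: sg_bij_inj; apply: mulgA. Qed.
Fact sg_mul1 : left_id sg_one sg_mul. Proof. by move=> f; apply: sg_bij_inj; apply: mul1g. Qed.
Fact sg_mulr1 : right_id sg_one sg_mul. Proof. by move=> f; apply: sg_bij_inj; apply: mulg1. Qed.
Fact sg_mulV : left_inverse sg_one sg_inv sg_mul.
Proof. by move=> f; apply: sg_bij_inj; apply: mulVg. Qed.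
Fact sg_mulrV : right_inverse sg_one sg_inv sg_mul.
Proof. by move=> f; apply: sg_bij_inj; apply: mulgV. Qed.

HB.instance Definition _ := isGroup.Build G sg_mulA sg_mul1 sg_mulr1 sg_mulV sg_mulrV.

Definition sg_translate (u : V) : G := SolenoidGroup (translate_gamma_group (encoding t) u).

Lemma sg_translateD u v : sg_translate (u + v) = (sg_translate u * sg_translate v)%g.
Proof. by apply: sg_bij_inj; apply: translateD. Qed.

Lemma sg_translate0 : sg_translate 0 = 1%g.
Proof. by apply: sg_bij_inj; apply: translate0. Qed.

Lemma sg_translateN u : sg_translate (- u) = (sg_translate u)^-1%g.
Proof. by apply: sg_bij_inj; apply: translateN. Qed.

Lemma sg_translate_inj : injective sg_translate.
Proof. by move=> u v /(congr1 sg_bij)/translate_inj. Qed.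

Lemma sg_centralises (g : G) : exists n, forall u : V, level n u ->
  (g * sg_translate u = sg_translate u * g)%g.
Proof.
have [[n cn] _] := tame (sg_bijP g).
by exists n => u nu; apply: sg_bij_inj; apply: cn.
Qed.

(** The topology for which the translations form an open subgroup carrying the topology of [Zp^d];
    left cosets of the levels are a base. *)
Definition sg_nbhs (g : G) : set_system G :=
  [set A | exists n, forall u : V, level n u -> A (g * sg_translate u)%g].

HB.instance Definition _ := hasNbhs.Build G sg_nbhs.

Fact sg_nbhs_filter (g : G) : ProperFilter (nbhs g).
Proof.
split.
  by move=> [n /(_ 0 ltac:(by apply: (level_zmod _ n).1))].
split.
- by exists 0%N.
- move=> A B [n nA] [m mB]; exists (maxn n m) => u nu; split.
    by apply: nA; exact: level_maxl nu.
  by apply: mB; exact: level_maxr nu.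
- by move=> A B AB [n nA]; exists n => u /nA/AB.
Qed.

Fact sg_nbhs_singleton (g : G) (A : set G) : nbhs g A -> A g.
Proof.
by move=> [n /(_ 0)]; rewrite sg_translate0 mulg1; apply; apply: (level_zmod _ n).1.
Qed.

Fact sg_nbhs_nbhs (g : G) (A : set G) : nbhs g A -> nbhs g (nbhs^~ A).
Proof.
move=> [n nA]; exists n => u nu; exists n => v nv.
by rewrite -mulgA -sg_translateD; apply: nA; apply: levelD.
Qed.

HB.instance Definition _ := Nbhs_isNbhsTopological.Build G
  sg_nbhs_filter sg_nbhs_singleton sg_nbhs_nbhs.

(** A small translation [u] commutes with [h], whence [(g u) (h v) = g h (u v)]. *)
Fact sg_mul_continuous : continuous (fun z : G * G => (z.1 * z.2)%g).
Proof.
move=> [g h] A [n nA]; have [m mh] := sg_centralises h.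
exists ([set x | exists2 u : V, level (maxn n m) u & x = (g * sg_translate u)%g],
        [set x | exists2 u : V, level n u & x = (h * sg_translate u)%g]).
  by split; [exists (maxn n m) => u nu; exists u|exists n => u nu; exists u].
move=> [_ _] [/= [u nu ->] [v nv ->]] /=.
rewrite mulgA -(mulgA g) -mh; last exact: level_maxr nu.
rewrite mulgA -mulgA -sg_translateD; apply: nA; apply: levelD => //.
by exact: level_maxl nu.
Qed.

Fact sg_inv_continuous : continuous (fun x : G => (x^-1)%g).
Proof.
move=> g A [n nA]; have [m mg] := sg_centralises g^-1%g.
exists (maxn n m) => u nu; rewrite /= invgM -sg_translateN -mg.
  by apply: nA; apply: levelN; exact: level_maxl nu.
by apply: levelN; exact: level_maxr nu.
Qed.

HB.instance Definition _ := isTopologicalGroup.Build G sg_mul_continuous sg_inv_continuous.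

(** Two points that cannot be separated differ by a translation lying in every level, which is
    therefore trivial. *)
Lemma sg_hausdorff : hausdorff_space G.
Proof.
move=> g h gh; apply: contrapT => ne.
have key n : exists2 u : V, level n u & h = (g * sg_translate u)%g.
  have [] := gh [set x | exists2 u : V, level n u & x = (g * sg_translate u)%g]
     [set x | exists2 u : V, level n u & x = (h * sg_translate u)%g].
  - by exists n => u nu; exists u.
  - by exists n => u nu; exists u.
  move=> _ [[u nu ->] [v nv e]]; exists (u - v); first exact: (level_zmod _ n).2.
  by rewrite sg_translateD sg_translateN mulgA e mulgK.
have [u _ hu] := key 0%N; apply: ne.
suff u0 : u = 0 by rewrite hu u0 sg_translate0 mulg1.
apply: level_sep => n; have [v nv hv] := key n.
by rewrite (_ : u = v) //; apply: sg_translate_inj; apply: (mulgI g); rewrite -hu hv.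
Qed.

(** The cosets of the levels by elements of the countable dense [gamma] form a base. *)
Lemma sg_second_countable : second_countable (T := G).
Proof.
have [J [e eP]] := gamma_countable V (encoding t).
pose B (i : J * nat) : set G := [set x | exists2 u : V, level i.2 u & sg_bij x =
  (e i.1 * translate u)%g].
exists (range B).
  by apply: sub_countable (card_image_le _ _) (countableP _).
split.
  move=> _ [[j n] _ <-]; rewrite openE => x [u nu xe]; exists n => v nv.
  by exists (u + v); [exact: levelD|rewrite translateD mulgA -xe].
move=> g A [n nA]; have [h [u [gh nu ge]]] := gamma_group_dense n (sg_bijP g).
have [j _ ej] := eP _ gh.
exists (B (j, n)); last first.
  move=> x [v nv xe]; have -> : x = (g * sg_translate (v - u))%g.
    apply: sg_bij_inj; rewrite xe /= ej -[RHS]/(sg_bij g * translate (v - u))%g ge.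
    by rewrite -mulgA -translateD addrC subrK.
  by apply: nA; apply: (level_zmod _ n).2.
by split; [exists (j, n)|exists u => //=; rewrite ej].
Qed.

(** A 3-cycle shows that the group is nontrivial. A nontrivial normal subgroup contains [gamma],
    which is dense, so it is everything once it is closed. *)
Lemma sg_topologically_simple : topologically_simple G.
Proof.
have l0 : lattice (0 : V) by apply: (lattice_zmod _).1.
have [s1 [s2 [s3 [d1 d2 d3 i3]]]] : exists s1 s2 s3 : V * seq bool,
    [/\ deep s1, deep s2, deep s3 & incomparable3 s1 s2 s3].
  by exists (0, w1), (0, w2), (0, w3); split.
split.
  have ge := elementary_gamma (encoding t) (elementary_cycle3 0 d1 d2 d3 i3).
  exists (SolenoidGroup (gamma_gamma_group ge)) => /(congr1 sg_bij) /= c1.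
  have [e1 _ _ _] := cycle3P (level 0) i3.
  have := e1 0 (fun=> false) (level0 _); rewrite c1 /= => /(congr1 snd) /=.
  move/and3P: i3 => [i12 _ _] e12.
  by have := starts_incomparable i12 (starts_prefixed _ (fun=> false)); rewrite e12 starts_prefixed.
move=> N Nclosed [N1 NM NV NJ].
have [H|/existsNP[g /not_implyP[Ng g1]]] := pselect (forall g, N g -> g = 1%g).
  by left; apply/seteqP; split=> [x /H//|x ->].
right; apply/seteqP; split=> // x _.
pose N' : set S := [set f | exists2 y, N y & f = sg_bij y].
have N'sub : is_subgroup N'.
  split; first by exists 1%g.
    by move=> _ _ [y Ny ->] [z Nz ->]; exists (y * z)%g => //; apply: NM.
  by move=> _ [y Ny ->]; exists y^-1%g => //; apply: NV.
have N'G : N' `<=` gamma_group (encoding t) by move=> _ [y _ ->]; apply: sg_bijP.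
have N'J h k : gamma (encoding t) h -> N' k -> N' (h * k * h^-1)%g.
  move=> gh [y Ny ->]; pose hh := SolenoidGroup (gamma_gamma_group gh).
  by exists (y ^ hh^-1)%g; [exact: NJ|rewrite /conjg invgK mulgA].
have sub := normal_contains_gamma (encoding_continuous t) (encodingV_continuous t)
  N'sub N'G N'J (ex_intro2 _ _ g Ng erefl) (fun e => g1 (@sg_bij_inj g 1%g e)).
have Ngamma y : gamma (encoding t) (sg_bij y) -> N y.
  by move=> /sub[z Nz /sg_bij_inj->].
rewrite ((closure_id N).1 Nclosed) => A [n nA].
have [h [u [gh nu ge]]] := gamma_group_dense n (sg_bijP x).
pose y := SolenoidGroup (gamma_gamma_group gh).
exists y; split; first exact: Ngamma.
have -> : y = (x * sg_translate (- u))%g.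
  by apply: sg_bij_inj; rewrite -[RHS]/(sg_bij x * translate (- u))%g ge translateN mulgK.
by apply: nA; apply: levelN.
Qed.

End SolenoidGroup.

(** * The analytic structure *)

Lemma product_shift (G : groupType) (a u h1 b v h2 : G) :
  (b * v * h1 = h1 * (b * v))%g ->
  (a * (u * h1) * (b * (v * h2)) = a * u * (b * v) * (h1 * h2))%g.
Proof.
move=> c; rewrite !mulgA -(mulgA _ h1) -(mulgA _ (h1 * b)%g) -[(h1 * b * v)%g]mulgA -c.
by rewrite !mulgA.
Qed.

Section LieStructure.
Variables (p : nat) (p_pr : prime p) (d : nat) (t : nat -> bool).
Local Notation K := (Qp p_pr).
Local Notation abs := (@Qp_abs p p_pr).
Local Notation V := (integral_filtered p_pr d).
Local Notation G := (solenoid_group p_pr d t).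
Local Notation T := (@sg_translate p p_pr d t).
Implicit Types (a b g : G) (u v : V) (h x : 'rV[K]_d).

Definition integral_ball : set 'rV[K]_d := [set x | x \in @integral_pred p p_pr d].

(** Vectors outside [Zp^d] are sent to 0; in the charts only integral vectors matter. *)
Definition to_integral x : V := insubd (0 : integral_vec p_pr d) x.

Lemma to_integralK x : integral_ball x -> vec (to_integral x) = x.
Proof. by move=> xi; rewrite /to_integral -[vec _]/(val _) insubdK. Qed.

Lemma vecK u : to_integral (vec u) = u.
Proof. exact: valKd. Qed.

Lemma vec_integral u : integral_ball (vec u).
Proof. exact: (valP (u : integral_vec p_pr d)). Qed.

Lemma level_vec n h : in_polydisc (p%:R^-1 ^+ n) h -> exists2 u : V, level n u & vec u = h.
Proof.
move=> hn; have hi : integral_ball h.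
  apply/forallP => i; apply: le_trans (hn i) _.
  by rewrite -(expr0 p%:R^-1) pinv_le.
exists (to_integral h); last exact: to_integralK.
by rewrite /level /= => i; rewrite to_integralK.
Qed.

Definition coset_dom a : set G := [set g | exists u, g = (a * T u)%g].
Definition coset_map a g : 'rV[K]_d := vec (xget 0 [set u | g = (a * T u)%g]).
Definition coset_inv a x : G := (a * T (to_integral x))%g.

Lemma coset_map_translate a u : coset_map a (a * T u)%g = vec u.
Proof.
rewrite /coset_map; case: xgetP => [v _ /= /mulgI/sg_translate_inj<-//|/(_ u)]; by case.
Qed.

Lemma coset_inv_vec a u : coset_inv a (vec u) = (a * T u)%g.
Proof. by rewrite /coset_inv vecK. Qed.

Lemma coset_image a : coset_map a @` coset_dom a = integral_ball.
Proof.
apply/seteqP; split=> [_ [_ [u ->] <-]|x xi].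
  by rewrite coset_map_translate; apply: vec_integral.
exists (coset_inv a x); first by exists (to_integral x).
by rewrite coset_map_translate to_integralK.
Qed.

Lemma integral_ball_open : open integral_ball.
Proof.
rewrite openE => x /forallP xi; exists (fun i j => ball (x i j) 1).
  by move=> i j; apply: nbhsx_ballx.
move=> y xy; apply/forallP => i; have := xy 0 i; rewrite ballEmdist /= /mdist /= /Qp_dist => xyi.
by rewrite -[y 0 i](subKr (x 0 i)) Qp_absB_le // ltW.
Qed.

Lemma coset_dom_open a : open (coset_dom a).
Proof.
rewrite openE => _ [u ->]; exists 0%N => v _; exists (u + v).
by rewrite sg_translateD mulgA.
Qed.

Lemma coset_mapK a : {in coset_dom a, cancel (coset_map a) (coset_inv a)}.
Proof. by move=> _ /set_mem[u ->]; rewrite coset_map_translate coset_inv_vec. Qed.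

Lemma coset_map_continuous a : {within coset_dom a, continuous (coset_map a)}.
Proof.
apply: continuous_in_subspaceT => _ /set_mem[u ->].
have F := nbhs_filter (a * T u)%g.
apply: (proj2 (@cvg_ballP _ _ _ _ F (coset_map a) _)) => e e0.
have [n ne] := pinv_small p_pr e0.
exists n => v nv /=; rewrite coset_map_translate -mulgA -sg_translateD coset_map_translate.
split=> // i j; rewrite ord1 ballEmdist /= /mdist /= /Qp_dist; rewrite mxE opprD addNKr Qp_absN.
exact: le_lt_trans (nv j) ne.
Qed.

Lemma coset_inv_continuous a : {within coset_map a @` coset_dom a, continuous (coset_inv a)}.
Proof.
rewrite coset_image; apply: continuous_in_subspaceT => x /set_mem xi A [n nA].
have xE := to_integralK xi; set u := to_integral x in xE; rewrite -xE in nA *.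
exists (fun i j => ball (vec u i j) (p%:R^-1 ^+ n)).
  by move=> i j; apply: nbhsx_ballx; rewrite exprn_gt0 // pinv_gt0.
move=> y uy; have [|v nv vE] := @level_vec n (y - vec u).
  move=> i; have := uy 0 i; rewrite ballEmdist /= /mdist /= /Qp_dist !mxE Qp_absC.
  exact: ltW.
have -> : y = vec (u + v) by rewrite vecD vE addrC subrK.
rewrite coset_inv_vec in nA; rewrite /preimage /mkset coset_inv_vec sg_translateD mulgA.
exact: nA.
Qed.

Lemma coset_image_open a : open (coset_map a @` coset_dom a).
Proof. by rewrite coset_image; apply: integral_ball_open. Qed.

Definition coset_chart a : chart p_pr G d :=
  Chart (@coset_dom_open a) (@coset_image_open a) (@coset_mapK a)
    (@coset_map_continuous a) (@coset_inv_continuous a).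

Definition coset_atlas : set (chart p_pr G d) := range coset_chart.

(** If [a T(u) = b T(v)] then [a T(u + w) = b T(v + w)]: a change of charts is a translation of
    coordinates. *)
Lemma coset_analytic_atlas : analytic_atlas coset_atlas.
Proof.
split=> [g|_ _ [a _ <-] [b _ <-]].
  by exists (coset_chart g); [exists g|exists 0; rewrite sg_translate0 mulg1].
move=> _ [_ [/= [u ->] [v e]] <-] j; rewrite coset_map_translate.
apply: (@affine_analytic_at _ _ _ _ _ 1 1 [:: j]) => // h h1.
have [w nw <-] := @level_vec 0 h h1.
rewrite big_seq1 mul1r /= -vecD !coset_inv_vec sg_translateD mulgA e.
by rewrite -mulgA -sg_translateD !coset_map_translate vecD mxE.
Qed.

(** Small increments of the first factor commute with the second factor, so near a given pair the
    product is the sum of the two increments in the coordinates of the target coset. *)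
Lemma coset_mulg_analytic c1 c2 c3 : coset_atlas c1 -> coset_atlas c2 -> coset_atlas c3 ->
    analytic_on
      [set z : 'rV[K]_(d + d) |
        [/\ (chart_map c1 @` chart_dom c1) (lsubmx z),
            (chart_map c2 @` chart_dom c2) (rsubmx z) &
            chart_dom c3 (chart_inv c1 (lsubmx z) * chart_inv c2 (rsubmx z))%g]]
      (fun z => chart_map c3 (chart_inv c1 (lsubmx z) * chart_inv c2 (rsubmx z))%g).
Proof.
move=> [a _ <-] [b _ <-] [c _ <-] z [zl zr [/= w e]] j.
have /to_integralK lz : integral_ball (lsubmx z) by rewrite -(coset_image a).
have /to_integralK rz : integral_ball (rsubmx z) by rewrite -(coset_image b).
set u := to_integral (lsubmx z) in lz; set v := to_integral (rsubmx z) in rz.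
rewrite -lz -rz !coset_inv_vec in e.
have [n nb] := sg_centralises (b * T v)%g.
apply: (@affine_analytic_at _ _ _ _ _ (p%:R^-1 ^+ n) 1 [:: lshift d j; rshift d j]).
  by rewrite exprn_gt0 // pinv_gt0.
move=> h hn.
have [h1 n1 e1] : exists2 h1 : V, level n h1 & vec h1 = lsubmx h.
  by apply: level_vec => i; rewrite mxE.
have [h2 n2 e2] : exists2 h2 : V, level n h2 & vec h2 = rsubmx h.
  by apply: level_vec => i; rewrite mxE.
have -> : lsubmx (z + h) = vec (u + h1) by rewrite vecD lz e1; apply/rowP => i; rewrite !mxE.
have -> : rsubmx (z + h) = vec (v + h2) by rewrite vecD rz e2; apply/rowP => i; rewrite !mxE.
rewrite -lz -rz !coset_inv_vec.
rewrite !sg_translateD.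
have -> : (a * (T u * T h1) * (b * (T v * T h2)) = c * T (w + (h1 + h2)))%g.
  by rewrite (product_shift _ _ _ (nb _ n1)) e !sg_translateD; apply/esym/mulgA.
rewrite e !coset_map_translate !vecD mxE [X in _ + X]mxE e1 e2 !mxE mul1r.
by rewrite big_cons big_seq1.
Qed.

Lemma coset_invg_analytic c1 c2 : coset_atlas c1 -> coset_atlas c2 ->
    analytic_on
      [set z | (chart_map c1 @` chart_dom c1) z /\ chart_dom c2 ((chart_inv c1 z)^-1)%g]
      (fun z => chart_map c2 ((chart_inv c1 z)^-1)%g).
Proof.
move=> [a _ <-] [b _ <-] z [zi [/= w e]] j.
have /to_integralK zE : integral_ball z by rewrite -(coset_image a).
set u := to_integral z in zE; rewrite -zE coset_inv_vec in e; rewrite -zE.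
have [n nb] := sg_centralises ((a * T u)^-1)%g.
apply: (@affine_analytic_at _ _ _ _ _ (p%:R^-1 ^+ n) (-1) [:: j]).
  by rewrite exprn_gt0 // pinv_gt0.
move=> h /level_vec[v nv <-]; rewrite -vecD !coset_inv_vec sg_translateD mulgA.
rewrite invgM -sg_translateN -nb; last exact: levelN.
rewrite e -mulgA -sg_translateD !coset_map_translate vecD vecN !mxE.
by rewrite big_seq1 mulN1r.
Qed.

Definition solenoid_lie_group : padicLieGroup p_pr :=
  PadicLieGroup (@sg_hausdorff p p_pr d t) coset_analytic_atlas
    coset_mulg_analytic coset_invg_analytic.

End LieStructure.

(** * The Lie algebra *)

Section LieAlgebraOfSolenoid.
Variables (p : nat) (p_pr : prime p) (d : nat) (t : nat -> bool).
Local Notation K := (Qp p_pr).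
Local Notation abs := (@Qp_abs p p_pr).
Local Notation V := (integral_filtered p_pr d).
Local Notation G := (solenoid_lie_group p_pr d t).
Local Notation T := (@sg_translate p p_pr d t).
Local Notation M := {ffun 'I_d -> nat}.
Implicit Types (f g : G -> K) (u v : V) (h : 'rV[K]_d) (s : M -> K) (i j : 'I_d).

Definition coordinates (x : G) : 'rV[K]_d := coset_map 1%g x.
Definition parametrization h : G := T (to_integral h).

Lemma coordinates_translate u : coordinates (T u) = vec u.
Proof. by rewrite /coordinates -[T u]mul1g coset_map_translate. Qed.

Lemma in_polydisc_integral r h : r <= 1 -> in_polydisc r h -> integral_ball h.
Proof. by move=> r1 hr; apply/forallP => i; apply: le_trans (hr i) r1. Qed.

Lemma parametrizationK r h : r <= 1 -> in_polydisc r h -> coordinates (parametrization h) = h.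
Proof.
by move=> r1 hr; rewrite coordinates_translate to_integralK //; apply: in_polydisc_integral hr.
Qed.

(** The bound [r <= 1] keeps the polydisc inside [Zp^d], where [parametrization] inverts the chart
    at 1. *)
Definition germ_expansion r f s := r <= 1 /\ expansion r (f \o parametrization) 0 s.

(** One chart suffices: any other chart around 1 differs from it by a translation of coordinates,
    which leaves the coefficients unchanged. *)
Lemma analytic_at_oneP f : analytic_at_one f <-> exists r s, germ_expansion r f s.
Proof.
split=> [fa|[r [s [r1 fs]]] _ [a _ <-] [u e]].
  have := fa (coset_chart 1%g) (imageP _ I).
  rewrite /= (_ : coset_map 1 1 = 0)%g; last first.
    have := coset_map_translate (1 : G)%g 0; rewrite sg_translate0 mulg1 => ->.
    exact: vec0.
  move=> /(_ _)/analytic_atP [|s [r fs]].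
    by exists 0; rewrite sg_translate0 mulg1.
  have [r0 _ _] := fs; have m0 : 0 < Num.min r 1 by rewrite lt_min r0 ltr01.
  exists (Num.min r 1), s; split; first by rewrite ge_min lexx orbT.
  have : expansion (Num.min r 1) (f \o coset_inv 1%g) 0 s.
    by apply: expansion_le m0 _ fs; rewrite ge_min lexx.
  by apply: expansion_local => h _; rewrite /= /coset_inv mul1g.
apply/analytic_atP; exists s, r.
have -> : chart_map (coset_chart a) 1%g = vec u by rewrite [in LHS]e /= coset_map_translate.
have [r0 sn sf] := fs; split=> // h hr.
have := sf h hr; rewrite add0r /=; congr has_sum; congr f.
have hi := in_polydisc_integral r1 hr.
rewrite -{2}[h]to_integralK // -(vecD u) coset_inv_vec sg_translateD mulgA.
by rewrite -e mul1g.
Qed.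

Lemma germ_expansion_le r r' f s : 0 < r' -> r' <= r -> germ_expansion r f s ->
  germ_expansion r' f s.
Proof.
by move=> r0 rr [r1 fs]; split; [exact: le_trans rr r1|exact: expansion_le r0 rr fs].
Qed.

Lemma germ_expansion_common r r' f g s s' : germ_expansion r f s -> germ_expansion r' g s' ->
  exists2 r0, germ_expansion r0 f s & germ_expansion r0 g s'.
Proof.
move=> fs gs; have [_ [r0 _ _]] := fs; have [_ [r0' _ _]] := gs.
have m0 : 0 < Num.min r r' by rewrite lt_min r0.
by exists (Num.min r r'); [apply: germ_expansion_le m0 _ fs|apply: germ_expansion_le m0 _ gs];
  rewrite ge_min lexx ?orbT.
Qed.

Lemma germ_expansion_linear r c f g s s' : germ_expansion r f s -> germ_expansion r g s' ->
  germ_expansion r (fun x => c * f x + g x) (fun a => c * s a + s' a).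
Proof. by move=> [r1 fs] [_ gs]; split=> //; apply: expansion_linear. Qed.

Lemma germ_expansionM r f g s s' : germ_expansion r f s -> germ_expansion r g s' ->
  germ_expansion r (fun x => f x * g x) (cauchy_product s s').
Proof. by move=> [r1 fs] [_ gs]; split=> //; apply: expansionM. Qed.

Lemma germ_expansion_at r f s : germ_expansion r f s -> f 1%g = s 0.
Proof.
move=> [_ /expansion_at <-] /=; congr f; rewrite /parametrization.
have -> : to_integral 0 = 0 :> V by rewrite -[X in to_integral X](vec0 p_pr d) vecK.
by rewrite sg_translate0.
Qed.

Lemma germ_expansion_coordinates r (F : 'rV[K]_d -> K) s : r <= 1 -> expansion r F 0 s ->
  germ_expansion r (F \o coordinates) s.
Proof.
move=> r1 Fs; split=> //; apply: expansion_local Fs => h hr.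
by rewrite add0r /= (parametrizationK r1).
Qed.

Definition locally_equal f g := exists n, forall u, level n u -> f (T u) = g (T u).

Lemma germ_expansion_local r f g s : locally_equal f g -> germ_expansion r f s ->
  exists r', germ_expansion r' g s.
Proof.
move=> [n fg] fs; have [_ [r0 _ _]] := fs.
have pn0 : 0 < (p%:R^-1 : rat) ^+ n by rewrite exprn_gt0 // pinv_gt0.
have m0 : 0 < Num.min r (p%:R^-1 ^+ n) by rewrite lt_min r0.
exists (Num.min r (p%:R^-1 ^+ n)).
have [r1 fs'] : germ_expansion (Num.min r (p%:R^-1 ^+ n)) f s.
  by apply: germ_expansion_le m0 _ fs; rewrite ge_min lexx.
split=> //; apply: expansion_local fs' => h hr; rewrite add0r /=.
have [i|u nu <-] := @level_vec p p_pr d n h.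
  by apply: le_trans (hr i) _; rewrite ge_min lexx orbT.
by rewrite /parametrization vecK fg.
Qed.

Lemma germ_expansion_const (c : K) : germ_expansion 1 (fun=> c)
  (fun a => (c - 1) * (a == 0)%:R + (a == 0)%:R).
Proof. by split=> //; apply: expansion_const. Qed.

Lemma analytic_const (c : K) : analytic_at_one (fun _ : G => c).
Proof. by apply/analytic_at_oneP; exists 1; eexists; apply: germ_expansion_const. Qed.

Lemma analytic_linear c f g : analytic_at_one f -> analytic_at_one g ->
  analytic_at_one (fun x => c * f x + g x).
Proof.
move=> /analytic_at_oneP[r [s fs]] /analytic_at_oneP[r' [s' gs]].
have [r0 fs0 gs0] := germ_expansion_common fs gs.
by apply/analytic_at_oneP; exists r0; eexists; apply: germ_expansion_linear fs0 gs0.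
Qed.

Lemma analyticM f g : analytic_at_one f -> analytic_at_one g ->
  analytic_at_one (fun x => f x * g x).
Proof.
move=> /analytic_at_oneP[r [s fs]] /analytic_at_oneP[r' [s' gs]].
have [r0 fs0 gs0] := germ_expansion_common fs gs.
by apply/analytic_at_oneP; exists r0; eexists; apply: germ_expansionM fs0 gs0.
Qed.

Lemma analytic_local f g : locally_equal f g -> analytic_at_one f -> analytic_at_one g.
Proof.
move=> fg /analytic_at_oneP[r [s /(germ_expansion_local fg)[r' gs]]].
by apply/analytic_at_oneP; exists r', s.
Qed.

Definition coordinate i (x : G) : K := coordinates x 0 i.

Lemma germ_expansion_coordinate i : germ_expansion 1 (coordinate i)
  (fun a => (a == unit_exponent i)%:R).
Proof.
have := germ_expansion_coordinates (lexx 1)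
  (@expansion_monomial p p_pr d 1 0 (unit_exponent i) ltr01).
by move=> [r1 h]; split=> //; apply: expansion_local h => h' _; rewrite /= subr0 monomial_unit.
Qed.

Lemma analytic_coordinate i : analytic_at_one (coordinate i).
Proof. by apply/analytic_at_oneP; exists 1; eexists; apply: germ_expansion_coordinate. Qed.

(** Well defined by [linear_coefficient_unique]; the default 0 agrees with the convention for point
    derivations outside the analytic functions. *)
Definition gradient i f : K :=
  xget 0 [set c | exists r s, germ_expansion r f s /\ c = s (unit_exponent i)].

Lemma gradientE r i f s : germ_expansion r f s -> gradient i f = s (unit_exponent i).
Proof.
move=> fs; rewrite /gradient; case: xgetP =>
  [c _ [r' [s' [[_ fs'] cs]]]|/(_ (s (unit_exponent i)))].
  rewrite cs.
  by case: fs => _ fs; apply: linear_coefficient_unique fs' fs.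
by case; exists r, s.
Qed.

Lemma gradient_coordinate i j : gradient i (coordinate j) = (i == j)%:R.
Proof.
rewrite (gradientE _ (germ_expansion_coordinate j)); congr (_%:R); congr nat_of_bool.
apply/eqP/eqP => [/ffunP/(_ i)|->//]; rewrite !ffunE eqxx; by case: eqP.
Qed.

Lemma gradient_linear i c f g : analytic_at_one f -> analytic_at_one g ->
  gradient i (fun x => c * f x + g x) = c * gradient i f + gradient i g.
Proof.
move=> /analytic_at_oneP[r [s fs]] /analytic_at_oneP[r' [s' gs]].
have [r0 fs0 gs0] := germ_expansion_common fs gs.
by rewrite (gradientE i (germ_expansion_linear c fs0 gs0)) (gradientE i fs) (gradientE i gs).
Qed.

Lemma gradientM i f g : analytic_at_one f -> analytic_at_one g ->
  gradient i (fun x => f x * g x) = gradient i f * g 1%g + f 1%g * gradient i g.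
Proof.
move=> /analytic_at_oneP[r [s fs]] /analytic_at_oneP[r' [s' gs]].
have [r0 fs0 gs0] := germ_expansion_common fs gs.
rewrite (gradientE i (germ_expansionM fs0 gs0)) (gradientE i fs) (gradientE i gs).
by rewrite cauchy_product_unit (germ_expansion_at fs) (germ_expansion_at gs).
Qed.

Lemma gradient0 i f : ~ analytic_at_one f -> gradient i f = 0.
Proof.
move=> nf; rewrite /gradient; case: xgetP => // c _ [r [s [fs _]]].
by case: nf; apply/analytic_at_oneP; exists r, s.
Qed.

Lemma directional_derivation_proof (c : 'rV[K]_d) :
  (fun f : G -> K => \sum_i c 0 i * gradient i f : K^o) \in @point_derivation p p_pr G.
Proof.
apply/asboolP; split=> [a f g fa ga|f g fa ga|f nf].
- rewrite mulr_sumr -big_split; apply: eq_bigr => i _ /=.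
  by rewrite gradient_linear // mulrDr mulrCA.
- rewrite mulr_suml mulr_sumr -big_split; apply: eq_bigr => i _ /=.
  by rewrite gradientM // mulrDr mulrA mulrCA.
- by rewrite big1 // => i _; rewrite gradient0 // mulr0.
Qed.

Definition directional_derivation c : lie_algebra G := LieAlgebra (directional_derivation_proof c).

Section Derivation.
Variable D : lie_algebra G.

Lemma derivation_linear (a : K) f g : analytic_at_one f -> analytic_at_one g ->
  D (fun x => a * f x + g x) = a * D f + D g.
Proof. by have /asboolP[h _ _] := valP D; apply: h. Qed.

Lemma derivationM f g : analytic_at_one f -> analytic_at_one g ->
  D (fun x => f x * g x) = D f * g 1%g + f 1%g * D g.
Proof. by have /asboolP[_ h _] := valP D; apply: h. Qed.

Lemma derivation_not_analytic f : ~ analytic_at_one f -> D f = 0.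
Proof. by have /asboolP[_ _ h] := valP D; apply: h. Qed.

Lemma derivation_zero : D (fun=> 0) = 0.
Proof.
have := derivation_linear 1 (analytic_const 0) (analytic_const 0).
have -> : (fun _ : G => 1 * 0 + 0) = (fun=> 0 : K) by apply/funext => x; rewrite mulr0 addr0.
by rewrite mul1r => /eqP; rewrite -subr_eq0 opprD addrA subrr sub0r oppr_eq0 => /eqP.
Qed.

Lemma derivation_const (c : K) : D (fun=> c) = 0.
Proof.
have one : D (fun=> 1) = 0.
  have := derivationM (analytic_const 1) (analytic_const 1).
  have -> : (fun _ : G => 1 * 1) = (fun=> 1 : K) by apply/funext => x; rewrite mulr1.
  by rewrite mul1r mulr1 => /eqP; rewrite -subr_eq0 opprD addrA subrr sub0r oppr_eq0 => /eqP.
have := derivation_linear c (analytic_const 1) (analytic_const 0).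
have -> : (fun _ : G => c * 1 + 0) = (fun=> c) by apply/funext => x; rewrite mulr1 addr0.
by rewrite one derivation_zero mulr0 addr0.
Qed.

(* A function vanishing near 1 is its own product with the indicator of the complement. *)
Lemma derivation_locally_zero f : locally_equal (fun=> 0) f -> D f = 0.
Proof.
move=> f0; have fa := analytic_local f0 (analytic_const 0).
have [n fn] := f0.
pose chi (x : G) : K := if `[< exists2 u, level n u & x = T u >] then 0 else 1.
have chi0 : locally_equal (fun=> 0) chi.
  by exists n => u nu; rewrite /chi asboolT //; exists u.
have -> : f = (fun x => f x * chi x).
  apply/funext => x; rewrite /chi; case: asboolP => [[u nu ->]|_]; last by rewrite mulr1.
  by rewrite -fn // mulr0.
have one : (1%g : G) = T 0 by rewrite sg_translate0.
have n0 : level n (0 : V) by apply: (level_zmod _ n).1.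
rewrite derivationM //; last exact: analytic_local chi0 (analytic_const 0).
rewrite (_ : f 1%g = 0); last by rewrite one -fn.
by rewrite (_ : chi 1%g = 0) ?mulr0 ?mul0r ?addr0 // /chi asboolT //; exists 0.
Qed.

Lemma derivation_local f g : analytic_at_one g -> locally_equal f g -> D f = D g.
Proof.
move=> ga [n fg].
have e0 : locally_equal (fun=> 0) (fun x => -1 * g x + f x).
  by exists n => u nu; rewrite fg // mulN1r addNr.
have fa : analytic_at_one f by apply: analytic_local ga; exists n => u /fg.
have := derivation_locally_zero e0; rewrite derivation_linear // mulN1r addrC.
by move=> /eqP; rewrite subr_eq0 => /eqP.
Qed.

Lemma derivation_sum (I : Type) (l : seq I) (F : I -> G -> K) :
  (forall k, analytic_at_one (F k)) ->
  analytic_at_one (fun x => \sum_(k <- l) F k x) /\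
  D (fun x => \sum_(k <- l) F k x) = \sum_(k <- l) D (F k).
Proof.
move=> Fa; elim: l => [|k l [IHa IHl]].
  rewrite big_nil (_ : (fun x => \sum_(k <- [::]) F k x) = (fun=> 0)).
    by split; [apply: analytic_const|apply: derivation_zero].
  by apply/funext => x; rewrite big_nil.
rewrite big_cons (_ : (fun x => \sum_(k' <- k :: l) F k' x) =
    (fun x => 1 * F k x + \sum_(k' <- l) F k' x)).
  by split; [apply: analytic_linear|rewrite derivation_linear // mul1r IHl].
by apply/funext => x; rewrite big_cons mul1r.
Qed.

(** Near 1, Hadamard's lemma writes [f] as [f 1] plus the sum of the products [coordinate i * q i].
    The coordinates vanish at 1 and [q i] takes the value [gradient i f] there, so the Leibniz rule
    gives the formula. *)
Lemma derivation_gradient f : analytic_at_one f -> D f = \sum_i D (coordinate i) * gradient i f.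
Proof.
move=> /analytic_at_oneP[r [s fs]]; have [r1 fs0] := fs; have [r0 sn _] := fs0.
pose q i : G -> K :=
  (fun h => Qp_sum (fun b => hadamard_coefficients i s b * monomial b (h - 0))) \o coordinates.
have qs i : germ_expansion r (q i) (hadamard_coefficients i s).
  apply: germ_expansion_coordinates => //.
  by apply: expansion_Qp_sum => //; apply: weighted_null_hadamard.
have qa i : analytic_at_one (q i) by apply/analytic_at_oneP; exists r; eexists; apply: qs.
have xqa i : analytic_at_one (fun x => coordinate i x * q i x).
  by apply: analyticM => //; apply: analytic_coordinate.
have [Sa SD] := derivation_sum (index_enum 'I_d) xqa.
rewrite (@derivation_local _ (fun x => 1 * s 0 + \sum_i coordinate i x * q i x)).
- rewrite (derivation_linear 1 (analytic_const (s 0)) Sa) derivation_const mulr0 add0r SD.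
  apply: eq_bigr => i _; rewrite derivationM //; last exact: analytic_coordinate.
  rewrite (germ_expansion_at (germ_expansion_coordinate i)) (germ_expansion_at (qs i)).
  rewrite eq_sym -mdegree_eq0 mdegree_unit mul0r addr0 (gradientE i fs).
  congr (_ * _); rewrite /hadamard_coefficients add0r ifT //.
  by apply/forallP => j; rewrite ffunE eqxx implybT.
- exact: (analytic_linear 1 (analytic_const (s 0)) Sa).
have [n nr] := pinv_small p_pr r0; exists n => u nu.
have ur : in_polydisc r (vec u) by move=> i; apply: le_trans (nu i) (ltW nr).
have := expansion_hadamard fs0 ur; rewrite add0r /= /parametrization vecK => ->.
rewrite -[RHS]/(1 * s 0 + \sum_i coordinate i (T u) * q i (T u)) (mul1r (s 0)).
apply: (congr1 (+%R (s 0))).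
apply: eq_bigr => i _.
by rewrite /coordinate /q /= coordinates_translate subr0.
Qed.

End Derivation.

(** A derivation corresponds to the row of its values on the coordinates, with inverse
    [directional_derivation]. *)
Lemma lie_dimension_solenoid : lie_dimension G d.
Proof.
constructor; exists (fun D : lie_algebra G => \row_i D (coordinate i)).
  by move=> a D E; apply/rowP => i; rewrite !mxE.
exists directional_derivation => [D|c].
  apply: val_inj; apply/funext => f /=.
  have [fa|nf] := pselect (analytic_at_one f).
    by rewrite derivation_gradient //; apply: eq_bigr => i _; rewrite mxE.
  by rewrite derivation_not_analytic // big1 // => i _; rewrite gradient0 // mulr0.
apply/rowP => i; rewrite mxE /= (bigD1 i) //= gradient_coordinate eqxx mulr1.
by rewrite big1 ?addr0 // => j ji; rewrite gradient_coordinate (negPf ji) mulr0.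
Qed.

(** For [x] near 1, left translation by [x] is recentring of the series, so the inner derivation is
    a combination of the partial derivatives of [f] at [x]; the outer one then yields second
    derivatives at 1. *)
Lemma iterated_derivation (D E : lie_algebra G) r f s : germ_expansion r f s ->
  D (fun x => E (fun y => f (x * y)%g)) = \sum_i \sum_j
    E (coordinate i) * D (coordinate j) * partial_coefficients i s (unit_exponent j).
Proof.
move=> fs; have [r1 fs0] := fs; have [r0 sn _] := fs0.
pose P i : G -> K :=
  (fun h => Qp_sum (fun b => partial_coefficients i s b * monomial b (h - 0))) \o coordinates.
have Ps i : germ_expansion r (P i) (partial_coefficients i s).
  apply: germ_expansion_coordinates => //.
  by apply: expansion_Qp_sum => //; apply: weighted_null_partial.
have Pa i : analytic_at_one (P i) by apply/analytic_at_oneP; exists r; eexists; apply: Ps.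
have ePa i : analytic_at_one (fun x => E (coordinate i) * P i x).
  exact: analyticM (analytic_const _) (Pa i).
have [Sa SD] := derivation_sum D (index_enum 'I_d) ePa.
rewrite (@derivation_local D _ (fun x => \sum_i E (coordinate i) * P i x)) //.
  rewrite SD; apply: eq_bigr => i _.
  rewrite derivationM //; last exact: analytic_const.
  rewrite derivation_const mul0r add0r (derivation_gradient D (Pa i)) mulr_sumr.
  by apply: eq_bigr => j _; rewrite (gradientE j (Ps i)) mulrA.
have [n nr] := pinv_small p_pr r0; exists n => u nu.
have ur : in_polydisc r (vec u) by move=> i; apply: le_trans (nu i) (ltW nr).
have gs : germ_expansion r (fun y => f (T u * y)%g) (recentered s (vec u)).
  split=> //; have [_ rn rs] := expansion_recenter ur fs0.
  split=> // h hr; have := rs h hr; rewrite !add0r /=; congr has_sum; congr f.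
  have hi := in_polydisc_integral r1 hr.
  by rewrite /parametrization -{1}[h]to_integralK // -(vecD u) vecK sg_translateD.
rewrite derivation_gradient; last by apply/analytic_at_oneP; exists r; eexists; apply: gs.
apply: eq_bigr => i _; congr (_ * _).
rewrite (gradientE i gs) (recentered_unit i r0 ur sn) /P /= coordinates_translate.
by rewrite subr0.
Qed.

(** The second derivatives are symmetric in [i] and [j], so exchanging the sums identifies the two
    iterated derivations. *)
Lemma lie_algebra_abelian_solenoid : lie_algebra_abelian G.
Proof.
move=> D E; apply/funext => f; rewrite /lie_bracket; case: asboolP => // fa.
have [r [s fs]] := (analytic_at_oneP f).1 fa.
rewrite (iterated_derivation D E fs) (iterated_derivation E D fs) [X in _ - X]exchange_big.
apply/eqP; rewrite subr_eq0; apply/eqP; apply: eq_bigr => i _; apply: eq_bigr => j _.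
rewrite [D _ * _]mulrC /partial_coefficients addrC !ffunE eq_sym.
by [].
Qed.

End LieAlgebraOfSolenoid.

(** * Pairwise non-isomorphic groups *)

Section AbstractIsomorphism.

Lemma abstractly_isomorphic_refl (G : groupType) : abstractly_isomorphic G G.
Proof. by exists (idfun : {multiplicative G -> G}); exists idfun. Qed.

Lemma abstractly_isomorphic_trans (G H L : groupType) :
  abstractly_isomorphic G H -> abstractly_isomorphic H L -> abstractly_isomorphic G L.
Proof.
move=> [f fb] [g gb]; exists (g \o f : {multiplicative G -> L}).
exact: bij_comp gb fb.
Qed.

Section Inverse.
Variables (G H : groupType) (f : {multiplicative G -> H}) (g : H -> G).
Hypotheses (fK : cancel f g) (gK : cancel g f).

(** The cancellation proofs are arguments so that a multiplicative structure can be attached to the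
    map. *)
Definition inverse_morphism of cancel f g & cancel g f := g.

Fact inverse_morphismM : {morph inverse_morphism fK gK : x y / (x * y)%g}.
Proof. by move=> x y; apply: (can_inj fK); rewrite gmulfM !gK. Qed.

HB.instance Definition _ := isMultiplicative.Build H G (inverse_morphism fK gK) inverse_morphismM.

Lemma abstractly_isomorphic_inverse : abstractly_isomorphic H G.
Proof. by exists (inverse_morphism fK gK : {multiplicative H -> G}); exists f. Qed.
End Inverse.

Lemma abstractly_isomorphic_sym (G H : groupType) :
  abstractly_isomorphic G H -> abstractly_isomorphic H G.
Proof. by move=> [f [g fK gK]]; apply: abstractly_isomorphic_inverse fK gK. Qed.

Lemma commutation_pattern_morph (G H : groupType) (f : G -> H) g1 g2 g3 m :
  {morph f : x y / (x * y)%g} -> injective f ->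
  commutation_pattern (f g1) (f g2) (f g3) m <-> commutation_pattern g1 g2 g3 m.
Proof.
move=> fM fi; have f1 : f 1%g = 1%g by apply: (mulgI (f 1%g)); rewrite -fM !mulg1.
have fX x k : f (x ^+ k)%g = (f x ^+ k)%g.
  by elim: k => // k IHk; rewrite !expgS fM IHk.
have fV x : f (x^-1)%g = ((f x)^-1)%g by apply: (mulgI (f x)); rewrite -fM !mulgV.
rewrite /commutation_pattern -fX -fV -!fM /commute -!fM.
by split=> [/fi|->].
Qed.

End AbstractIsomorphism.

(* Writing 2^N as (2^N)^N, a diagonal argument gives an n such that the n-th slice *)
(* of the n-th listed element of a class takes all values.                        *)
Lemma inequivalent_family (E : (nat -> bool) -> (nat -> bool) -> Prop) :
  (forall s, E s s) -> (forall s t, E s t -> E t s) ->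
  (forall r s t, E r s -> E s t -> E r t) ->
  (forall t, exists e : nat -> (nat -> bool), forall s, E s t -> exists k, e k = s) ->
  exists F : (nat -> bool) -> (nat -> bool), forall s t, s <> t -> ~ E (F s) (F t).
Proof.
move=> Er Es Et /choice[e eP].
(* A canonical representative makes the listing [e (rep t)] the same for equivalent sequences. *)
pose rep t := xget (fun=> false) [set s | E s t].
have repE t : E (rep t) t by rewrite /rep; case: xgetP => // /(_ t); case; apply: Er.
have rep_eq s t : E s t -> rep s = rep t.
  move=> st; rewrite /rep; congr xget; apply/seteqP; split=> r /= h; first exact: Et h st.
  exact: Et h (Es _ _ st).
pose slice (n : nat) (c : nat -> bool) : nat -> bool := fun k => c (pickle (n, k)).
have [n nP] : exists n, forall c, exists s, slice n (e (rep s) n) = c.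
  apply: contrapT => /forallNP H.
  have /choice[c cP] : forall n, exists c, forall s, slice n (e (rep s) n) <> c.
    by move=> n; have /existsNP[c /forallNP] := H n; exists c.
  pose t i := if @unpickle (nat * nat)%type i is Some (n, k) then c n k else false.
  have [k ek] := eP _ t (Es _ _ (repE t)); apply: (cP k t); rewrite ek.
  by apply/funext => j; rewrite /slice /t pickleK.
have [F0 F0P] := choice nP; exists (fun c => rep (F0 c)) => c c' cc' /rep_eq.
rewrite !(rep_eq _ _ (repE _)) => e0; apply: cc'.
by rewrite -(F0P c) -(F0P c') e0.
Qed.

Section Patterns.
Variables (p : nat) (p_pr : prime p) (d : nat).
Local Notation G := (solenoid_lie_group p_pr d).

(** The three elements that encode [s] are carried over by the isomorphism with their pattern, and
    [gamma_group_pattern] moves them into the countable group of [t]. *)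
Lemma isomorphic_pattern s t : abstractly_isomorphic (G s) (G t) ->
  exists h1 h2 h3 : selfbij (integral_filtered p_pr d * (nat -> bool)),
    [/\ gamma (encoding t) h1, gamma (encoding t) h2, gamma (encoding t) h3 &
        forall m, commutation_pattern h1 h2 h3 m <-> s m = false].
Proof.
move=> [f /bij_inj fi].
have [g1 [g2 [g3 [G1 G2 G3 gP]]]] := gamma_encodes (integral_filtered p_pr d) s.
pose lift g (gg : gamma (encoding s) g) : G s := SolenoidGroup (gamma_gamma_group gg).
have [h1 [h2 [h3 [H1 H2 H3 hP]]]] := gamma_group_pattern
  (encoding_continuous t) (encodingV_continuous t) (sg_bijP (f (lift g1 G1)))
  (sg_bijP (f (lift g2 G2))) (sg_bijP (f (lift g3 G3))).
exists h1, h2, h3; split=> // m; rewrite -hP -gP.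
rewrite (@commutation_pattern_morph (G t) _ (@sg_bij p p_pr d t)) //; last exact: sg_bij_inj.
rewrite (@commutation_pattern_morph (G s) (G t) f _ _ _ _ (@gmulfM _ _ f) fi).
rewrite -(@commutation_pattern_morph (G s) _ (@sg_bij p p_pr d s)) //; exact: sg_bij_inj.
Qed.

(** A triple of elements of the countable group of [t] determines the sequence it encodes, and there
    are only countably many triples. *)
Lemma isomorphism_class_countable t : exists e : nat -> (nat -> bool),
  forall s, abstractly_isomorphic (G s) (G t) -> exists k, e k = s.
Proof.
have [J [e eP]] := gamma_countable (integral_filtered p_pr d) (encoding t).
exists (fun k => if @unpickle (J * J * J)%type k is Some (a, b, c) then
  fun m => ~~ `[< commutation_pattern (e a) (e b) (e c) m >] else fun=> false).
move=> s /isomorphic_pattern[_ [_ [_ [/eP[a _ <-] /eP[b _ <-] /eP[c _ <-] hP]]]].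
exists (pickle (a, b, c)); rewrite pickleK; apply/funext => m.
case sm: (s m); last by rewrite asboolT //; apply/hP.
by rewrite asboolF // => /hP; rewrite sm.
Qed.

End Patterns.

Theorem theorem1p2 (p : nat) (p_pr : prime p) (d : nat) (d_gt0 : (0 < d)%N) :
  exists G : (nat -> bool) -> padicLieGroup p_pr,
    (forall s, [/\ second_countable (T := G s), topologically_simple (G s),
                   lie_dimension (G s) d & lie_algebra_abelian (G s)]) /\
    (forall s t, s <> t -> ~ abstractly_isomorphic (G s) (G t)).
Proof.
pose G := solenoid_lie_group p_pr d.
have [F FP] := @inequivalent_family (fun s t => abstractly_isomorphic (G s) (G t))
  (fun s => @abstractly_isomorphic_refl (G s))
  (fun s t => @abstractly_isomorphic_sym (G s) (G t))
  (fun r s t => @abstractly_isomorphic_trans (G r) (G s) (G t))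
  (@isomorphism_class_countable p p_pr d).
(* Distinct parameters of [G] may give isomorphic groups; [F] selects a family of pairwise
   inequivalent ones, indexed by all binary sequences. *)
exists (fun s => G (F s)); split=> // s; split.
- exact: sg_second_countable.
- exact: sg_topologically_simple.
- exact: lie_dimension_solenoid.
- exact: lie_algebra_abelian_solenoid.
Qed.
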